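(* Let $\{(y_i,x_i)\}_{i\in[n]}$ be an i.i.d. sample from the generalized linear model of the context with true parameter $\beta^*\in\Theta_0$, and suppose (D) and (G) of the context hold. There are constants $0<\alpha\le\gamma<\infty$, $C_0<\infty$, $L_{\psi,0}<\infty$, depending only on the fixed model ingredients in (D), (G) and on $b_0$, namely constants such that for every deterministic $L_\psi\ge L_{\psi,0}$ and every $n\ge C_0d\log(en)$, $$\mathbb P\Big(\alpha I_d\preceq\tfrac1n\sum_{i=1}^n\psi_{L_\psi}''(x_i^\top\beta)x_ix_i^\top\preceq\gamma I_d\ \ \forall\beta\in\Theta_0\Big)\ge1-n^{-2},$$ for which the following holds. Suppose $n\ge C_0d\log(en)$, $0<\varepsilon<1$ and $0<\delta\le n^{-1}$. Initialize the algorithm of the context (noisy projected gradient descent) at $\beta^0=0$ and choose $$\eta^0=\frac2{\alpha+\gamma},\quad L_x=C_xK_x\sqrt{d+\log n},\quad L_\psi=L_{\psi,0}+C_\psi K_xb_0\sqrt{\log n},\quad S_\psi=|\psi'(0)|+2c_2L_\psi,$$ $$R=|\psi'(0)|+c_2L_\psi+\sqrt{6c_2c(\sigma)\log n},\quad B=4(R+S_\psi)L_x,\quad T=\left\lceil\frac{\log(\max\{nb_0,n\})}{-\log\rho}\right\rceil,$$ where $\rho=\max\{1/2,(\gamma-\alpha)/(\gamma+\alpha)\}$ and $C_x,C_\psi$ are sufficiently large absolute constants. Then the algorithm is $(\varepsilon,\delta)$-differentially private and its output $\beta^T$ satisfies $$\sup_{\beta^*\in\Theta_0}\mathbb E_{\beta^*}\|\beta^T-\beta^*\|_2^2\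 \le\ C'\,c(\sigma)\left\{\frac dn+\frac{d(d+\log n)\log(1/\delta)\log^3n}{n^2\varepsilon^2}\right\},$$ where $C'$ may depend on the fixed model constants and $b_0$, but not on $n,d,\varepsilon,\delta$.
   Context: Generalized linear model: $x\in\mathbb R^d$ has law $f_x$ and, given $x$, $y\in\mathbb R$ has density (with respect to a fixed dominating measure) $f_\beta(y\mid x)=h(y,\sigma)\exp\{(y\,x^\top\beta-\psi(x^\top\beta))/c(\sigma)\}$; $\psi,h,c(\sigma)$ are fixed and known, and for every $\theta\in\mathbb R$, $h(y,\sigma)\exp\{(y\theta-\psi(\theta))/c(\sigma)\}$ is a probability density. The scale $c(\sigma)>0$ is a fixed constant bounded above and away from zero. $\Theta_0=\{\beta\in\mathbb R^d:\|\beta\|_2\le b_0\}$ with $b_0>0$ fixed. Assumptions. (D): $\lambda_{\max}\{\mathbb E(xx^\top)\}\le C$; $\|u^\top x\|_{\psi_2}\le K_x\|u\|_2$ for every $u\in\mathbb R^d$ (sub-Gaussian Orlicz norm); $\mathbb Ex=0$; and $\mathbb E xx^\top\succeq C^{-1}I_d$; with fixed $C,K_x<\infty$. (G): $\psi\in C^3(\mathbb R)$, $0<\psi''(t)\le c_2$ for every $t\in\mathbb R$, and $\|\psi'''\|_\infty\le c_3$, with fixed $c_2,c_3<\infty$. Clipping and saturation: $\mathsf C_L^{(2)}(x)=x\min\{1,L/\|x\|_2\}$ (with $\mathsf C_L^{(2)}(0)=0$); $\Pi_R(t)$ is the projection of $t\in\mathbb R$ onto $[-R,R]$. Fix an even $C^1$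 function $\chi:\mathbb R\to[0,1]$ with $\chi(t)=1$ for $|t|\le1$, $\chi(t)=0$ for $|t|\ge2$, $\|\chi'\|_\infty<\infty$. For $L_\psi\ge1$, $\psi_{L_\psi}'(t)=\psi'(0)+\int_0^t\psi''(u)\chi(u/L_\psi)\,du$ and $\psi_{L_\psi}(t)=\psi(0)+\int_0^t\psi_{L_\psi}'(u)\,du$. Algorithm (inputs: data, $\Theta_0$, step size $\eta^0$, privacy parameters $\varepsilon,\delta$, noise scale $B$, number of iterations $T$, levels $R,L_x,L_\psi$, initial value $\beta^0\in\Theta_0$): set $\bar x_i=\mathsf C^{(2)}_{L_x}(x_i)$. For $t=0,\dots,T-1$ draw independently $w_t\in\mathbb R^d$ with i.i.d. coordinates $N\big(0,(\eta^0)^2\,2B^2\log(2T/\delta)/(n^2(\varepsilon/T)^2)\big)$ and set $$\beta^{t+1}=\Pi_{\Theta_0}\Big[\beta^t-\frac{\eta^0}n\sum_{i=1}^n\big(\psi'_{L_\psi}(\bar x_i^\top\beta^t)-\Pi_R(y_i)\big)\bar x_i+w_t\Big],$$ $\Pi_{\Theta_0}$ being Euclidean projection. Output $\beta^T$. Differential privacy: a randomized algorithm $M$ is $(\varepsilon,\delta)$-differentially private if for every two data sets $D,D'$ of size $n$ differing by replacement of one record and every measurable $S$, $\mathbb P(M(D)\in S)\le e^\varepsilon\mathbb P(M(D')\in S)+\delta$, over the randomness of $M$ only. ''Fixed model ingredients/constants'' means $C,K_x,c_2,c_3$, the fixed functions $\psi,\chi$, and the fixed bounds on $c(\sigma)$.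 *)

(* Defs.v *)
From HB Require Import structures.
From mathcomp Require Import all_boot all_order all_algebra.
From mathcomp Require Import all_classical all_reals all_analysis.

Set Implicit Arguments.
Unset Strict Implicit.
Unset Printing Implicit Defensive.

Import Order.TTheory GRing.Theory Num.Theory.
Import numFieldNormedType.Exports.

Local Open Scope classical_set_scope.
Local Open Scope ring_scope.

(* Matrices over a measurable type carry the sigma-algebra generated by their
   entries; on 'cV[R]_d this is the Borel sigma-algebra of R^d. *)
Definition measure_matrix_display : measure_display -> measure_display.
Proof. exact. Qed.

Section measurable_matrix.
Context {d} {T : measurableType d} (m n : nat).

Definition mx_measurable : set (set 'M[T]_(m, n)) :=
  <<s \bigcup_(ij in [set: 'I_m * 'I_n])
        preimage_set_system setT (fun A : 'M[T]_(m, n) => A ij.1 ij.2)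
          measurable >>.

Let mx_set0 : mx_measurable set0.
Proof. exact: sigma_algebra0. Qed.

Let mx_setC A : mx_measurable A -> mx_measurable (~` A).
Proof. exact: sigma_algebraC. Qed.

Let mx_bigcup (F : (set 'M[T]_(m, n))^nat) :
  (forall i, mx_measurable (F i)) -> mx_measurable (\bigcup_i (F i)).
Proof. exact: sigma_algebra_bigcup. Qed.

HB.instance Definition _ := @isMeasurable.Build (measure_matrix_display d)
  'M[T]_(m, n) mx_measurable mx_set0 mx_setC mx_bigcup.

End measurable_matrix.

Section euclidean.
Context {R : realType}.

Definition dotv d (u v : 'cV[R]_d) : R := (u^T *m v) 0 0.

(* The norm `|u| of the library on matrices is the sup norm. *)
Definition l2norm d (u : 'cV[R]_d) : R := Num.sqrt (dotv u u).

Definition l2ball d (r : R) : set 'cV[R]_d := [set u | l2norm u <= r].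

Definition psdmx d (A : 'M[R]_d) : Prop :=
  A^T = A /\ forall u : 'cV[R]_d, 0 <= dotv u (A *m u).

Definition loewner_le d (A B : 'M[R]_d) : Prop := psdmx (B - A).

Definition lambda_max d (A : 'M[R]_d) : R := sup [set a | eigenvalue A a].

(* A point of S closest to v; unique for S closed convex and dist Euclidean. *)
Definition projection (T : choiceType) (dist : T -> T -> R) (S : set T) (v : T)
  : T := xget v [set p | S p /\ forall q, S q -> dist v p <= dist v q].

Definition proj_ball d (r : R) : 'cV[R]_d -> 'cV[R]_d :=
  projection (fun u v => l2norm (u - v)) (l2ball r).

Definition proj_itv (r : R) : R -> R :=
  projection (fun s t => `|s - t|) `[- r, r].

(* At x = 0 the value is 0, since L / 0 = 0. *)
Definition clip2 d (L : R) (x : 'cV[R]_d) : 'cV[R]_d :=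
  Num.min 1 (L / l2norm x) *: x.

End euclidean.

Section probability_notions.
Context {R : realType}.

Definition psi2_norm d (T : measurableType d) (P : probability T R)
    (Z : T -> R) : \bar R :=
  ereal_inf [set t%:E | t in
    [set t : R | 0 < t /\ ('E_P[fun w => expR ((Z w / t) ^+ 2)%R] <= 2%:E)%E]].

Definition mutually_independent d d' (T : measurableType d)
    (T' : measurableType d') (P : probability T R) (I : finType)
    (X : I -> T -> T') : Prop :=
  forall A : I -> set T', (forall i, measurable (A i)) ->
    P [set w | forall i, A i (X i w)] =
    (\prod_(i : I) P (X i @^-1` A i))%E.

Definition is_pdf d (T : measurableType d) (nu : {measure set T -> \bar R})
    (f : T -> R) : Prop :=
  [/\ measurable_fun setT f, forall y, 0 <= f y &
      (\int[nu]_y (f y)%:E = 1)%E].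

(* [fine] is harmless under [design_subgaussian] below, which makes these
   expectations finite. *)
Definition mean_vec d (fx : probability 'cV[R]_d R) : 'cV[R]_d :=
  \col_i fine ('E_fx[fun x : 'cV[R]_d => (x i 0)%R])%E.

Definition second_moment d (fx : probability 'cV[R]_d R) : 'M[R]_d :=
  \matrix_(i, j) fine ('E_fx[fun x : 'cV[R]_d => ((x *m x^T) i j)%R])%E.

End probability_notions.

Section glm.
Context {R : realType}.

Record design_assumption d (fx : probability 'cV[R]_d R) (C Kx : R) : Prop :=
  DesignAssumption {
    design_max : lambda_max (second_moment fx) <= C;
    design_subgaussian : forall u : 'cV[R]_d,
      (psi2_norm fx (dotv u) <= (Kx * l2norm u)%:E)%E;
    design_centered : mean_vec fx = 0;
    design_min : loewner_le (C^-1)%:M (second_moment fx) }.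

Record link_assumption (psi : R -> R) (c2 c3 : R) : Prop := LinkAssumption {
  link_derivable : forall k t, (k < 3)%N -> derivable (psi^`(k)%classic) t 1;
  link_continuous3 : continuous (psi^`(3)%classic);
  link_curvature : forall t, 0 < psi^`(2)%classic t <= c2;
  link_third : forall t, `|psi^`(3)%classic t| <= c3 }.

Record cutoff (chi : R -> R) : Prop := Cutoff {
  cutoff_even : forall t, chi (- t) = chi t;
  cutoff_range : forall t, 0 <= chi t <= 1;
  cutoff_derivable : forall t, derivable chi t 1;
  cutoff_derive_continuous : continuous (chi^`()%classic);
  cutoff_one : forall t, `|t| <= 1 -> chi t = 1;
  cutoff_zero : forall t, 2 <= `|t| -> chi t = 0;
  cutoff_derive_bounded : exists M, forall t, `|chi^`()%classic t| <= M }.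

(* The oriented integral of f from 0 to t, for either sign of t. *)
Definition integral_from0 (f : R -> R) (t : R) : R :=
  if 0 <= t then (\int[lebesgue_measure]_(u in `[0, t]) f u)%R
  else - (\int[lebesgue_measure]_(u in `[t, 0]) f u)%R.

Definition dpsi_sat (psi chi : R -> R) (L t : R) : R :=
  psi^`()%classic 0 +
  integral_from0 (fun u => psi^`(2)%classic u * chi (u / L)) t.

Definition psi_sat (psi chi : R -> R) (L t : R) : R :=
  psi 0 + integral_from0 (dpsi_sat psi chi L) t.

Definition glm_pdf (psi : R -> R) (h : R -> R -> R) (c : R -> R)
    (sigma theta y : R) : R :=
  h y sigma * expR ((y * theta - psi theta) / c sigma).

(* Joint law of a record (y, x): x has law fx and, given x, y has density
   y |-> glm_pdf (x^T b) y with respect to nu. *)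
Definition glm_law d (fx : probability 'cV[R]_d R)
    (nu : {measure set R -> \bar R}) (psi : R -> R) (h : R -> R -> R)
    (c : R -> R) (sigma : R) (b : 'cV[R]_d)
    (mu : set (R * 'cV[R]_d) -> \bar R) : Prop :=
  forall (B : set R) (A : set 'cV[R]_d), measurable B -> measurable A ->
    (mu (B `*` A) =
     \int[fx]_(x in A) \int[nu]_(y in B)
       (glm_pdf psi h c sigma (dotv x b) y)%:E)%E.

Definition glm_sample d (fx : probability 'cV[R]_d R)
    (nu : {measure set R -> \bar R}) (psi : R -> R) (h : R -> R -> R)
    (c : R -> R) (sigma : R) (b : 'cV[R]_d)
    dO (Om : measurableType dO) (P : probability Om R) n
    (Z : 'I_n -> {mfun Om >-> (R * 'cV[R]_d)%type}) : Prop :=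
  mutually_independent P (fun i => Z i : Om -> (R * 'cV[R]_d)%type) /\
  forall i, glm_law fx nu psi h c sigma b (distribution P (Z i)).

Definition empirical_hessian (psi chi : R -> R) (L : R) d n
    (x : 'I_n -> 'cV[R]_d) (b : 'cV[R]_d) : 'M[R]_d :=
  n%:R^-1 *: \sum_(i < n)
    (psi_sat psi chi L)^`(2)%classic (dotv (x i) b) *: (x i *m (x i)^T).

End glm.

Section algorithm.
Context {R : realType}.

Fixpoint noisy_pgd (psi chi : R -> R) (b0 eta0 r Lx Lpsi : R) d n
    (beta0 : 'cV[R]_d) (D : 'I_n -> R * 'cV[R]_d) (w : nat -> 'cV[R]_d)
    (t : nat) : 'cV[R]_d :=
  if t is s.+1 then
    let b := noisy_pgd psi chi b0 eta0 r Lx Lpsi beta0 D w s in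
    proj_ball b0
      (b - (eta0 / n%:R) *:
             (\sum_(i < n)
                (dpsi_sat psi chi Lpsi (dotv (clip2 Lx (D i).2) b)
                 - proj_itv r (D i).1) *: clip2 Lx (D i).2)
         + w s)
  else beta0.

Definition noise_var (eta0 B eps delta : R) (n T : nat) : R :=
  eta0 ^+ 2 * (2 * B ^+ 2 * ln (2 * T%:R / delta))
  / (n%:R ^+ 2 * (eps / T%:R) ^+ 2).

(* The vectors w_0, ..., w_(T-1) are independent with i.i.d. N(0, v) coordinates;
   normal_prob takes the standard deviation as its second parameter. *)
Definition gaussian_noise dW (W : measurableType dW) (Q : probability W R) d
    (w : nat -> {mfun W >-> 'cV[R]_d}) (T : nat) (v : R) : Prop :=
  mutually_independent Q
    (fun (tj : 'I_T * 'I_d) (o : W) => (w tj.1 o) tj.2 0) /\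
  forall (t : 'I_T) (j : 'I_d) (B : set R), measurable B ->
    Q [set o | B ((w t o) j 0)] = normal_prob 0 (Num.sqrt v) B.

Definition neighbors (T : Type) n (D D' : 'I_n -> T) : Prop :=
  exists i, forall j, j != i -> D j = D' j.

Definition differentially_private dW (W : measurableType dW)
    (Q : probability W R) dS (S : measurableType dS) (T : Type) n
    (M : ('I_n -> T) -> W -> S) (eps delta : R) : Prop :=
  forall D D' : 'I_n -> T, neighbors D D' ->
  forall A : set S, measurable A ->
    (Q (M D @^-1` A) <= (expR eps)%:E * Q (M D' @^-1` A) + delta%:E)%E.

End algorithm.

(* Main.v *)
Require Import Defs.
From HB Require Import structures.
From mathcomp Require Import all_boot all_order all_algebra.
From mathcomp Require Import all_classical all_reals all_analysis.
From mathcomp Require Import measurable_realfun ring lra.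

Set Implicit Arguments.
Unset Strict Implicit.
Unset Printing Implicit Defensive.

Import Order.TTheory GRing.Theory Num.Theory.
Import numFieldNormedType.Exports.

Local Open Scope classical_set_scope.
Local Open Scope ring_scope.

(** Risk. Suppose the empirical Hessian of the saturated loss lies between [alpha] and [gamma] times
    the identity on the whole ball. Then a noiseless gradient step of size [2 / (alpha + gamma)]
    contracts distances by the factor [(gamma - alpha) / (gamma + alpha)], and projection does not
    increase the distance to a point of the ball. On a good event, whose complement has probability
    at most [8 / n], no record is clipped and saturation is inactive at [bstar], so the noiseless
    step moves [bstar] exactly by [eta0] times the score there. The error [e] therefore satisfies [e
    (t + 1) <= rho e t + eta0 |score| + |w t|] ([noisy_pgd_step]). Squaring, summing the geometric
    weights and integrating leaves four terms ([noisy_pgd_expectation_bound]): a bias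
    [rho ^ T <= 1 / n], the mean squared score of order [c(sigma) d / n] ([score_sqr_norm]), the
    mean squared noise ([gaussian_sqr_norm]), and [4 b0 ^ 2] times the failure probability, since
    all iterates stay in the ball. As [T] is of order [ln n] and the clipping and saturation levels
    are of order [sqrt (ln n)], the noise variance carries the factor [ln n ^ 3] ([noise_var_le]).

    Curvature. The function [psi''] is positive but may tend to zero at infinity, so the lower
    Hessian bound counts only records in a slab [|<b, x>| <= tau], on which [psi''] has a positive
    minimum. By the fourth moment bound the slab retains a fixed share of the second moment
    ([truncated_moment_ge]). Chernoff bounds in fixed directions and nets of lattice points make the
    upper and lower bounds uniform in the direction and in [b] ([sqr_sum_net_bound],
    [slab_sum_net_bound]); the sample size condition absorbs the logarithm of the net cardinality
    ([hessian_event_prob]).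

    Privacy. Replacing one record moves a noiseless step by at most [eta0 B / (2 n)]
    ([pgd_drift_sensitivity]). Comparing a Gaussian vector with its translate by the Cameron-Martin
    formula makes each step private at level [(eps / T, delta / T)] ([gaussian_mechanism]), and
    since the noise of a step is independent of the current iterate, induction over steps adds the
    levels up ([pgd_privacy], [noisy_pgd_private]). *)

Section euclidean_geometry.
Context {R : realType}.
Implicit Types (d : nat).

(** * Inner product, Euclidean norm and quadratic forms *)

Lemma dotvE d (u v : 'cV[R]_d) : dotv u v = \sum_i u i 0 * v i 0.
Proof. by rewrite /dotv mxE; apply: eq_bigr => i _; rewrite mxE. Qed.

Lemma dotvC d (u v : 'cV[R]_d) : dotv u v = dotv v u.
Proof. by rewrite !dotvE; apply: eq_bigr => i _; rewrite mulrC. Qed.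

Lemma dotvDl d (u v w : 'cV[R]_d) : dotv (u + v) w = dotv u w + dotv v w.
Proof. by rewrite /dotv linearD/= mulmxDl mxE. Qed.

Lemma dotvDr d (u v w : 'cV[R]_d) : dotv w (u + v) = dotv w u + dotv w v.
Proof. by rewrite /dotv mulmxDr mxE. Qed.

Lemma dotvZl d a (u v : 'cV[R]_d) : dotv (a *: u) v = a * dotv u v.
Proof. by rewrite /dotv linearZ/= -scalemxAl mxE. Qed.

Lemma dotvZr d a (u v : 'cV[R]_d) : dotv u (a *: v) = a * dotv u v.
Proof. by rewrite dotvC dotvZl dotvC. Qed.

Lemma dotvNl d (u v : 'cV[R]_d) : dotv (- u) v = - dotv u v.
Proof. by rewrite -scaleN1r dotvZl mulN1r. Qed.

Lemma dotvNr d (u v : 'cV[R]_d) : dotv u (- v) = - dotv u v.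
Proof. by rewrite dotvC dotvNl dotvC. Qed.

Lemma dotvBl d (u v w : 'cV[R]_d) : dotv (u - v) w = dotv u w - dotv v w.
Proof. by rewrite dotvDl dotvNl. Qed.

Lemma dotvBr d (u v w : 'cV[R]_d) : dotv w (u - v) = dotv w u - dotv w v.
Proof. by rewrite dotvDr dotvNr. Qed.

Lemma dotv0l d (v : 'cV[R]_d) : dotv 0 v = 0.
Proof. by rewrite -(scale0r 0) dotvZl mul0r. Qed.

Lemma dotv0r d (v : 'cV[R]_d) : dotv v 0 = 0.
Proof. by rewrite dotvC dotv0l. Qed.

Lemma dotv_sumr d (I : Type) (s : seq I) (P : pred I) (F : I -> 'cV[R]_d) u :
  dotv u (\sum_(i <- s | P i) F i) = \sum_(i <- s | P i) dotv u (F i).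
Proof.
by apply: (big_morph (dotv u)); [move=> x y; rewrite dotvDr|rewrite dotv0r].
Qed.

Lemma dotv_ge0 d (u : 'cV[R]_d) : 0 <= dotv u u.
Proof. by rewrite dotvE sumr_ge0// => i _; rewrite -expr2 sqr_ge0. Qed.

Lemma l2norm_ge0 d (u : 'cV[R]_d) : 0 <= l2norm u.
Proof. exact: sqrtr_ge0. Qed.

Lemma sqr_l2norm d (u : 'cV[R]_d) : l2norm u ^+ 2 = dotv u u.
Proof. by rewrite sqr_sqrtr// dotv_ge0. Qed.

Lemma l2norm0 d : l2norm (0 : 'cV[R]_d) = 0.
Proof. by rewrite /l2norm dotv0l sqrtr0. Qed.

Lemma l2normZ d a (u : 'cV[R]_d) : l2norm (a *: u) = `|a| * l2norm u.
Proof.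
by rewrite /l2norm dotvZl dotvZr mulrA -expr2 sqrtrM ?sqr_ge0// sqrtr_sqr.
Qed.

Lemma l2normN d (u : 'cV[R]_d) : l2norm (- u) = l2norm u.
Proof. by rewrite -scaleN1r l2normZ normrN1 mul1r. Qed.

Lemma l2normBC d (u v : 'cV[R]_d) : l2norm (u - v) = l2norm (v - u).
Proof. by rewrite -l2normN opprB. Qed.

Lemma dotv_eq0 d (u : 'cV[R]_d) : dotv u u = 0 -> u = 0.
Proof.
rewrite dotvE => /eqP; rewrite psumr_eq0 => [/allP u0|i _]; last first.
  by rewrite -expr2 sqr_ge0.
apply/matrixP => i j; rewrite ord1 mxE.
have := u0 i (mem_index_enum i); rewrite /= -expr2 sqrf_eq0 => /eqP.
by [].
Qed.

Lemma l2norm_eq0 d (u : 'cV[R]_d) : l2norm u = 0 -> u = 0.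
Proof. by move=> u0; apply: dotv_eq0; rewrite -sqr_l2norm u0 expr0n. Qed.

(** Cauchy-Schwarz: the squared norm of [l2norm v *: u - l2norm u *: v] equals [2 |u| |v|] times the
    difference of the two sides. *)
Lemma dotv_le d (u v : 'cV[R]_d) : dotv u v <= l2norm u * l2norm v.
Proof.
have [u0|u0] := eqVneq (l2norm u) 0.
  by rewrite u0 (l2norm_eq0 u0) dotv0l mul0r.
have [v0|v0] := eqVneq (l2norm v) 0.
  by rewrite v0 (l2norm_eq0 v0) dotv0r mulr0.
have up : 0 < l2norm u by rewrite lt_def u0 l2norm_ge0.
have vp : 0 < l2norm v by rewrite lt_def v0 l2norm_ge0.
have := dotv_ge0 (l2norm v *: u - l2norm u *: v).
rewrite !(dotvBl, dotvBr, dotvZl, dotvZr) -!sqr_l2norm (dotvC v u).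
set a := l2norm u in up *; set b := l2norm v in vp *; set s := dotv u v => h.
have ab : 0 < a * b by rewrite mulr_gt0.
rewrite -(ler_pM2l ab) -subr_ge0; rewrite -(pmulrn_lge0 _ (isT : (0 < 2)%N)).
rewrite (le_trans h)// le_eqVlt; apply/orP; left; apply/eqP; ring.
Qed.

Lemma normr_dotv_le d (u v : 'cV[R]_d) : `|dotv u v| <= l2norm u * l2norm v.
Proof. by rewrite ler_norml dotv_le andbT lerNl -dotvNl -(l2normN u) dotv_le. Qed.

Lemma l2normD d (u v : 'cV[R]_d) : l2norm (u + v) <= l2norm u + l2norm v.
Proof.
rewrite -(@ler_pXn2r _ 2) ?nnegrE ?addr_ge0 ?l2norm_ge0// sqr_l2norm.
rewrite !(dotvDl, dotvDr) (dotvC v u) -!sqr_l2norm sqrrD.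
have := dotv_le u v; lra.
Qed.

Lemma l2norm_sum d (I : Type) (s : seq I) (P : pred I) (F : I -> 'cV[R]_d) :
  l2norm (\sum_(i <- s | P i) F i) <= \sum_(i <- s | P i) l2norm (F i).
Proof.
elim/big_rec2 : _ => [|i x y _ h]; first by rewrite l2norm0.
by rewrite (le_trans (l2normD _ _))// lerD2l.
Qed.

Lemma normr_coord_le d (u : 'cV[R]_d) i : `|u i 0| <= l2norm u.
Proof.
rewrite -(@ler_pXn2r _ 2) ?nnegrE ?l2norm_ge0// sqr_l2norm real_normK ?num_real//.
rewrite dotvE (bigD1 i)//= -expr2 lerDl sumr_ge0// => j _.
by rewrite -expr2 sqr_ge0.
Qed.

Lemma l2norm_le_coord d (u : 'cV[R]_d) h : 0 <= h ->
  (forall i, `|u i 0| <= h) -> l2norm u <= h * Num.sqrt d%:R.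
Proof.
move=> h0 uh; rewrite -(@ler_pXn2r _ 2) ?nnegrE ?l2norm_ge0 ?mulr_ge0 ?sqrtr_ge0//.
rewrite sqr_l2norm exprMn sqr_sqrtr// dotvE.
apply: (@le_trans _ _ (\sum_(i < d) h ^+ 2)).
  by apply: ler_sum => i _; rewrite -expr2 -real_normK ?num_real// ler_pXn2r ?nnegrE.
by rewrite sumr_const card_ord mulr_natr.
Qed.

Lemma dotv_outer d (x u v : 'cV[R]_d) :
  dotv u ((x *m x^T) *m v) = dotv x u * dotv x v.
Proof.
rewrite /dotv -mulmxA mulmxA mxE big_ord1; congr (_ * _).
by rewrite -/(dotv u x) dotvC.
Qed.

Lemma loewner_leP d (A B : 'M[R]_d) : A^T = A -> B^T = B ->
  loewner_le A B <-> forall u, dotv u (A *m u) <= dotv u (B *m u).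
Proof.
move=> sA sB; split=> [[_ h] u|h].
  by have := h u; rewrite mulmxBl dotvBr subr_ge0.
split; first by rewrite linearB/= sA sB.
by move=> u; rewrite mulmxBl dotvBr subr_ge0.
Qed.

Lemma dotv_scalar_mx d a (u v : 'cV[R]_d) : dotv u (a%:M *m v) = a * dotv u v.
Proof. by rewrite mul_scalar_mx dotvZr. Qed.

(* Polarization turns the bound on the quadratic form into a bilinear one. *)
Lemma sym_form_bound d (S : 'M[R]_d) (rho : R) (u v : 'cV[R]_d) : 0 <= rho ->
  S^T = S -> (forall x, `|dotv x (S *m x)| <= rho * dotv x x) ->
  dotv v (S *m u) <= rho * l2norm v * l2norm u.
Proof.
move=> rho0 sS h.
have symS x y : dotv x (S *m y) = dotv y (S *m x).
  by rewrite (dotvC y) {1}/dotv -[in LHS]sS mulmxA -trmx_mul.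
(* [4 <y, S x>] is the difference of the form at [x + y] and at [y - x], hence at most
   [rho (|x + y|^2 + |y - x|^2) = 4 rho]. *)
have unit_bound x y : l2norm x = 1 -> l2norm y = 1 -> dotv y (S *m x) <= rho.
  move=> x1 y1.
  have := h (x + y); have := h (y - x).
  rewrite !mulmxDr mulmxN !(dotvDl,dotvDr,dotvNl,dotvNr) (symS x y) (dotvC x y).
  rewrite -!sqr_l2norm x1 y1 !expr1n !ler_norml => /andP[h1 h2] /andP[h3 h4].
  lra.
have [u0|u0] := eqVneq (l2norm u) 0.
  by rewrite u0 (l2norm_eq0 u0) mulmx0 dotv0r mulr0.
have [v0|v0] := eqVneq (l2norm v) 0.
  by rewrite v0 (l2norm_eq0 v0) dotv0l mulr0 mul0r.
have up : 0 < l2norm u by rewrite lt_def u0 l2norm_ge0.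
have vp : 0 < l2norm v by rewrite lt_def v0 l2norm_ge0.
have := unit_bound ((l2norm u)^-1 *: u) ((l2norm v)^-1 *: v).
rewrite !l2normZ !ger0_norm ?invr_ge0 ?l2norm_ge0// !mulVf// => /(_ erefl erefl).
rewrite -scalemxAr dotvZl dotvZr.
set x := dotv v _; set a := l2norm u; set b := l2norm v => hx.
have -> : x = b * a * (b^-1 * (a^-1 * x)) by field; rewrite u0 v0.
by rewrite -[rho * _ * _]mulrA [rho * _]mulrC ler_wpM2l ?mulr_ge0 ?l2norm_ge0//.
Qed.

End euclidean_geometry.

(** * Measures given by a density *)

Section density.
Context d (T : measurableType d) (R : realType).
Variables (mu : {measure set T -> \bar R}) (g : T -> R).
Local Open Scope ereal_scope.

(** The proofs about [g] are arguments so that the measure structure can be attached to the term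
    [density g0 mg], which may then be passed to any lemma on measures. *)
Definition density of (forall x, (0 <= g x)%R) & measurable_fun [set: T] g :=
  fun A : set T => \int[mu]_(x in A) (g x)%:E.

Hypotheses (g0 : forall x, (0 <= g x)%R) (mg : measurable_fun [set: T] g).

Let density_set0 : density g0 mg set0 = 0.
Proof. exact: integral_set0. Qed.

Let density_ge0 A : 0 <= density g0 mg A.
Proof. by apply: integral_ge0 => x _; rewrite lee_fin. Qed.

Let density_sigma_additive : semi_sigma_additive (density g0 mg).
Proof.
move=> F mF tF mUF; rewrite /density ge0_integral_bigcup//.
- apply: is_cvg_ereal_nneg_natsum_cond => n _ _.
  by apply: integral_ge0 => x _; rewrite lee_fin.
- by apply/measurable_EFinP; apply: measurable_funTS.
- by move=> x _; rewrite lee_fin.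
Qed.

HB.instance Definition _ := isMeasure.Build _ _ _ (density g0 mg)
  density_set0 density_ge0 density_sigma_additive.

Import HBNNSimple.

(** True for indicators by definition, for simple functions by linearity, and in general by monotone
    convergence along [nnsfun_approx]. *)
Lemma ge0_integral_density (f : T -> \bar R) : (forall x, 0 <= f x) ->
  measurable_fun [set: T] f ->
  \int[density g0 mg]_x f x = \int[mu]_x (f x * (g x)%:E).
Proof.
move=> f0 mf; pose h := nnsfun_approx measurableT mf.
have h0 n x : 0 <= (h n x)%:E by rewrite lee_fin.
have mh n : measurable_fun [set: T] (fun x => (h n x)%:E).
  exact/measurable_EFinP/measurable_funP.
have fE x : (fun n => (h n x)%:E) @ \oo --> f x by exact: cvg_nnsfun_approx.
have ndh x : nondecreasing_seq (fun n => (h n x)%:E).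
  by move=> m n mn; rewrite lee_fin; exact/lefP/nd_nnsfun_approx.
transitivity (limn (fun n => \int[density g0 mg]_x (h n x)%:E)).
  rewrite -monotone_convergence//; apply: eq_integral => x _.
  exact/esym/cvg_lim.
transitivity (limn (fun n => \int[mu]_x ((h n x)%:E * (g x)%:E))); last first.
  rewrite -monotone_convergence//.
  - apply: eq_integral => x _; apply/cvg_lim => //.
    by apply: cvgeZr; [|exact: fE].
  - by move=> n; apply: emeasurable_funM => //; exact/measurable_EFinP.
  - by move=> n x _; rewrite mule_ge0// lee_fin.
  - by move=> x _ m n mn; rewrite lee_wpmul2r ?lee_fin//; exact: ndh.
congr (limn _); apply/funext => n.
transitivity (\int[density g0 mg]_x
   (\sum_(y \in range (h n)) (y * \1_(h n @^-1` [set y]) x)%:E)).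
  by apply: eq_integral => t _; rewrite /= fimfunE -fsumEFin.
have indich r : measurable_fun [set: T]
    (fun x => (r * \1_(h n @^-1` [set r]) x)%:E).
  by apply: (measurable_comp measurableT) => //; exact: measurable_funM.
rewrite ge0_integral_fsum//; last by move=> y x _; exact: nnfun_muleindic_ge0.
transitivity (\int[mu]_x (\sum_(y \in range (h n))
    (y * \1_(h n @^-1` [set y]) x)%:E * (g x)%:E)); last first.
  under eq_integral => x xE.
    rewrite -ge0_mule_fsuml => [|y]; last exact: nnfun_muleindic_ge0.
    rewrite fsumEFin // -(fimfunE _ x); over.
  by [].
rewrite ge0_integral_fsum//; last 2 first.
  - by move=> y; apply: emeasurable_funM => //; exact/measurable_EFinP.
  - by move=> y x _; rewrite mule_ge0 ?lee_fin// -lee_fin nnfun_muleindic_ge0.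
apply: eq_fsbigr => r rhn.
under [LHS]eq_integral do rewrite EFinM.
rewrite integralZl_indic_nnsfun => //.
under [RHS]eq_integral do rewrite EFinM -muleA.
rewrite ge0_integralZl//.
- under [in RHS]eq_integral do rewrite muleC.
  rewrite [in RHS](eq_integral ((EFin \o g) \_ (h n @^-1` [set r]))); last first.
    by move=> x xE; rewrite epatch_indic.
  by rewrite -integral_mkcondr setTI integral_indic// setIT.
- by apply: emeasurable_funM; exact/measurable_EFinP.
- by move=> t Et; rewrite mule_ge0 ?lee_fin.
- by move: rhn; rewrite inE => -[t _ <-]; rewrite lee_fin.
Qed.

End density.

(** * Expectations of products under mutual independence *)

Section independence.
Context d (T : measurableType d) (R : realType) (P : probability T R).
Local Open Scope ereal_scope.

(** The hypothesis on sets says that the image under [X] of the measure with density [G] is [c]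
    times the law of [X]; integrating [f] against these two equal measures gives the claim. *)
Lemma ge0_integral_factor d' (T' : measurableType d') (X : T -> T')
    (G : T -> R) (c : R) (f : T' -> \bar R) :
  measurable_fun [set: T] X -> measurable_fun [set: T] G ->
  (forall w, (0 <= G w)%R) -> (0 <= c)%R ->
  (forall A, measurable A ->
    \int[P]_w ((\1_A (X w))%:E * (G w)%:E) = P (X @^-1` A) * c%:E) ->
  (forall x, 0 <= f x) -> measurable_fun [set: T'] f ->
  \int[P]_w (f (X w) * (G w)%:E) = (\int[P]_w f (X w)) * c%:E.
Proof.
move=> mX mG G0 c0 h f0 mf.
have mfX : measurable_fun [set: T] (f \o X) by exact: measurableT_comp.
rewrite -(ge0_integral_density P G0 mG)//=.
transitivity (\int[pushforward (density P G0 mG) X]_y f y).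
  by rewrite ge0_integral_pushforward.
pose PX := pushforward P X.
transitivity (\int[PX]_y (f y * c%:E)); last first.
  rewrite ge0_integralZr//.
  by rewrite ge0_integral_pushforward.
rewrite -(ge0_integral_density (measure_function_pushforward__canonical__measure_function_Measure P mX) (fun=> c0) (measurable_cst c))//.
apply: eq_measure_integral => A mA _.
transitivity (P (X @^-1` A) * c%:E); last first.
  by rewrite muleC; apply/esym; exact: integral_cst.
rewrite -h//; transitivity (\int[P]_(w in X @^-1` A) (G w)%:E) => //.
rewrite integral_mkcond; apply: eq_integral => w _.
by rewrite epatch_indic muleC.
Qed.

Lemma integral_indic_comp d' (T' : measurableType d') (X : T -> T') A :
  measurable_fun [set: T] X -> measurable A ->
  \int[P]_w (\1_A (X w))%:E = P (X @^-1` A).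
Proof.
move=> mX mA.
have mXA : measurable (X @^-1` A).
  by rewrite -[X in measurable X]setTI; exact: mX.
transitivity (\int[P]_w (\1_(X @^-1` A) w)%:E); first by [].
by rewrite integral_indic// setIT.
Qed.

Lemma independent_integral_prod d' (T' : measurableType d') (I : finType)
    (X : I -> T -> T') (f : I -> T' -> R) (e : I -> R) :
  mutually_independent P X -> (forall i, measurable_fun [set: T] (X i)) ->
  (forall i x, (0 <= f i x)%R) -> (forall i, measurable_fun [set: T'] (f i)) ->
  (forall i, \int[P]_w (f i (X i w))%:E = (e i)%:E) ->
  \int[P]_w (\prod_i f i (X i w))%:E = (\prod_i e i)%:E.
Proof.
move=> indX mX f0 mf fe.
(* Induction on the list [s] of indices whose factor is arbitrary, the other factors being
   indicators: for the empty list this is the definition of independence, and each step frees one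
   factor. *)
suff main (s : seq I) : forall (f : I -> T' -> R) (e : I -> R),
    (forall i x, (0 <= f i x)%R) -> (forall i, measurable_fun [set: T'] (f i)) ->
    (forall i, \int[P]_w (f i (X i w))%:E = (e i)%:E) ->
    (forall i, i \notin s -> exists2 A, measurable A & f i = \1_A) ->
    \int[P]_w (\prod_i f i (X i w))%:E = (\prod_i e i)%:E.
  by apply: (main (index_enum I)) => // i; rewrite mem_index_enum.
elim: s => [|i0 s IH] {f0 mf fe f e}f e f0 mf fe hs.
  have [A hA] : {A : I -> set T' & forall i, measurable (A i) /\ f i = \1_(A i)}.
    apply: (@choice _ _ (fun i A => measurable A /\ f i = \1_A)) => i.
    by have [A mA fA] := hs i isT; exists A.
  have mE : measurable [set w | forall i, A i (X i w)].
    rewrite (_ : [set _ | _] = \bigcap_(i in [set: I]) (X i @^-1` A i)); last first.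
      by apply/seteqP; split=> w /= h i => [_|]; exact: h.
    apply: fin_bigcap_measurable => // i _; rewrite -[X in measurable X]setTI.
    by apply: mX => //; exact: (hA i).1.
  rewrite (eq_integral (fun w => (\1_[set w | forall i, A i (X i w)] w)%:E)).
    transitivity (P [set w | forall i, A i (X i w)]).
      by rewrite integral_indic// setIT.
    rewrite (indX A) => [|i]; last exact: (hA i).1.
    rewrite -prodEFin; apply: eq_bigr => i _; rewrite -fe (hA i).2.
    by rewrite integral_indic_comp//; exact: (hA i).1.
  move=> w _; rewrite indicE; congr EFin.
  have [/= wE|wE] := pselect (forall i, A i (X i w)).
    rewrite mem_set//= big1// => i _; rewrite (hA i).2 indicE mem_set//.
  rewrite memNset//=; have [i iA] : exists i, ~ A i (X i w).
    by apply/existsNP.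
  by rewrite (bigD1 i)//= (hA i).2 indicE memNset// mul0r.
pose G w := (\prod_(i | i != i0) f i (X i w))%R.
pose c := (\prod_(i | i != i0) e i)%R.
have e0 i : (0 <= e i)%R.
  by rewrite -lee_fin -fe integral_ge0// => w _; rewrite lee_fin.
have mG : measurable_fun [set: T] G.
  rewrite /G; under eq_fun do rewrite -big_filter.
  by apply: measurable_prod => i _; exact: measurableT_comp.
rewrite (bigD1 i0)//= EFinM -fe -(@ge0_integral_factor _ _ (X i0) G c (EFin \o f i0))//.
- by apply: eq_integral => w _; rewrite (bigD1 i0)//= EFinM.
- by move=> w; exact: prodr_ge0.
- exact: prodr_ge0.
- move=> A mA.
  (* With the factor at [i0] turned into an indicator the induction hypothesis applies, and it is
     exactly the condition on sets required by [ge0_integral_factor]. *)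
  pose f' i := if i == i0 then \1_A else f i.
  pose e' i := if i == i0 then fine (P (X i0 @^-1` A)) else e i.
  have mXA : measurable (X i0 @^-1` A).
    by rewrite -[X in measurable X]setTI; apply: mX.
  have <- : (\prod_i e' i)%:E = P (X i0 @^-1` A) * c%:E.
    rewrite (bigD1 i0)//= {1}/e' eqxx EFinM fineK ?fin_num_measure//.
    by congr (_ * _%:E); apply: eq_bigr => i /negbTE ii0; rewrite /e' ii0.
  rewrite -(IH f' e').
  + apply: eq_integral => w _; rewrite (bigD1 i0)//= {1}/f' eqxx EFinM.
    by congr (_ * _%:E); apply: eq_bigr => i /negbTE ii0; rewrite /f' ii0.
  + by move=> i x; rewrite /f'; case: ifPn => // _; rewrite indicE.
  + by move=> i; rewrite /f'; case: ifPn => // _; exact: measurable_indic.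
  + move=> i; rewrite /f' /e'; case: eqP => [->|//]; rewrite fineK ?fin_num_measure//.
    by rewrite integral_indic_comp.
  + move=> i is_; rewrite /f'; case: eqP => [_|/eqP ii0]; first by exists A.
    by apply: hs; rewrite in_cons negb_or ii0.
- by move=> x; rewrite lee_fin.
- exact/measurable_EFinP.
Qed.

End independence.

(** * Boxes and the sigma-algebra on matrices *)

Section matrix_measurability.
Context d (T : measurableType d) (m n : nat).

Let mx_entry_preimages : set (set 'M[T]_(m, n)) :=
  \bigcup_(ij in [set: 'I_m * 'I_n])
    preimage_set_system setT (fun A : 'M[T]_(m, n) => A ij.1 ij.2) measurable.

Lemma measurable_mx_entry i j :
  measurable_fun [set: 'M[T]_(m, n)] (fun A : 'M[T]_(m, n) => A i j).
Proof.
move=> _ B mB; rewrite setTI; apply: sub_sigma_algebra.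
by exists (i, j) => //; exists B => //; rewrite setTI.
Qed.

Lemma measurable_mx_fun d' (T' : measurableType d') (f : T' -> 'M[T]_(m, n)) :
  (forall i j, measurable_fun [set: T'] (fun x => f x i j)) ->
  measurable_fun [set: T'] f.
Proof.
move=> mf; apply: (measurability mx_entry_preimages) => //.
move=> _ [_ [[i j] _ [B mB <-]] <-]; rewrite !setTI.
by rewrite -[X in measurable X]setTI; exact: (mf i j).
Qed.

Definition mx_box (A : 'I_m -> 'I_n -> set T) : set 'M[T]_(m, n) :=
  [set M | forall i j, A i j (M i j)].

Lemma measurable_mx_box A : (forall i j, measurable (A i j)) ->
  measurable (mx_box A).
Proof.
move=> mA; rewrite (_ : mx_box A = \bigcap_(ij in [set: 'I_m * 'I_n])
    ((fun M : 'M[T]_(m, n) => M ij.1 ij.2) @^-1` A ij.1 ij.2)); last first.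
  apply/seteqP; split=> M /= h; first by move=> [i j] _; exact: h.
  by move=> i j; exact: (h (i, j)).
apply: fin_bigcap_measurable => // -[i j] _; rewrite -[X in measurable X]setTI.
exact: measurable_mx_entry.
Qed.

(** Boxes are stable under intersection and generate the sigma-algebra, since the preimage of a set
    by one entry is a box whose other sides are full. *)
Lemma mx_measure_unique (R : realType)
    (m1 m2 : {measure set 'M[T]_(m, n) -> \bar R}) :
  (m1 setT < +oo)%E ->
  (forall A, (forall i j, measurable (A i j)) -> m1 (mx_box A) = m2 (mx_box A)) ->
  forall A, measurable A -> m1 A = m2 A.
Proof.
move=> m1fin m12 A mA.
pose G := [set B | exists2 C, (forall i j, measurable (C i j)) & B = mx_box C].
apply: (measure_unique G (fun=> setT)) => //.
- apply/seteqP; split.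
    apply: smallest_sub; first exact: smallest_sigma_algebra.
    move=> _ [[i j] _ [B mB <-]]; apply: sub_sigma_algebra; rewrite setTI.
    exists (fun i' j' => if (i', j') == (i, j) then B else setT).
      by move=> i' j'; case: ifP.
    apply/seteqP; split=> M /=; last by move/(_ i j); rewrite eqxx.
    by move=> BM i' j'; case: eqP => // -[-> ->].
  apply: smallest_sub; first exact: sigma_algebra_measurable.
  by move=> _ [C mC ->]; exact: measurable_mx_box.
- move=> _ _ [B mB ->] [C mC ->]; exists (fun i j => B i j `&` C i j).
    by move=> i j; exact: measurableI.
  apply/seteqP; split=> M /=; first by move=> [h1 h2] i j; split.
  by move=> h; split=> i j; case: (h i j).
- by move=> _; exists (fun _ _ => setT) => //; apply/seteqP; split.
- by rewrite bigcup_const.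
- by move=> _ [C mC ->]; exact: m12.
Qed.

End matrix_measurability.

(** * Independence of two random matrices *)

Section pair_independence.
Context d (W : measurableType d) (R : realType) (Q : probability W R).
Local Open Scope ereal_scope.

(* Only the product rule on boxes is assumed: each factor is extended in turn
   from boxes to the sigma-algebra by uniqueness of measures. *)
Lemma mx_box_independent d1 (T1 : measurableType d1) d2 (T2 : measurableType d2)
    m n p q (U : W -> 'M[T1]_(m, n)) (V : W -> 'M[T2]_(p, q)) :
  measurable_fun [set: W] U -> measurable_fun [set: W] V ->
  (forall A B, (forall i j, measurable (A i j)) ->
     (forall i j, measurable (B i j)) ->
     Q (U @^-1` mx_box A `&` V @^-1` mx_box B) =
     Q (U @^-1` mx_box A) * Q (V @^-1` mx_box B)) ->
  forall A B, measurable A -> measurable B ->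
    Q (U @^-1` A `&` V @^-1` B) = Q (U @^-1` A) * Q (V @^-1` B).
Proof.
move=> mU mV h.
have mpre d' (T' : measurableType d') (Y : W -> T') A :
    measurable_fun [set: W] Y -> measurable A -> measurable (Y @^-1` A).
  by move=> mY mA; rewrite -[X in measurable X]setTI; exact: mY.
(* For a fixed event [E], both sides are finite measures in [A] that agree on boxes. This is used
   twice: first for [U] with [E] an arbitrary event of [V], then for [V] with [E] a box event of
   [U]. *)
have ext d' (T' : measurableType d') m' n' (Y : W -> 'M[T']_(m', n')) E :
    measurable_fun [set: W] Y -> measurable E ->
    (forall A, (forall i j, measurable (A i j)) ->
      Q (Y @^-1` mx_box A `&` E) = Q (Y @^-1` mx_box A) * Q E) ->
    forall A, measurable A -> Q (Y @^-1` A `&` E) = Q (Y @^-1` A) * Q E.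
  move=> mY mE hE A mA.
  pose c := NngNum (fine_ge0 (measure_ge0 Q E)).
  have QE : Q E = c%:num%:E by rewrite fineK// fin_num_measure.
  have := @mx_measure_unique _ T' m' n' R
    (measure_function_pushforward__canonical__measure_function_Measure
       (mrestr Q mE) mY)
    (measure_function_pushforward__canonical__measure_function_Measure
       (mscale c Q) mY).
  move=> /(_ _ _ A mA) /=; rewrite /pushforward/= /mrestr /mscale/= -QE muleC; apply.
    by rewrite preimage_setT setTI QE ltry.
  by move=> B mB; rewrite hE// muleC.
move=> A B mA mB; apply: (ext) => //; first exact: mpre.
move=> C mC; rewrite setIC muleC; apply: (ext) => //.
  by apply: mpre => //; exact: measurable_mx_box.
by move=> D mD; rewrite setIC muleC; exact: h.
Qed.

(** The joint law is the product of the marginals, so Tonelli's theorem turns the integral into an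
    iterated one. *)
Lemma independent_pair_integral d1 (T1 : measurableType d1)
    d2 (T2 : measurableType d2) (U : W -> T1) (V : W -> T2)
    (F : T1 * T2 -> \bar R) :
  measurable_fun [set: W] U -> measurable_fun [set: W] V ->
  (forall A B, measurable A -> measurable B ->
    Q (U @^-1` A `&` V @^-1` B) = Q (U @^-1` A) * Q (V @^-1` B)) ->
  (forall z, 0 <= F z) -> measurable_fun [set: T1 * T2] F ->
  \int[Q]_w F (U w, V w) = \int[Q]_w \int[Q]_w' F (U w, V w').
Proof.
move=> mU mV UV F0 mF.
have mUV : measurable_fun [set: W] (fun w => (U w, V w)).
  exact: measurable_fun_pair.
pose hU : {mfun W >-> T1} := HB.pack U (isMeasurableFun.Build _ _ _ _ _ mU).
pose hV : {mfun W >-> T2} := HB.pack V (isMeasurableFun.Build _ _ _ _ _ mV).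
pose hUV : {mfun W >-> (T1 * T2)%type} :=
  HB.pack (fun w => (U w, V w)) (isMeasurableFun.Build _ _ _ _ _ mUV).
transitivity (\int[distribution Q hUV]_z F z).
  by rewrite ge0_integral_distribution.
transitivity (\int[distribution Q hU \x distribution Q hV]_z F z).
  apply: eq_measure_integral => A mA _; apply/esym.
  by apply: product_measure_unique => // B C mB mC; exact: UV.
rewrite fubini_tonelli1// ge0_integral_distribution//=.
- apply: eq_integral => w _; rewrite /fubini_F ge0_integral_distribution//.
  by apply: measurableT_comp => //; exact: measurable_fun_pair.
- exact: measurable_fun_fubini_tonelli_F.
- by move=> x; exact: integral_ge0.
Qed.

End pair_independence.

(** * Integrals of nonnegative real functions *)

Section nonneg_integrals.
Context d (T : measurableType d) (R : realType).
Variable mu : {measure set T -> \bar R}.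
Local Open Scope ereal_scope.

Lemma le_integral_EFin (f g : T -> R) :
  (forall w, (0 <= f w)%R) -> (forall w, (f w <= g w)%R) ->
  measurable_fun [set: T] f -> measurable_fun [set: T] g ->
  \int[mu]_w (f w)%:E <= \int[mu]_w (g w)%:E.
Proof.
move=> f0 fg mf mg; apply: ge0_le_integral => //.
- by move=> w _; rewrite lee_fin.
- exact/measurable_EFinP.
- exact/measurable_EFinP.
- by move=> w _; rewrite lee_fin.
Qed.

Lemma integralD_nneg (f g : T -> R) :
  (forall w, (0 <= f w)%R) -> (forall w, (0 <= g w)%R) ->
  measurable_fun [set: T] f -> measurable_fun [set: T] g ->
  \int[mu]_w (f w + g w)%:E = \int[mu]_w (f w)%:E + \int[mu]_w (g w)%:E.
Proof.
move=> f0 g0 mf mg; rewrite -ge0_integralD//.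
- by move=> w _; rewrite lee_fin.
- exact/measurable_EFinP.
- by move=> w _; rewrite lee_fin.
- exact/measurable_EFinP.
Qed.

Lemma integralZl_nneg (k : R) (f : T -> R) :
  (0 <= k)%R -> (forall w, (0 <= f w)%R) -> measurable_fun [set: T] f ->
  \int[mu]_w (k * f w)%:E = k%:E * \int[mu]_w (f w)%:E.
Proof.
move=> k0 f0 mf; under eq_integral do rewrite EFinM.
rewrite ge0_integralZl_EFin//; first by move=> w _; rewrite lee_fin.
exact/measurable_EFinP.
Qed.

Lemma integral_sum_nneg (I : Type) (s : seq I) (f : I -> T -> R) :
  (forall i w, (0 <= f i w)%R) -> (forall i, measurable_fun [set: T] (f i)) ->
  \int[mu]_w (\sum_(i <- s) f i w)%:E = \sum_(i <- s) \int[mu]_w (f i w)%:E.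
Proof.
move=> f0 mf; under eq_integral do rewrite -sumEFin.
rewrite ge0_integral_sum//; first by move=> i; exact/measurable_EFinP.
by move=> i w _; rewrite lee_fin.
Qed.

(** Markov's inequality; every Chernoff bound below takes for [f] an exponential that is at least
    [1] on [A]. *)
Lemma measure_le_integral (A : set T) (f : T -> R) : measurable A ->
  (forall w, (0 <= f w)%R) -> (forall w, A w -> (1 <= f w)%R) ->
  measurable_fun [set: T] f -> mu A <= \int[mu]_w (f w)%:E.
Proof.
move=> mA f0 f1 mf.
rewrite -[X in mu X]setIT -integral_indic//; apply: le_integral_EFin => // w.
rewrite indicE; case: (boolP (w \in A)) => [|_]; last exact: f0.
by rewrite inE => /f1.
Qed.

End nonneg_integrals.

(** * Elementary exponential bounds and sub-Gaussian variables *)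

Section exponential_inequalities.
Context {R : realType}.
Implicit Types x y : R.

Lemma expR_le_inv1B x : x < 1 -> expR x <= (1 - x)^-1.
Proof.
move=> x1; rewrite -[x in expR x]opprK expRN lef_pV2 ?posrE ?expR_gt0 ?subr_gt0//.
exact: expR_ge1Dx.
Qed.

Lemma expR_half_le2 : expR (1 / 2) <= 2 :> R.
Proof.
rewrite (le_trans (expR_le_inv1B _))//; first by lra.
by rewrite (_ : 1 - 1 / 2 = 2^-1) ?invrK//; lra.
Qed.

Lemma expR1_le4 : expR 1 <= 4 :> R.
Proof.
have -> : 1 = 2%:R * (1 / 2) :> R by lra.
have := expR_half_le2; have := expR_ge0 (1 / 2 : R).
rewrite expRM_natl; nra.
Qed.

Lemma sqr_le_expR x : x ^+ 2 <= 2 * (expR x + expR (- x)).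
Proof.
have h y : 0 <= y -> y ^+ 2 <= 2 * expR y.
  move=> y0; have := expR_ge1Dxn 1 y0.
  by rewrite (_ : (2`!)%N = 2%N)//; lra.
have := expR_ge0 x; have := expR_ge0 (- x).
have [x0|x0] := leP 0 x; first by have := h _ x0; lra.
by have := h (- x); rewrite sqrrN oppr_ge0 ltW// => /(_ isT); lra.
Qed.

Lemma normr_le_expR x : `|x| <= expR x + expR (- x).
Proof.
have := expR_ge0 x; have := expR_ge0 (- x).
have := expR_ge1Dx x; have := expR_ge1Dx (- x).
by case: (ger0P x); lra.
Qed.

End exponential_inequalities.

Section subgaussian.
Context d (T : measurableType d) (R : realType) (P : probability T R).
Variables (Z : T -> R) (v : R).
Hypotheses (mZ : measurable_fun [set: T] Z) (v0 : 0 < v).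
Hypothesis mgf_le : forall l : R,
  (\int[P]_w (expR (l * Z w))%:E <= (expR (l ^+ 2 * v / 2))%:E)%E.

Let mexp (l : R) : measurable_fun [set: T] (fun w => expR (l * Z w)).
Proof. by apply: measurableT_comp => //; exact: measurable_funM. Qed.

(** With [l = v^(-1/2)], the square of [l Z] is at most [2 (exp (l Z) + exp (- l Z))], and both
    exponentials have mean at most [exp (1/2) <= 2]. *)
Lemma subgaussian_sqr : (\int[P]_w (Z w ^+ 2)%:E <= (8 * v)%:E)%E.
Proof.
pose l := (Num.sqrt v)^-1.
have l2 : l ^+ 2 = v^-1 by rewrite /l exprVn sqr_sqrtr// ltW.
have hl k : k ^+ 2 = v^-1 -> (\int[P]_w (expR (k * Z w))%:E <= 2%:E)%E.
  move=> k2; rewrite (le_trans (mgf_le k))// lee_fin k2 mulVf ?gt_eqF//.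
  exact: expR_half_le2.
apply: (@le_trans _ _ (\int[P]_w (v * 2 * (expR (l * Z w) + expR (- l * Z w)))%:E)%E).
  apply: le_integral_EFin => //.
  - by move=> w; exact: sqr_ge0.
  - move=> w; have := sqr_le_expR (l * Z w).
    by rewrite exprMn l2 ler_pdivrMl// mulNr mulrA.
  - by apply: measurable_funX.
  - by apply: measurable_funM => //; apply: measurable_funD.
rewrite integralZl_nneg; [|by rewrite mulr_ge0// ltW|
  by move=> w; rewrite addr_ge0// expR_ge0|exact: measurable_funD].
rewrite integralD_nneg//; try by move=> w; exact: expR_ge0.
have -> : (8 * v)%:E = ((v * 2)%:E * (2%:E + 2%:E))%E.
  by rewrite -EFinD -EFinM; congr EFin; ring.
apply: lee_wpmul2l; first by rewrite lee_fin mulr_ge0// ltW.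
by apply: leeD; apply: hl; rewrite ?sqrrN.
Qed.

Lemma subgaussian_integrable : P.-integrable [set: T] (EFin \o Z).
Proof.
apply/integrableP; split; first exact/measurable_EFinP.
apply: (@le_lt_trans _ _ (\int[P]_w (expR (1 * Z w) + expR (-1 * Z w))%:E)%E).
  apply: le_integral_EFin => //.
  - by move=> w; rewrite mul1r mulN1r; exact: normr_le_expR.
  - exact: measurableT_comp.
  - exact: measurable_funD.
rewrite integralD_nneg//; try by move=> w; exact: expR_ge0.
by rewrite lte_add_pinfty// (le_lt_trans (mgf_le _))// ltry.
Qed.

(** From [1 + l E Z <= E exp (l Z) <= exp (l^2 v / 2)] the mean is squeezed to zero by small [l] of
    either sign. *)
Lemma subgaussian_mean0 : (\int[P]_w (Z w)%:E = 0)%E.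
Proof.
have iZ := subgaussian_integrable.
set m := (\int[P]_w (Z w)%:E)%E.
have mfin : m \is a fin_num by exact: integrable_fin_num.
have key l : l * fine m <= expR (l ^+ 2 * v / 2) - 1.
  rewrite lerBrDl -lee_fin (le_trans _ (mgf_le l))// EFinD EFinM fineK//.
  have iexp : P.-integrable [set: T] (fun w => (expR (l * Z w))%:E).
    apply/integrableP; split; first exact/measurable_EFinP.
    under eq_integral do rewrite /= ger0_norm ?expR_ge0//.
    by rewrite (le_lt_trans (mgf_le _))// ltry.
  apply: (@le_trans _ _ (\int[P]_w (1%:E + l%:E * (Z w)%:E))%E).
    rewrite integralD//; last 2 first.
      exact: finite_measure_integrable_cst.
      exact: integrableZl.
    rewrite (integral_cst P)// mul1e [X in (_ <= X + _)%E](_ : _ = 1%E); last first.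
      exact: probability_setT.
    by rewrite integralZl.
  apply: le_integral => //.
    apply: integrableD => //; first exact: finite_measure_integrable_cst.
    exact: integrableZl.
  by move=> w _; rewrite -EFinM -EFinD lee_fin expR_ge1Dx.
have key2 l : l ^+ 2 * v <= 1 -> l * fine m <= l ^+ 2 * v.
  move=> lv; apply: (le_trans (key l)).
  set y := l ^+ 2 * v in lv *.
  have y0 : 0 <= y by rewrite mulr_ge0 ?sqr_ge0 ?ltW.
  have : expR (y / 2) <= (1 - y / 2)^-1 by apply: expR_le_inv1B; lra.
  suff : (1 - y / 2)^-1 <= 1 + y by lra.
  rewrite -[leLHS]mul1r ler_pdivrMr; nra.
suff : fine m = 0 by rewrite -{2}(fineK mfin) => ->.
apply/eqP/negPn/negP => m0.
(* The first term keeps [t^2 v <= 1], where [key2] applies; the second contradicts the resulting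
   [|m| <= t v]. *)
pose t := Num.min (1 / (Num.sqrt v)) (`|fine m| / (2 * v)).
have t0 : 0 < t.
  by rewrite lt_min !divr_gt0 ?sqrtr_gt0 ?mulr_gt0 ?normr_gt0.
have tv : t ^+ 2 * v <= 1.
  have -> : 1 = (1 / Num.sqrt v) ^+ 2 * v.
    by rewrite expr_div_n sqr_sqrtr ?ltW// expr1n mul1r mulVf ?gt_eqF.
  rewrite ler_pM2r// ler_pXn2r ?nnegrE ?(ltW t0) ?divr_ge0 ?sqrtr_ge0//.
  by rewrite /t ge_min lexx.
have tm : t * `|fine m| <= t ^+ 2 * v.
  case: (ger0P (fine m)) => _; first exact: key2.
  by rewrite mulrN -mulNr -sqrrN; apply: key2; rewrite sqrrN.
move: tm; rewrite expr2 -mulrA ler_pM2l// leNgt => /negP; apply.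
have tm : t <= `|fine m| / (2 * v) by rewrite /t ge_min lexx orbT.
rewrite -lter_pdivlMr// (le_lt_trans tm)// ltr_pM2l ?normr_gt0//.
by rewrite ltf_pV2 ?posrE ?mulr_gt0// ltr_pMl// ltr1n.
Qed.

Lemma subgaussian_tail s : 0 <= s ->
  (P [set w | (s <= Z w)%R] <= (expR (- (s ^+ 2 / (2 * v))))%:E)%E.
Proof.
move=> s0; pose l := s / v.
have mA : measurable [set w | s <= Z w].
  rewrite (_ : [set w | _] = Z @^-1` `[s, +oo[).
    by rewrite -[X in measurable X]setTI; exact: mZ.
  by apply/seteqP; split=> w /=; rewrite in_itv/= andbT.
apply: (@le_trans _ _ (\int[P]_w (expR (- (l * s)) * expR (l * Z w))%:E)%E).
  apply: measure_le_integral => //.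
  - move=> w /= sw; rewrite -expRD -expR0 ler_expR addrC subr_ge0.
    by rewrite ler_wpM2l// divr_ge0// ltW.
  - exact: measurable_funM.
rewrite integralZl_nneg ?expR_ge0//.
apply: (@le_trans _ _ ((expR (- (l * s)))%:E * (expR (l ^+ 2 * v / 2))%:E)%E).
  by apply: lee_wpmul2l => //; rewrite lee_fin expR_ge0.
rewrite -EFinM -expRD lee_fin ler_expR /l le_eqVlt; apply/orP; left; apply/eqP.
by field; rewrite gt_eqF.
Qed.

End subgaussian.

Lemma subgaussian_abs_tail d (T : measurableType d) (R : realType)
    (P : probability T R) (Z : T -> R) (v s : R) :
  measurable_fun [set: T] Z -> 0 < v ->
  (forall l : R,
    (\int[P]_w (expR (l * Z w))%:E <= (expR (l ^+ 2 * v / 2))%:E)%E) ->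
  0 <= s ->
  (P [set w | (s <= `|Z w|)%R] <= (2 * expR (- (s ^+ 2 / (2 * v))))%:E)%E.
Proof.
move=> mZ v0 h s0.
have mN : measurable_fun [set: T] (\- Z) by exact: measurableT_comp.
have mA (Y : T -> R) : measurable_fun [set: T] Y -> measurable [set w | s <= Y w].
  move=> mY; rewrite (_ : [set w | _] = Y @^-1` `[s, +oo[).
    by rewrite -[X in measurable X]setTI; exact: mY.
  by apply/seteqP; split=> w /=; rewrite in_itv/= andbT.
have -> : [set w | s <= `|Z w|] = [set w | s <= Z w] `|` [set w | s <= - Z w].
  by apply/seteqP; split=> w /=; rewrite ler_normr => /orP.
rewrite (le_trans (measureU2 _ _ _))//; try exact: mA.
rewrite mulrDl mul1r EFinD leeD//; first exact: subgaussian_tail.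
apply: (subgaussian_tail mN v0) => // l.
under eq_integral do rewrite mulrN -mulNr.
by rewrite -sqrrN; exact: h.
Qed.

(** * Mean value theorem and derivative of the oriented integral *)

Section real_calculus.
Context {R : realType}.
Implicit Types (f g df : R -> R) (a b t : R).

Lemma mean_value f df a b : (forall x : R, is_derive x 1 f (df x)) ->
  exists c, (Num.min a b <= c <= Num.max a b) /\ f b - f a = df c * (b - a).
Proof.
move=> fdf.
have cf : continuous f.
  by move=> x; apply: differentiable_continuous; apply/derivable1_diffP.
have mv (u v : R) : u <= v -> exists c : R, (u <= c <= v) /\ f v - f u = df c * (v - u).
  move=> uv; have [c cuv fE] := @MVT_segment _ f df u v uv
    (fun x _ => fdf x) (continuous_subspaceT cf).
  by exists c; split=> //; move: cuv; rewrite in_itv.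
have [ab|ba] := leP a b; first exact: mv.
have [c [cba fE]] := mv _ _ (ltW ba).
by exists c; split=> //; rewrite -[LHS]opprB fE -mulrN opprB.
Qed.

Lemma is_derive_fadd f g t (df dg : R) : is_derive t 1 f df ->
  is_derive t 1 g dg -> is_derive t 1 (fun u => f u + g u) (df + dg).
Proof. exact: is_deriveD. Qed.

Lemma is_derive_fsub f g t (df dg : R) : is_derive t 1 f df ->
  is_derive t 1 g dg -> is_derive t 1 (fun u => f u - g u) (df - dg).
Proof. exact: is_deriveB. Qed.

Lemma is_derive_fscale f k t (df : R) : is_derive t 1 f df ->
  is_derive t 1 (fun u => k * f u) (k * df).
Proof. exact: is_deriveZ. Qed.

Lemma is_derive_affine f a b t (df : R) : is_derive (a + b * t) 1 f df ->
  is_derive t 1 (fun u => f (a + b * u)) (b * df).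
Proof.
move=> fdf; rewrite mulrC.
apply: (@is_derive1_comp _ f (fun u => a + b * u)).
rewrite -[X in is_derive _ _ _ X]add0r; apply: is_derive_fadd.
by rewrite -[X in is_derive _ _ _ X]mulr1; apply: is_derive_fscale.
Qed.

(** A common base point [a] below both [0] and [t] removes the case split on the sign of [t], so
    that the fundamental theorem of calculus can be applied across zero. *)
Lemma itv_from0 f t a : continuous f -> a < t -> a < 0 ->
  integral_from0 f t =
  (\int[lebesgue_measure]_(u in `[a, t]) f u -
   \int[lebesgue_measure]_(u in `[a, 0%R]) f u)%R.
Proof.
move=> cf a_t a0.
have fi u v : lebesgue_measure.-integrable `[u, v] (EFin \o f).
  apply: continuous_compact_integrable; first exact: segment_compact.
  exact: continuous_subspaceT.
have fio u v : lebesgue_measure.-integrable `]u, v] (EFin \o f).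
  by apply: integrableS (fi u v) => //; exact: subset_itv_oc_cc.
rewrite /integral_from0; case: ifPn => [t0|].
  rewrite Rintegral_itvB// ?bnd_simp ?(ltW a0)//.
  by rewrite Rintegral_itv_obnd_cbnd.
rewrite -ltNge => t0; rewrite -opprB Rintegral_itvB// ?bnd_simp ?(ltW a_t) ?(ltW t0)//.
by rewrite Rintegral_itv_obnd_cbnd.
Qed.

Lemma integral_from00 f : integral_from0 f 0 = 0.
Proof. by rewrite /integral_from0 lexx set_itv1 Rintegral_set1. Qed.

Lemma is_derive_integral_from0 f t : continuous f ->
  is_derive t 1 (integral_from0 f) (f t).
Proof.
move=> cf; pose a := Num.min t 0 - 1.
have a_t : a < t by rewrite /a ltrBlDr (le_lt_trans (y := t))// ?ge_min ?lexx// ltrDl.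
have a0 : a < 0 by rewrite /a ltrBlDr (le_lt_trans (y := 0))// ?ge_min ?lexx ?orbT// ltrDl.
pose F y := (\int[lebesgue_measure]_(u in `[a, y]) f u)%R.
have fi : lebesgue_measure.-integrable `[a, t + 1] (EFin \o f).
  apply: continuous_compact_integrable; first exact: segment_compact.
  exact: continuous_subspaceT.
have [dF FE] := @continuous_FTC1_closed _ f a t (t + 1) (ltac:(by rewrite ltrDl)) fi a_t (cf t).
apply: (@near_eq_is_derive _ _ _ (fun y => F y - F 0)).
  near=> y; rewrite (itv_from0 cf (a := a))//; near: y.
  exact: lt_nbhsr.
rewrite -[f t]subr0; apply: is_deriveB.
by rewrite -FE derive1E; exact: DeriveDef.
Unshelve. all: by end_near. Qed.

End real_calculus.

(** * The link function and its saturation *)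

Section link.
Context {R : realType}.
Variables (psi chi : R -> R) (c2 c3 : R).
Hypotheses (hpsi : link_assumption psi c2 c3) (hchi : cutoff chi).

Local Notation dpsi := (psi^`()%classic).
Local Notation ddpsi := (psi^`(2)%classic).

Lemma is_derive_link (t : R) : is_derive t 1 psi (dpsi t).
Proof.
have := @link_derivable _ _ _ _ hpsi 0 t isT; rewrite derive1n0 => h.
by rewrite derive1E; exact: DeriveDef.
Qed.

Lemma is_derive_dlink (t : R) : is_derive t 1 dpsi (ddpsi t).
Proof.
have := @link_derivable _ _ _ _ hpsi 1 t isT; rewrite derive1n1 => h.
by rewrite derive1nS derive1n1 derive1E; exact: DeriveDef.
Qed.

Lemma continuous_link : continuous psi.
Proof.
move=> t; apply: differentiable_continuous; apply/derivable1_diffP.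
by have [] := is_derive_link t.
Qed.

Lemma continuous_dlink : continuous dpsi.
Proof.
move=> t; apply: differentiable_continuous; apply/derivable1_diffP.
by have [] := is_derive_dlink t.
Qed.

Lemma continuous_ddlink : continuous ddpsi.
Proof.
move=> t; apply: differentiable_continuous; apply/derivable1_diffP.
exact: (link_derivable hpsi).
Qed.

Lemma continuous_cutoff : continuous chi.
Proof.
move=> t; apply: differentiable_continuous; apply/derivable1_diffP.
exact: cutoff_derivable.
Qed.

Lemma link_c2_gt0 : 0 < c2.
Proof. by have /andP[] := link_curvature hpsi 0; exact: lt_le_trans. Qed.

Lemma dlink_growth t : `|dpsi t| <= `|dpsi 0| + c2 * `|t|.
Proof.
have [c [_]] := mean_value 0 t is_derive_dlink.
rewrite subr0 => /(congr1 (fun x => x + dpsi 0)); rewrite subrK => ->.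
rewrite addrC (le_trans (ler_normD _ _))// lerD2l normrM ler_wpM2r//.
by have /andP[h0 h1] := link_curvature hpsi c; rewrite gtr0_norm.
Qed.

(** The gap [f] between the parabola and [psi] satisfies [u f'(u) >= 0], because [psi'' <= c2], so
    it is smallest at [u = 0]. *)
Lemma link_taylor_le t s : psi (t + s) <= psi t + s * dpsi t + c2 * s ^+ 2 / 2.
Proof.
pose f u := c2 * u ^+ 2 / 2 + u * dpsi t - psi (t + u).
pose df u := c2 * u + dpsi t - dpsi (t + u).
have fdf (u : R) : is_derive u 1 f (df u).
  have h1 : is_derive u 1 (fun u : R => u) (1 : R) by exact: is_derive_id.
  have h2 : is_derive u 1 (fun u : R => psi (t + 1 * u)) (1 * dpsi (t + 1 * u)).
    by apply: is_derive_affine; exact: is_derive_link.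
  have := is_derive_fsub (is_derive_fadd
    (is_derive_fscale (c2 / 2) (is_deriveM h1 h1)) (is_derive_fscale (dpsi t) h1)) h2.
  set d := (X in is_derive _ _ _ X) => h3.
  have -> : f = (fun u => c2 / 2 * (u * u) + dpsi t * u - psi (t + 1 * u)).
    by apply/funext => x; rewrite /f mul1r; ring.
  suff -> : df u = d by exact: h3.
  by rewrite /d /df !mul1r /GRing.scale/=; field.
have df_ge u : 0 <= u * df u.
  have [c [_]] := mean_value t (t + u) is_derive_dlink.
  rewrite (_ : t + u - t = u); last by ring.
  move=> dE.
  have -> : df u = (c2 - ddpsi c) * u by rewrite /df mulrBl -dE; ring.
  rewrite mulrCA mulr_ge0//; last by rewrite -expr2 sqr_ge0.
  by rewrite subr_ge0; have /andP[] := link_curvature hpsi c.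
have [c [cs]] := mean_value 0 s fdf.
have -> : f s - f 0 = psi t + s * dpsi t + c2 * s ^+ 2 / 2 - psi (t + s).
  by rewrite /f addr0; ring.
rewrite subr0 => E; rewrite -subr_ge0 E.
have := df_ge c; move: cs; rewrite ge_min le_max.
have [-> _ _|c0] := eqVneq c 0.
  have -> : df 0 = 0 by rewrite /df mulr0 add0r addr0 subrr.
  by rewrite mul0r.
move=> /andP[/orP ca /orP cb].
have [cp|cn] := ltP 0 c.
  rewrite pmulr_rge0// => d0; rewrite mulr_ge0//.
  by case: cb => [/(lt_le_trans cp)|/(le_trans (ltW cp))]//; rewrite ltxx.
have {}cn : c < 0 by rewrite lt_neqAle c0.
rewrite nmulr_rge0// => d0; rewrite mulr_le0//.
by case: ca => [/le_lt_trans/(_ cn)|/le_trans/(_ (ltW cn))]//; rewrite ltxx.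
Qed.

Variable L : R.
Hypothesis L1 : 1 <= L.

Let sat_curv (u : R) := ddpsi u * chi (u / L).

Let continuous_sat_curv : continuous sat_curv.
Proof.
move=> t; apply: cvgM; first exact: continuous_ddlink.
apply: (@continuous_comp _ _ _ (fun u : R => u / L) chi).
  by apply: cvgM; [exact: cvg_id|exact: cvg_cst].
exact: continuous_cutoff.
Qed.

Lemma is_derive_dpsi_sat (t : R) :
  is_derive t 1 (dpsi_sat psi chi L) (ddpsi t * chi (t / L)).
Proof.
rewrite -[X in is_derive _ _ _ X]add0r; apply: is_derive_fadd.
exact: is_derive_integral_from0.
Qed.

Lemma continuous_dpsi_sat : continuous (dpsi_sat psi chi L).
Proof.
move=> t; apply: differentiable_continuous; apply/derivable1_diffP.
by have [] := is_derive_dpsi_sat t.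
Qed.

Lemma is_derive_psi_sat (t : R) :
  is_derive t 1 (psi_sat psi chi L) (dpsi_sat psi chi L t).
Proof.
rewrite -[X in is_derive _ _ _ X]add0r; apply: is_derive_fadd.
by apply: is_derive_integral_from0; exact: continuous_dpsi_sat.
Qed.

Lemma ddpsi_satE (t : R) :
  (psi_sat psi chi L)^`(2)%classic t = ddpsi t * chi (t / L).
Proof.
have -> : (psi_sat psi chi L)^`(2)%classic = (dpsi_sat psi chi L)^`()%classic.
  rewrite derive1nS derive1n1; congr (_^`()%classic); apply/funext => u.
  by rewrite derive1E; have [] := is_derive_psi_sat u.
by rewrite derive1E; have [] := is_derive_dpsi_sat t.
Qed.

Lemma dpsi_sat0 : dpsi_sat psi chi L 0 = dpsi 0.
Proof. by rewrite /dpsi_sat integral_from00 addr0. Qed.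

Let L0 : 0 < L. Proof. exact: lt_le_trans L1. Qed.

Lemma sat_curv_range t : 0 <= ddpsi t * chi (t / L) <= c2.
Proof.
have /andP[h0 h1] := link_curvature hpsi t.
have /andP[k0 k1] := cutoff_range hchi (t / L).
apply/andP; split; first by rewrite mulr_ge0// ltW.
apply: le_trans h1; by rewrite -[leRHS]mulr1 ler_wpM2l// ltW.
Qed.

(** Between [0] and [t] the cutoff equals [1], so the difference of the two functions has zero
    derivative there. *)
Lemma dpsi_satE t : `|t| <= L -> dpsi_sat psi chi L t = dpsi t.
Proof.
move=> tL.
have hd (u : R) : is_derive u 1 (fun u => dpsi_sat psi chi L u - dpsi u)
    (ddpsi u * chi (u / L) - ddpsi u).
  by apply: is_derive_fsub; [exact: is_derive_dpsi_sat|exact: is_derive_dlink].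
have [c [cb]] := mean_value 0 t hd.
rewrite dpsi_sat0 subrr subr0 (cutoff_one hchi).
  by rewrite mulr1 subrr mul0r => /eqP; rewrite subr_eq0 => /eqP.
rewrite normrM normfV (gtr0_norm L0) ler_pdivrMr// mul1r (le_trans _ tL)//.
move: cb; rewrite ge_min le_max; case: (ger0P t); case: (ger0P c); lra.
Qed.

(** The slope is at most [c2] on [[- 2 L, 2 L]] and zero outside, where the cutoff vanishes. This
    bound on the gradient weights, uniform in [t], makes the sensitivity finite. *)
Lemma dpsi_sat_bound t :
  `|dpsi_sat psi chi L t| <= `|dpsi 0| + 2 * c2 * L.
Proof.
have lip s u : `|dpsi_sat psi chi L s - dpsi_sat psi chi L u| <= c2 * `|s - u|.
  have [c [_ ->]] := mean_value u s is_derive_dpsi_sat.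
  have /andP[h0 h1] := sat_curv_range c.
  by rewrite normrM ler_wpM2r// ger0_norm.
have small s : `|s| <= 2 * L ->
    `|dpsi_sat psi chi L s| <= `|dpsi 0| + 2 * c2 * L.
  move=> sL; have := lip s 0; rewrite subr0 dpsi_sat0.
  have := ler_normD (dpsi_sat psi chi L s - dpsi 0) (dpsi 0); rewrite subrK.
  have : c2 * `|s| <= c2 * (2 * L) by rewrite ler_wpM2l// ltW// link_c2_gt0.
  lra.
have [|tL] := leP `|t| (2 * L); first exact: small.
(* The endpoint on the side of [t]; the function is constant between [s] and [t]. *)
pose s := if 0 <= t then 2 * L else - (2 * L).
have -> : dpsi_sat psi chi L t = dpsi_sat psi chi L s.
  have [c [cb]] := mean_value s t is_derive_dpsi_sat.
  rewrite (cutoff_zero hchi) ?mulr0 ?mul0r.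
    by move=> /eqP; rewrite subr_eq0 => /eqP.
  rewrite normrM normfV (gtr0_norm L0) ler_pdivlMr//.
  move: cb tL; rewrite /s ge_min le_max.
  by case: (ger0P t); case: (ger0P c); lra.
by apply: small; rewrite /s; case: ifP => _; rewrite ?normrN gtr0_norm ?mulr_gt0.
Qed.

End link.

(** * Uniqueness on rectangles and measurability of vector operations *)

Lemma rect_measure_unique d1 d2 (T1 : measurableType d1) (T2 : measurableType d2)
    (R : realType) (m1 m2 : {measure set (T1 * T2) -> \bar R}) :
  (m1 setT < +oo)%E ->
  (forall A B, measurable A -> measurable B -> m1 (A `*` B) = m2 (A `*` B)) ->
  forall X, measurable X -> m1 X = m2 X.
Proof.
move=> m1fin m12 X mX.
pose C : set (set (T1 * T2)) :=
  [set C | exists A, measurable A /\ exists B, measurable B /\ C = A `*` B].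
apply: (measure_unique C (fun=> setT)) => //.
- rewrite measurable_prod_measurableType //; congr (<<s _ >>).
  rewrite predeqE; split => [[A mA [B mB <-]]|[A [mA [B [mB ->]]]]].
    by exists A; split => //; exists B.
  by exists A => //; exists B.
- move=> /= _ _ [X1 [mX1 [X2 [mX2 ->]]]] [Y1 [mY1 [Y2 [mY2 ->]]]].
  rewrite -setXI; exists (X1 `&` Y1); split; first exact: measurableI.
  by exists (X2 `&` Y2); split => //; exact: measurableI.
- move=> _; exists setT; split=> //; exists setT; split=> //.
  by rewrite setXTT.
- by rewrite bigcup_const.
- by move=> _ [A [mA [B [mB ->]]]]; exact: m12.
Qed.

Section vector_measurability.
Context d (T : measurableType d) (R : realType).

Lemma measurable_dotv k (u v : T -> 'cV[R]_k) :
  measurable_fun [set: T] u -> measurable_fun [set: T] v ->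
  measurable_fun [set: T] (fun w => dotv (u w) (v w)).
Proof.
move=> mu mv; under eq_fun do rewrite dotvE.
apply: measurable_sum => i; apply: measurable_funM.
  exact: (measurableT_comp (measurable_mx_entry i 0)).
exact: (measurableT_comp (measurable_mx_entry i 0)).
Qed.

Lemma measurable_l2norm k (u : T -> 'cV[R]_k) : measurable_fun [set: T] u ->
  measurable_fun [set: T] (fun w => l2norm (u w)).
Proof.
move=> mu; rewrite /l2norm.
apply: (measurableT_comp (continuous_measurable_fun (@sqrt_continuous R))).
exact: measurable_dotv.
Qed.

Lemma measurable_scalev k (a : T -> R) (u : T -> 'cV[R]_k) :
  measurable_fun [set: T] a -> measurable_fun [set: T] u ->
  measurable_fun [set: T] (fun w => a w *: u w).
Proof.
move=> ma mu; apply: measurable_mx_fun => i j.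
under eq_fun do rewrite mxE; apply: measurable_funM => //.
exact: (measurableT_comp (measurable_mx_entry i j)).
Qed.

Lemma measurable_addv k (u v : T -> 'cV[R]_k) :
  measurable_fun [set: T] u -> measurable_fun [set: T] v ->
  measurable_fun [set: T] (fun w => u w + v w).
Proof.
move=> mu mv; apply: measurable_mx_fun => i j.
under eq_fun do rewrite mxE; apply: measurable_funD.
  exact: (measurableT_comp (measurable_mx_entry i j)).
exact: (measurableT_comp (measurable_mx_entry i j)).
Qed.

Lemma measurable_oppv k (u : T -> 'cV[R]_k) : measurable_fun [set: T] u ->
  measurable_fun [set: T] (fun w => - u w).
Proof.
move=> mu; under eq_fun do rewrite -scaleN1r.
by apply: measurable_scalev.
Qed.

Lemma measurable_sumv k (I : Type) (s : seq I) (u : I -> T -> 'cV[R]_k) :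
  (forall i, measurable_fun [set: T] (u i)) ->
  measurable_fun [set: T] (fun w => \sum_(i <- s) u i w).
Proof.
move=> mu; elim: s => [|i s IH].
  under eq_fun do rewrite big_nil.
  exact: measurable_cst.
under eq_fun do rewrite big_cons.
exact: measurable_addv.
Qed.

End vector_measurability.

(** * The law of a record and the conditional moment generating function *)

Section glm_law.
Context {R : realType} (d : nat).
Variables (fx : probability 'cV[R]_d R) (nu : {measure set R -> \bar R}).
Variables (psi : R -> R) (h : R -> R -> R) (c : R -> R) (sigma c2 c3 : R).
Variables (b : 'cV[R]_d) (mu : probability (R * 'cV[R]_d)%type R).
Hypotheses (hpsi : link_assumption psi c2 c3) (cs0 : 0 < c sigma).
Hypothesis hpdf : forall theta, is_pdf nu (glm_pdf psi h c sigma theta).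
Hypothesis hmu : glm_law fx nu psi h c sigma b mu.

Let cs := c sigma.
Let p0 := glm_pdf psi h c sigma 0.
Let p0_ge0 y : 0 <= p0 y. Proof. by have [_ /(_ y)] := hpdf 0. Qed.
Let mp0 : measurable_fun [set: R] p0. Proof. by have [] := hpdf 0. Qed.

Let tilt (y th : R) := expR ((y * th - psi th + psi 0) / cs).

Let tiltE y th : glm_pdf psi h c sigma th y = tilt y th * p0 y.
Proof.
rewrite /tilt /p0 /glm_pdf -/cs mulrCA -expRD; congr (_ * expR _).
by rewrite mulr0; field; rewrite gt_eqF.
Qed.

Let mtilt : measurable_fun [set: R * 'cV[R]_d]
  (fun z : R * 'cV[R]_d => tilt z.1 (dotv z.2 b)).
Proof.
have mb : measurable_fun [set: R * 'cV[R]_d]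
  (fun z : R * 'cV[R]_d => dotv z.2 b) by apply: measurable_dotv.
apply: (measurableT_comp (@measurable_expR R)); apply: measurable_funM => //.
apply: measurable_funD => //; apply: measurable_funB.
  exact: measurable_funM.
exact: (measurableT_comp (continuous_measurable_fun (continuous_link hpsi))).
Qed.

Local Open Scope ereal_scope.

(** Every density of the family is a tilt of the one at parameter [0], so the law of a record has
    density [tilt] with respect to the product of [mu0] and [fx]; the two agree on rectangles. *)
Lemma glm_integral (F : R * 'cV[R]_d -> R) : (forall z, (0 <= F z)%R) ->
  measurable_fun [set: R * 'cV[R]_d] F ->
  \int[mu]_z (F z)%:E =
  \int[fx]_x \int[nu]_y (F (y, x) * glm_pdf psi h c sigma (dotv x b) y)%:E.
Proof.
move=> F0 mF.
(* The dominating measure [nu] comes without sigma-finiteness; Tonelli's theorem is therefore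
   applied to the probability with density [p0]. *)
pose mu0 : probability R R := HB.pack (density nu p0_ge0 mp0)
  (Measure_isProbability.Build _ _ _ (density nu p0_ge0 mp0)
    (let: And3 _ _ e := hpdf 0 in e)).
have tilt0 (z : R * 'cV[R]_d) : (0 <= tilt z.1 (dotv z.2 b))%R by exact: expR_ge0.
pose D := density (mu0 \x fx)%E tilt0 mtilt.
have iter (G : R * 'cV[R]_d -> R) : (forall z, (0 <= G z)%R) ->
    measurable_fun [set: R * 'cV[R]_d] G ->
    \int[D]_z (G z)%:E =
    \int[fx]_x \int[nu]_y (G (y, x) * glm_pdf psi h c sigma (dotv x b) y)%:E.
  move=> G0 mG; rewrite ge0_integral_density//; last exact/measurable_EFinP.
  under eq_integral do rewrite -EFinM.
  have mGt : measurable_fun [set: R * 'cV[R]_d]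
      (fun z : R * 'cV[R]_d => (G z * tilt z.1 (dotv z.2 b))%:E).
    by apply/measurable_EFinP; apply: measurable_funM.
  rewrite fubini_tonelli2//; last by move=> z; rewrite lee_fin mulr_ge0.
  apply: eq_integral => x _; rewrite /fubini_G/=.
  rewrite ge0_integral_density; [|by move=> y; rewrite lee_fin mulr_ge0// expR_ge0|
    exact: (measurable_fun_pair1 x mGt)].
  by apply: eq_integral => y _; rewrite -EFinM -mulrA -tiltE.
rewrite -iter//; apply: eq_measure_integral => A mA _.
apply: rect_measure_unique => //.
  by apply: (@le_lt_trans _ _ 1); [exact: probability_le1|exact: ltry].
move=> B A' mB mA'.
transitivity (\int[fx]_(x in A') \int[nu]_(y in B)
    (glm_pdf psi h c sigma (dotv x b) y)%:E); first exact: hmu.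
transitivity (\int[D]_z (\1_(B `*` A') z)%:E); last first.
  by rewrite integral_indic//= ?setIT//; exact: measurableX.
rewrite iter//; last exact: measurable_indic (measurableX _ _).
rewrite integral_mkcond; apply: eq_integral => x _; rewrite patchE.
case: ifPn => xA.
  rewrite integral_mkcond; apply: eq_integral => y _; rewrite patchE.
  rewrite indicE; case: ifPn => yB.
    by rewrite mem_set ?mul1r//; split=> /=; rewrite -inE.
  rewrite memNset ?mul0r// => -[/=]; rewrite -inE => yB'.
  by rewrite yB' in yB.
apply/esym; apply: integral0_eq => y _.
rewrite indicE memNset ?mul0r// => -[/= _]; rewrite -inE => xA'.
by rewrite xA' in xA.
Qed.

Lemma glm_pdf_integral th : \int[nu]_y (glm_pdf psi h c sigma th y)%:E = 1.
Proof. by have [] := hpdf th. Qed.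

Lemma glm_design_integral (g : 'cV[R]_d -> R) : (forall x, (0 <= g x)%R) ->
  measurable_fun [set: 'cV[R]_d] g ->
  \int[mu]_z (g z.2)%:E = \int[fx]_x (g x)%:E.
Proof.
move=> g0 mg; rewrite (@glm_integral (fun z => g z.2))//; last first.
  exact: measurableT_comp.
apply: eq_integral => x _ /=; have [mp p0' ip] := hpdf (dotv x b).
by rewrite integralZl_nneg// ip mule1.
Qed.

(** Multiplying the density by [exp (g y)] shifts the parameter by [g c(sigma)], so the conditional
    moment generating function is explicit in [psi] and [link_taylor_le] bounds it. Letting [g]
    depend on [x] covers both the residual (constant [g]) and the coordinates of the score. *)
Lemma glm_mgf_le (g : 'cV[R]_d -> R) : measurable_fun [set: 'cV[R]_d] g ->
  \int[mu]_z (expR (g z.2 * (z.1 - psi^`()%classic (dotv z.2 b))))%:E <=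
  \int[fx]_x (expR (g x ^+ 2 * (c2 * c sigma) / 2))%:E.
Proof.
move=> mg.
have mb : measurable_fun [set: R * 'cV[R]_d]
  (fun z : R * 'cV[R]_d => dotv z.2 b) by apply: measurable_dotv.
have mF : measurable_fun [set: R * 'cV[R]_d]
    (fun z : R * 'cV[R]_d => expR (g z.2 * (z.1 - psi^`()%classic (dotv z.2 b)))).
  apply: (measurableT_comp (@measurable_expR R)); apply: measurable_funM.
    exact: measurableT_comp.
  apply: measurable_funB => //.
  exact: (measurableT_comp (continuous_measurable_fun (continuous_dlink hpsi))).
rewrite (glm_integral (fun z => expR_ge0 _) mF).
pose m x := expR ((psi (dotv x b + g x * cs) - psi (dotv x b) -
  g x * cs * psi^`()%classic (dotv x b)) / cs).
have mbx : measurable_fun [set: 'cV[R]_d] (fun x : 'cV[R]_d => dotv x b).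
  exact: measurable_dotv.
have mpsi := continuous_measurable_fun (continuous_link hpsi).
have mdpsi := continuous_measurable_fun (continuous_dlink hpsi).
have mm : measurable_fun [set: 'cV[R]_d] m.
  apply: (measurableT_comp (@measurable_expR R)); apply: measurable_funM => //.
  apply: measurable_funB; last first.
    apply: measurable_funM; first exact: measurable_funM.
    exact: (measurableT_comp mdpsi).
  apply: measurable_funB; apply: (measurableT_comp mpsi) => //.
  by apply: measurable_funD => //; exact: measurable_funM.
rewrite (eq_integral (fun x => (m x)%:E)).
  apply: le_integral_EFin => //; first by move=> x; exact: expR_ge0.
  - move=> x; rewrite ler_expR ler_pdivrMr//.
    have := link_taylor_le hpsi (dotv x b) (g x * cs).
    suff -> : (g x ^+ 2 * (c2 * c sigma) / 2 * cs =
      c2 * (g x * cs) ^+ 2 / 2)%R by lra.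
    by rewrite /cs; ring.
  - apply: (measurableT_comp (@measurable_expR R)); apply: measurable_funM => //.
    by apply: measurable_funM => //; exact: measurable_funX.
move=> x _ /=.
have [mp p0' ip] := hpdf (dotv x b + g x * cs).
transitivity (\int[nu]_y
    (m x * glm_pdf psi h c sigma (dotv x b + g x * cs) y)%:E).
  apply: eq_integral => y _; congr EFin.
  rewrite /glm_pdf -/cs mulrCA [RHS]mulrCA -!expRD; congr (_ * expR _)%R.
  by rewrite /cs; field; rewrite gt_eqF.
by rewrite integralZl_nneg// ?ip ?mule1//; exact: expR_ge0.
Qed.

End glm_law.

Lemma measure_union_bound d (T : measurableType d) (R : realType)
    (mu : {measure set T -> \bar R}) (I : finType) (P : pred I)
    (A : set T) (B : I -> set T) :
  measurable A -> (forall i, measurable (B i)) ->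
  (forall w, A w -> exists2 i, P i & B i w) ->
  (mu A <= \sum_(i | P i) mu (B i))%E.
Proof.
move=> mA mB AB.
apply: (@le_trans _ _ (\int[mu]_w (\sum_(i <- enum P) \1_(B i) w)%:E)%E).
  apply: measure_le_integral => //.
  - by move=> w; apply: sumr_ge0 => i _; rewrite indicE.
  - move=> w /AB[i Pi Bi]; rewrite (bigD1_seq i) ?mem_enum ?enum_uniq//=.
    by rewrite indicE mem_set// lerDl sumr_ge0.
  - by apply: measurable_sum => i; exact: measurable_indic.
rewrite integral_sum_nneg => [|i w|i]; [|by rewrite indicE|exact: measurable_indic].
rewrite big_enum/= lee_sum// => i _.
by rewrite integral_indic// setIT.
Qed.

(** * Lattice points, from which all nets are built *)

Section lattice.
Context {R : realType} (d N : nat).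
Implicit Types (v : 'cV[R]_d).

(** Integer vectors coded by sign and absolute value in each coordinate. A zero coordinate has two
    codes, which only enlarges the counts, and these are bounded from above. *)
Definition lattice_pt (f : {ffun 'I_d -> bool * 'I_N.+1}) : 'cV[R]_d :=
  \col_j ((-1) ^+ (f j).1 * (f j).2%:R).

Lemma l2norm_mono v (w : 'cV[R]_d) : (forall i, `|v i 0| <= `|w i 0|) -> l2norm v <= l2norm w.
Proof.
move=> vw; rewrite /l2norm ler_wsqrtr// !dotvE ler_sum// => i _.
by rewrite -!expr2 -(real_normK (num_real (v i 0))) -(real_normK (num_real (w i 0)))
  ler_pXn2r ?nnegrE.
Qed.

(** Each coordinate is rounded towards zero: it moves by at most [1] and the norm does not grow, so
    net points stay inside the ball. *)
Lemma lattice_round v : (forall i, `|v i 0| <= N%:R) ->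
  exists f, l2norm (lattice_pt f) <= l2norm v /\
            l2norm (v - lattice_pt f) <= Num.sqrt d%:R.
Proof.
move=> vN.
have tN (i : 'I_d) : (Num.truncn (`|v i 0|%R : R) < N.+1)%N.
  by rewrite ltnS -(@ler_nat R) (le_trans _ (vN i))// truncn_le.
pose f := [ffun i => (v i 0 < 0, Ordinal (tN i))].
have tv i : (Num.truncn `|v i 0|)%:R <= `|v i 0| by rewrite truncn_le.
exists f; split.
  apply: l2norm_mono => i; rewrite mxE ffunE/= normrM normrX normrN1 expr1n mul1r.
  by rewrite ger0_norm.
rewrite -[leRHS]mul1r; apply: l2norm_le_coord => // i; rewrite !mxE ffunE/=.
have := truncnS_gt `|v i 0|; have := tv i; rewrite -natr1.
set t := (Num.truncn _)%:R => h1 h2.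
case: (ltP (v i 0) 0) h1 h2 => v0.
  rewrite expr1 mulN1r opprK (ltr0_norm v0) ler_norml => h1 h2; lra.
by rewrite expr0 mul1r (ger0_norm v0) ler_norml => h1 h2; lra.
Qed.

(* Generating function: weight every lattice point by exp (- |z|^2) and
   factorize over the coordinates. *)
Lemma lattice_card_le (r : R) :
  (\sum_(f | l2norm (lattice_pt f) ^+ 2 <= r) 1) <= expR r * 4 ^+ d.
Proof.
apply: (@le_trans _ _ (\sum_(f : {ffun 'I_d -> bool * 'I_N.+1})
   expR r * \prod_j expR (- ((f j).2%:R ^+ 2)))).
  rewrite big_mkcond ler_sum// => f _; rewrite -expR_sum -expRD.
  case: ifP => [fr|_]; last exact: expR_ge0.
  rewrite -[X in X <= _]expR0 ler_expR sumrN subr_ge0 (le_trans _ fr)//.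
  rewrite sqr_l2norm dotvE ler_sum// => j _; rewrite mxE -expr2 exprMn.
  by rewrite -exprM mulnC exprM sqrrN expr1n expr1n mul1r.
rewrite -mulr_sumr ler_wpM2l ?expR_ge0//.
rewrite -(bigA_distr_bigA (fun (j : 'I_d) (x : bool * 'I_N.+1) => expR (- (x.2%:R ^+ 2)))).
rewrite prodr_const card_ord; apply: lerXn2r; rewrite ?nnegrE//.
  by apply: sumr_ge0 => *; exact: expR_ge0.
rewrite -(pair_big predT predT (fun (b : bool) (m : 'I_N.+1) => expR (- (m%:R ^+ 2))))/=.
(* Comparison with the geometric series of ratio [1/2]; the two signs then give the factor [4] per
   coordinate. *)
have hN : \sum_(m < N.+1) expR (- (m%:R ^+ 2)) <= 2 :> R.
  apply: (@le_trans _ _ (\sum_(m < N.+1) 2^-1 ^+ m)).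
    apply: ler_sum => m _; apply: (@le_trans _ _ (expR (- m%:R))).
      rewrite ler_expR lerN2 -natrX ler_nat; case: (val m) => // k.
      by rewrite expnS leq_pmulr.
    rewrite expRN -(mulr1 m%:R) expRM_natl exprVn lef_pV2 ?posrE ?exprn_gt0 ?expR_gt0//.
    rewrite lerXn2r ?nnegrE ?expR_ge0//.
    by have := expR_ge1Dx (1 : R); lra.
  suff -> : \sum_(m < N.+1) 2^-1 ^+ m = 2 - 2^-1 ^+ N :> R.
    by rewrite gerBl exprn_ge0.
  elim: N => [|k IH]; first by rewrite big_ord_recl big_ord0 !expr0; lra.
  by rewrite big_ord_recr/= IH exprS; lra.
by rewrite big_bool/=; lra.
Qed.

End lattice.

(** * Tails and moments of the design *)

Section design.
Context {R : realType} (d : nat) (fx : probability 'cV[R]_d R) (C Kx : R).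
Hypotheses (Kx0 : 0 < Kx) (hD : design_assumption fx C Kx).

Lemma measurable_dotl (u : 'cV[R]_d) : measurable_fun [set: 'cV[R]_d] (dotv u).
Proof. exact: measurable_dotv. Qed.

(** The Orlicz norm is an infimum that need not be attained; doubling [Kx] leaves strict room, so
    some admissible [t] lies below [2 Kx |u|]. The room vanishes at [u = 0], which is treated
    apart. *)
Lemma design_exp_sqr (u : 'cV[R]_d) : l2norm u <= 1 ->
  (\int[fx]_x (expR ((dotv u x / (2 * Kx)) ^+ 2))%:E <= 2%:E)%E.
Proof.
move=> u1.
have [u0|u0] := eqVneq u 0.
  rewrite u0; under eq_integral do rewrite dotv0l mul0r expr0n expR0.
  rewrite integral_cst// mul1e (@le_trans _ _ 1%E)//; first exact: probability_le1.
  by rewrite lee_fin; lra.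
have un : 0 < l2norm u.
  by rewrite lt_def l2norm_ge0 andbT; apply: contra_neq u0; exact: l2norm_eq0.
have := design_subgaussian hD u; rewrite /psi2_norm => hinf.
have : (ereal_inf [set t%:E | t in [set t : R | (0 < t)%R /\
   ('E_fx[fun w => expR ((dotv u w / t) ^+ 2)%R] <= 2%:E)%E]] <
   (2 * Kx * l2norm u)%:E)%E.
  by rewrite (le_lt_trans hinf)// lte_fin ltr_pM2r// ltr_pMl// ltr1n.
move=> /ereal_inf_lt[_ [t [t0 ht] <-]]; rewrite lte_fin => tK.
apply: le_trans ht; rewrite unlock.
have mE s : measurable_fun [set: 'cV[R]_d] (fun x => expR ((dotv u x / s) ^+ 2)).
  apply: measurableT_comp => //; apply: measurable_funX; apply: measurable_funM => //.
  exact: measurable_dotl.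
apply: le_integral_EFin => // x.
rewrite ler_expR !expr_div_n ler_wpM2l ?sqr_ge0// lef_pV2 ?posrE ?exprn_gt0 ?mulr_gt0//.
rewrite ler_pXn2r ?nnegrE ?(ltW t0) ?mulr_ge0 ?(ltW Kx0)//.
by rewrite (le_trans (ltW tK))// ler_piMr// mulr_ge0// ltW.
Qed.

Lemma measurable_ge_set d' (T : measurableType d') (f : T -> R) s :
  measurable_fun [set: T] f -> measurable [set x | s <= f x].
Proof.
move=> mf; rewrite (_ : [set x | _] = f @^-1` `[s, +oo[).
  by rewrite -[X in measurable X]setTI; exact: mf.
by apply/seteqP; split=> w /=; rewrite in_itv/= andbT.
Qed.

Lemma design_tail (u : 'cV[R]_d) s : l2norm u <= 1 -> 0 <= s ->
  (fx [set x | (s <= `|dotv u x|)%R] <= (2 * expR (- (s ^+ 2 / (4 * Kx ^+ 2))))%:E)%E.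
Proof.
move=> u1 s0.
have mE : measurable_fun [set: 'cV[R]_d] (fun x => expR ((dotv u x / (2 * Kx)) ^+ 2)).
  apply: measurableT_comp => //; apply: measurable_funX; apply: measurable_funM => //.
  exact: measurable_dotl.
have K40 : 0 < 4 * Kx ^+ 2 by rewrite mulr_gt0// exprn_gt0.
apply: (@le_trans _ _ (\int[fx]_x (expR (- (s ^+ 2 / (4 * Kx ^+ 2))) *
    expR ((dotv u x / (2 * Kx)) ^+ 2))%:E)%E).
  apply: measure_le_integral.
  - apply: measurable_ge_set; apply: measurableT_comp => //; exact: measurable_dotl.
  - by move=> x; rewrite mulr_ge0 ?expR_ge0.
  - move=> x /= sx; rewrite -expRD -[leLHS]expR0 ler_expR addrC subr_ge0.
    have -> : (dotv u x / (2 * Kx)) ^+ 2 = dotv u x ^+ 2 / (4 * Kx ^+ 2).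
      by field; rewrite gt_eqF.
    rewrite ler_pM2r ?invr_gt0// -(real_normK (num_real (dotv u x))).
    by rewrite ler_pXn2r ?nnegrE.
  - exact: measurable_funM.
rewrite integralZl_nneg; [|exact: expR_ge0|by move=> x; exact: expR_ge0|exact: mE].
rewrite [X in (_ <= X%:E)%E]mulrC EFinM lee_wpmul2l ?lee_fin ?expR_ge0//.
exact: design_exp_sqr.
Qed.

(** Uses [y^2 / 2 <= exp y] at [y = (<u, x> / (2 Kx))^2], whose exponential has mean at most [2]. *)
Lemma design_fourth_moment (u : 'cV[R]_d) : l2norm u <= 1 ->
  (\int[fx]_x (dotv u x ^+ 4)%:E <= (64 * Kx ^+ 4)%:E)%E.
Proof.
move=> u1.
have mE : measurable_fun [set: 'cV[R]_d] (fun x => expR ((dotv u x / (2 * Kx)) ^+ 2)).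
  apply: measurableT_comp => //; apply: measurable_funX; apply: measurable_funM => //.
  exact: measurable_dotl.
apply: (@le_trans _ _ (\int[fx]_x (32 * Kx ^+ 4 *
    expR ((dotv u x / (2 * Kx)) ^+ 2))%:E)%E).
  apply: le_integral_EFin.
  - by move=> x; rewrite (exprM _ 2 2) sqr_ge0.
  - move=> x; have := @expR_ge1Dxn R ((dotv u x / (2 * Kx)) ^+ 2) 1 (sqr_ge0 _).
    rewrite (_ : (2`!)%N = 2%N)// -exprM => h.
    have -> : dotv u x ^+ 4 = 16 * Kx ^+ 4 * (dotv u x / (2 * Kx)) ^+ (2 * 2).
      by field; rewrite gt_eqF.
    rewrite (_ : 32 * Kx ^+ 4 = 16 * Kx ^+ 4 * 2); last by ring.
    rewrite -[leRHS]mulrA ler_wpM2l//; last by lra.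
    by rewrite mulr_ge0// exprn_ge0// ltW.
  - by apply: measurable_funX; exact: measurable_dotl.
  - exact: measurable_funM.
have K0 : 0 <= 32 * Kx ^+ 4 by rewrite mulr_ge0// exprn_ge0// ltW.
rewrite integralZl_nneg; [|exact: K0|by move=> x; exact: expR_ge0|exact: mE].
rewrite (_ : 64 * Kx ^+ 4 = 32 * Kx ^+ 4 * 2); last by ring.
rewrite [X in (_ <= X)%E]EFinM lee_wpmul2l ?lee_fin//.
exact: design_exp_sqr.
Qed.

(** Union bound over a net of the unit ball with mesh [1/2]: a vector of norm at least [s] has inner
    product at least [s / 2] with some net point, and the net has at most
    [exp (4 d) 4^d <= exp (6 d)] points. *)
Lemma design_norm_tail s : 0 < s -> (0 < d)%N ->
  (fx [set x | (s <= l2norm x)%R] <=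
   (2 * expR (6 * d%:R - s ^+ 2 / (16 * Kx ^+ 2)))%:E)%E.
Proof.
move=> s0 d0.
have sd0 : 0 < Num.sqrt d%:R :> R by rewrite sqrtr_gt0 ltr0n.
pose N := (2 * d)%N.
pose F := {ffun 'I_d -> bool * 'I_N.+1}.
pose w (f : F) : 'cV[R]_d := (2 * Num.sqrt d%:R)^-1 *: lattice_pt f.
pose P (f : F) := l2norm (lattice_pt f : 'cV[R]_d) ^+ 2 <= 4 * d%:R.
have mA (f : F) : measurable [set x | s / 2 <= `|dotv (w f) x|].
  by apply: measurable_ge_set; apply: measurableT_comp => //; exact: measurable_dotl.
have sub : [set x : 'cV[R]_d | s <= l2norm x] `<=`
    \bigcup_(f in [set f : F | P f]) [set x | s / 2 <= `|dotv (w f) x|].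
  move=> x /= sx.
  have x0 : 0 < l2norm x by exact: lt_le_trans sx.
  (* At norm [2 sqrt d] the rounding error [sqrt d] costs half of the inner product with [x]. *)
  pose v : 'cV[R]_d := (2 * Num.sqrt d%:R / l2norm x) *: x.
  have vn : l2norm v = 2 * Num.sqrt d%:R.
    rewrite l2normZ ger0_norm; last by rewrite divr_ge0 ?mulr_ge0 ?sqrtr_ge0 ?l2norm_ge0.
    by rewrite divfK// gt_eqF.
  have [i|f [f1 f2]] := @lattice_round R d N v.
    rewrite (le_trans (normr_coord_le v i))// vn /N natrM ler_wpM2l//.
    rewrite -[leRHS]ger0_norm// -sqrtr_sqr ler_wsqrtr// expr2.
    by rewrite -[leLHS]mulr1 ler_wpM2l// ler1n.
  exists f.
    rewrite /= /P (_ : 4 * d%:R = (2 * Num.sqrt d%:R) ^+ 2); last first.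
      by rewrite exprMn sqr_sqrtr//; congr (_ * _); rewrite expr2; lra.
    by rewrite -vn ler_pXn2r ?nnegrE ?l2norm_ge0.
  rewrite /= (le_trans _ (ler_norm _))// /w dotvZl.
  have : dotv (v - lattice_pt f) x <= Num.sqrt d%:R * l2norm x.
    by rewrite (le_trans (dotv_le _ _))// ler_wpM2r// l2norm_ge0.
  rewrite dotvBl /v dotvZl -sqr_l2norm expr2 mulrA divfK ?gt_eqF// => h.
  rewrite ler_pdivlMl ?mulr_gt0//.
  have : Num.sqrt d%:R * s <= Num.sqrt d%:R * l2norm x by rewrite ler_wpM2l// ltW.
  lra.
apply: (@le_trans _ _ (\sum_(f : F | P f) fx [set x | (s / 2 <= `|dotv (w f) x|)%R])%E).
  apply: measure_union_bound => //.
    by apply: measurable_ge_set; exact: measurable_l2norm.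
pose e := expR (- ((s / 2) ^+ 2 / (4 * Kx ^+ 2))).
apply: (@le_trans _ _ (\sum_(f : F | P f) (2 * e)%:E)%E).
  apply: lee_sum => f Pf; apply: design_tail; last by rewrite divr_ge0// ltW.
  rewrite /w l2normZ ger0_norm ?invr_ge0 ?mulr_ge0 ?sqrtr_ge0//.
  rewrite ler_pdivrMl ?mulr_gt0// mulr1.
  rewrite -(@ler_pXn2r _ 2) ?nnegrE ?l2norm_ge0 ?mulr_ge0 ?sqrtr_ge0//.
  rewrite exprMn (sqr_sqrtr (ler0n _ d)); apply: (le_trans Pf); rewrite ler_wpM2r//.
  by rewrite expr2; lra.
rewrite sumEFin lee_fin.
have -> : \sum_(f | P f) (2 * e) = (2 * e) * \sum_(f | P f) 1.
  by rewrite mulr_sumr; apply: eq_bigr => f _; rewrite mulr1.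
have -> : expR (6 * d%:R - s ^+ 2 / (16 * Kx ^+ 2)) = e * expR (6 * d%:R).
  rewrite /e -expRD addrC; congr (expR (_ + _)); congr (- _).
  by field; rewrite gt_eqF.
rewrite mulrA ler_wpM2l ?mulr_ge0 ?expR_ge0//.
apply: (le_trans (@lattice_card_le R d N _)).
rewrite (_ : 6 * d%:R = 4 * d%:R + d%:R * 2 :> R); last by ring.
rewrite expRD ler_wpM2l ?expR_ge0// expRM_natl lerXn2r ?nnegrE ?expR_ge0//.
rewrite (_ : 4 = 2 ^+ 2 :> R); last by rewrite expr2; lra.
rewrite -[X in expR X]mulr1 expRM_natl lerXn2r ?nnegrE ?expR_ge0//.
by have := expR_ge1Dx (1 : R); lra.
Qed.

End design.

Section design_second_moment.
Context {R : realType} (d : nat) (fx : probability 'cV[R]_d R) (C Kx : R).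
Hypotheses (Kx0 : 0 < Kx) (hD : design_assumption fx C Kx).

Lemma l2norm_delta (i : 'I_d) : l2norm (delta_mx i 0 : 'cV[R]_d) = 1.
Proof.
rewrite /l2norm dotvE (bigD1 i)//= big1 => [|j ji].
  by rewrite !mxE !eqxx mulr1 addr0 sqrtr1.
by rewrite !mxE (negbTE ji) mul0r.
Qed.

Lemma dotv_delta (i : 'I_d) (x : 'cV[R]_d) : dotv (delta_mx i 0) x = x i 0.
Proof.
rewrite dotvE (bigD1 i)//= big1 => [|j ji].
  by rewrite !mxE !eqxx mul1r addr0.
by rewrite !mxE (negbTE ji) mul0r.
Qed.

Lemma design_coord_integrable (i j : 'I_d) :
  fx.-integrable setT (fun x : 'cV[R]_d => (x i 0 * x j 0)%:E).
Proof.
have mx i' : measurable_fun [set: 'cV[R]_d] (fun x : 'cV[R]_d => x i' 0).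
  exact: measurable_mx_entry.
have mq i' : measurable_fun [set: 'cV[R]_d]
    (fun x : 'cV[R]_d => 16 * Kx ^+ 2 * expR ((x i' 0 / (2 * Kx)) ^+ 2)).
  apply: measurable_funM => //; apply: measurableT_comp => //.
  by apply: measurable_funX; exact: measurable_funM.
have k0 : 0 <= 16 * Kx ^+ 2 by rewrite mulr_ge0// sqr_ge0.
have q0 i' (x : 'cV[R]_d) : 0 <= 16 * Kx ^+ 2 * expR ((x i' 0 / (2 * Kx)) ^+ 2).
  by rewrite mulr_ge0// expR_ge0.
have qi i' : (\int[fx]_x (16 * Kx ^+ 2 * expR ((x i' 0 / (2 * Kx)) ^+ 2))%:E < +oo)%E.
  rewrite integralZl_nneg//; last first.
    apply: measurableT_comp => //.
    by apply: measurable_funX; exact: measurable_funM.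
  have h : (\int[fx]_x (expR ((x i' 0 / (2 * Kx)) ^+ 2))%:E <= 2%:E)%E.
    rewrite (eq_integral (fun x => (expR ((dotv (delta_mx i' 0) x / (2 * Kx)) ^+ 2))%:E)).
      by apply: (design_exp_sqr Kx0 hD); rewrite l2norm_delta.
    by move=> x _; rewrite dotv_delta.
  apply: le_lt_trans (ltry (16 * Kx ^+ 2 * 2)).
  by rewrite [leRHS]EFinM lee_wpmul2l// lee_fin.
apply/integrableP; split.
  by apply/measurable_EFinP; exact: measurable_funM.
apply: (@le_lt_trans _ _ (\int[fx]_x (16 * Kx ^+ 2 * expR ((x i 0 / (2 * Kx)) ^+ 2)
    + 16 * Kx ^+ 2 * expR ((x j 0 / (2 * Kx)) ^+ 2))%:E)%E).
  apply: (@le_integral_EFin _ _ _ fx (fun x : 'cV[R]_d => `|x i 0 * x j 0|)).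
  - by move=> x.
  - move=> x.
    have h i' : x i' 0 ^+ 2 <= 16 * Kx ^+ 2 * expR ((x i' 0 / (2 * Kx)) ^+ 2).
      have -> : x i' 0 ^+ 2 = 4 * Kx ^+ 2 * (x i' 0 / (2 * Kx)) ^+ 2.
        by field; rewrite gt_eqF.
      have := expR_ge1Dx ((x i' 0 / (2 * Kx)) ^+ 2).
      have := sqr_ge0 (x i' 0 / (2 * Kx)); have := sqr_ge0 Kx.
      set a := (x i' 0 / _) ^+ 2; set e := expR _; set K := Kx ^+ 2; nra.
    have := h i; have := h j; have := sqr_ge0 (x i 0 - x j 0).
    have := sqr_ge0 (x i 0 + x j 0).
    set a := 16 * _ * _; set b := 16 * _ * _; rewrite ler_norml; nra.
  - by apply: measurableT_comp => //; exact: measurable_funM.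
  - exact: measurable_funD.
rewrite integralD_nneg//.
exact: lte_add_pinfty.
Qed.

(** The second moment matrix is defined entrywise through [fine], so the double sum can be exchanged
    with the integral only after [design_coord_integrable]. *)
Lemma design_second_moment_ge (u : 'cV[R]_d) :
  ((dotv u u / C)%:E <= \int[fx]_x (dotv u x ^+ 2)%:E)%E.
Proof.
have [_ /(_ u)] := design_min hD.
rewrite mulmxBl dotvBr subr_ge0 dotv_scalar_mx mulrC => h.
have hi (p : 'I_d * 'I_d) : fx.-integrable setT
    (fun x : 'cV[R]_d => (u p.1 0 * u p.2 0)%:E * (x p.1 0 * x p.2 0)%:E)%E.
  by apply: integrableZl => //; exact: design_coord_integrable.
apply: le_trans (_ : (dotv u (second_moment fx *m u))%:E <= _)%E.
  by rewrite lee_fin.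
rewrite (eq_integral (fun x : 'cV[R]_d => \sum_(p : 'I_d * 'I_d)
    ((u p.1 0 * u p.2 0)%:E * (x p.1 0 * x p.2 0)%:E))%E); last first.
  move=> x _; under eq_bigr do rewrite -EFinM.
  rewrite sumEFin; congr EFin.
  rewrite expr2 dotvE mulr_suml -(pair_big predT predT
    (fun i j => u i 0 * u j 0 * (x i 0 * x j 0)))/=.
  apply: eq_bigr => i _; rewrite mulr_sumr; apply: eq_bigr => j _; ring.
rewrite integral_sum//.
under eq_bigr => p _.
  rewrite integralZl//; last exact: design_coord_integrable.
  rewrite -[X in (_ * X)%E]fineK; last first.
    by apply: integrable_fin_num => //; exact: design_coord_integrable.
  over.
under eq_bigr do rewrite -EFinM.
rewrite sumEFin lee_fin le_eqVlt; apply/orP; left; apply/eqP.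
rewrite dotvE -(pair_big predT predT (fun i j => u i 0 * u j 0 *
  fine (\int[fx]_x (x i 0 * x j 0)%:E)%E))/=.
apply: eq_bigr => i _; rewrite mxE mulr_sumr; apply: eq_bigr => j _.
rewrite mxE unlock -mulrA; congr (_ * _); rewrite [LHS]mulrC; congr (_ * fine _).
apply: eq_integral => x _; congr EFin.
by rewrite mxE big_ord1 mxE.
Qed.

End design_second_moment.

Lemma independent_prod_le d (T : measurableType d) (R : realType)
    (P : probability T R) d' (T' : measurableType d') (I : finType)
    (X : I -> T -> T') (f : T' -> R) (a : R) :
  mutually_independent P X -> (forall i, measurable_fun [set: T] (X i)) ->
  (forall x, 0 <= f x) -> measurable_fun [set: T'] f ->
  (forall i, (\int[P]_w (f (X i w))%:E <= a%:E)%E) ->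
  (\int[P]_w (\prod_i f (X i w))%:E <= (a ^+ #|I|)%:E)%E.
Proof.
move=> indX mX f0 mf fa.
have i0 i : (0 <= \int[P]_w (f (X i w))%:E)%E.
  by apply: integral_ge0 => w _; rewrite lee_fin.
pose e i := fine (\int[P]_w (f (X i w))%:E).
have eE i : (\int[P]_w (f (X i w))%:E)%E = (e i)%:E.
  by rewrite fineK// ge0_fin_numE// (le_lt_trans (fa i))// ltry.
rewrite (independent_integral_prod (f := fun _ => f) indX mX _ _ eE)//.
rewrite lee_fin -prodr_const; apply: ler_prod => i _.
by rewrite -!lee_fin -eE i0 fa.
Qed.

Lemma expRN_le (R : realType) (x : R) : 0 <= x -> expR (- x) <= 1 - x + x ^+ 2 :> R.
Proof.
move=> x0; rewrite expRN; apply: (@le_trans _ _ (1 + x)^-1).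
  by rewrite lef_pV2 ?posrE ?expR_gt0//; [exact: expR_ge1Dx|lra].
rewrite -[leLHS]mul1r ler_pdivrMr; last by lra.
have : 0 <= x ^+ 3 by exact: exprn_ge0.
rewrite (_ : (1 - x + x ^+ 2) * (1 + x) = 1 + x ^+ 3); first by lra.
by ring.
Qed.

(** * Second moment restricted to a slab *)

Section truncated_moment.
Context {R : realType} (d : nat) (fx : probability 'cV[R]_d R) (C Kx b0 tau : R).
Hypotheses (C0 : 0 < C) (Kx0 : 0 < Kx) (b00 : 0 < b0) (tau0 : 0 < tau).
Hypothesis hD : design_assumption fx C Kx.
Hypothesis htau :
  2 * expR (- ((tau / b0) ^+ 2 / (4 * Kx ^+ 2))) <= (256 * C ^+ 2 * Kx ^+ 4)^-1.

(** Weight selecting the records at which the curvature of [psi] is bounded below by a fixed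
    constant when the parameter is [b]. *)
Definition slab (b x : 'cV[R]_d) : R :=
  if `|dotv b x| <= tau then 1 else 0.

Lemma slab_ge0 b x : 0 <= slab b x.
Proof. by rewrite /slab; case: ifP. Qed.

Lemma slab_le1 b x : slab b x <= 1.
Proof. by rewrite /slab; case: ifP. Qed.

Lemma measurable_slab b : measurable_fun [set: 'cV[R]_d] (slab b).
Proof.
have -> : slab b = \1_[set x | `|dotv b x| <= tau].
  apply/funext => x; rewrite indicE /slab; case: ifPn => bx.
    by rewrite mem_set.
  by rewrite memNset//; exact/negP.
apply: measurable_indic.
rewrite (_ : [set x | _] = [set x | - tau <= - `|dotv b x|]); last first.
  by apply/seteqP; split=> x /=; rewrite lerN2.
apply: measurable_ge_set; apply: measurableT_comp => //.
by apply: measurableT_comp => //; exact: measurable_dotl.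
Qed.

Let Y u b x := dotv u x ^+ 2 * slab b x.

Let Y0 u b x : 0 <= Y u b x.
Proof. by rewrite mulr_ge0 ?sqr_ge0// slab_ge0. Qed.

Let mY u b : measurable_fun [set: 'cV[R]_d] (Y u b).
Proof.
apply: measurable_funM; last exact: measurable_slab.
by apply: measurable_funX; exact: measurable_dotl.
Qed.

(** The mass lost outside the slab is controlled by [q <= a q^2 / 2 + 1 / (2 a)] with
    [q = <u, x>^2]: the fourth moment bounds the first term and the tail of [<b, x>] the second. *)
Lemma truncated_moment_ge u b : l2norm u <= 1 -> l2norm b <= b0 ->
  ((dotv u u / C - (2 * C)^-1)%:E <= \int[fx]_x (dotv u x ^+ 2 * slab b x)%:E)%E.
Proof.
move=> u1 bb.
(* This weight makes each of the two losses [1 / (4 C)]; the constant in [htau] is tuned to the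
   second one. *)
have [a a0 aE] : exists2 a, 0 < a & a = (128 * C * Kx ^+ 4)^-1.
  by eexists; last by []; rewrite invr_gt0 !mulr_gt0// exprn_gt0.
pose E := [set x : 'cV[R]_d | tau / b0 <= `|dotv (b0^-1 *: b) x|].
have mE : measurable E.
  by apply: measurable_ge_set; apply: measurableT_comp => //; exact: measurable_dotl.
have m4 : measurable_fun [set: 'cV[R]_d] (fun x => dotv u x ^+ 4).
  by apply: measurable_funX; exact: measurable_dotl.
have p4 x : 0 <= dotv u x ^+ 4 by rewrite (exprM _ 2 2) sqr_ge0.
have mind : measurable_fun [set: 'cV[R]_d] (\1_E : 'cV[R]_d -> R).
  exact: measurable_indic.
have ind0 x : 0 <= \1_E x :> R by rewrite indicE.
have s0 x : 0 <= a / 2 * dotv u x ^+ 4 + a^-1 / 2 * \1_E x.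
  by apply: addr_ge0; apply: mulr_ge0 => //; apply: divr_ge0 => //;
    rewrite ?invr_ge0 ltW.
have key : ((dotv u u / C)%:E <= \int[fx]_x (Y u b x)%:E + (2 * C)^-1%:E)%E.
  apply: (le_trans (design_second_moment_ge Kx0 hD u)).
  apply: (@le_trans _ _ (\int[fx]_x (Y u b x + (a / 2 * dotv u x ^+ 4 +
      a^-1 / 2 * \1_E x))%:E)%E).
    apply: le_integral_EFin.
    - by move=> x; exact: sqr_ge0.
    - move=> x; rewrite /Y /slab; case: (leP `|dotv b x| tau) => bx.
        by rewrite mulr1 lerDl s0.
      rewrite mulr0 add0r indicE mem_set; last first.
        rewrite /E/= dotvZl normrM ger0_norm ?invr_ge0 ?(ltW b00)// [leRHS]mulrC.
        by rewrite ler_pM2r ?invr_gt0// ltW.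
      rewrite /= (_ : 1%:R = 1 :> R)// mulr1.
      have -> : dotv u x ^+ 4 = (dotv u x ^+ 2) ^+ 2 by rewrite -exprM.
      set q := dotv u x ^+ 2.
      have : 0 <= (a * q - 1) ^+ 2 * a^-1 by rewrite mulr_ge0 ?sqr_ge0// invr_ge0 ltW.
      have -> : (a * q - 1) ^+ 2 * a^-1 = a * q ^+ 2 - 2 * q + a^-1.
        by field; rewrite gt_eqF.
      set ai := a^-1; lra.
    - by apply: measurable_funX; exact: measurable_dotl.
    - apply: measurable_funD => //; apply: measurable_funD; exact: measurable_funM.
  have ms : measurable_fun [set: 'cV[R]_d]
      (fun x => a / 2 * dotv u x ^+ 4 + a^-1 / 2 * \1_E x).
    by apply: measurable_funD; exact: measurable_funM.
  rewrite integralD_nneg// leeD2l//.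
  rewrite integralD_nneg; [|by move=> x; rewrite mulr_ge0// divr_ge0// ltW|
    by move=> x; rewrite mulr_ge0// divr_ge0 ?invr_ge0// ltW|
    exact: measurable_funM|exact: measurable_funM].
  rewrite integralZl_nneg; [|by rewrite divr_ge0// ltW|by []|by []].
  rewrite integralZl_nneg; [|by rewrite divr_ge0 ?invr_ge0// ltW|
    by move=> x; rewrite indicE|by []].
  have -> : (2 * C)^-1 = a / 2 * (64 * Kx ^+ 4) + a^-1 / 2 * (256 * C ^+ 2 * Kx ^+ 4)^-1.
    by rewrite aE; field; rewrite !gt_eqF.
  rewrite [leRHS]EFinD; apply: leeD.
    rewrite [leRHS]EFinM lee_wpmul2l ?lee_fin ?divr_ge0// ?(ltW a0)//.
    exact: (design_fourth_moment Kx0 hD).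
  rewrite [leRHS]EFinM lee_wpmul2l ?lee_fin ?divr_ge0// ?invr_ge0 ?(ltW a0)//.
  rewrite integral_indic// setIT.
  apply: le_trans (_ : (2 * expR (- ((tau / b0) ^+ 2 / (4 * Kx ^+ 2))))%:E <= _)%E.
    apply: (design_tail Kx0 hD); last by rewrite divr_ge0// ltW.
    by rewrite l2normZ ger0_norm ?invr_ge0 ?(ltW b00)// ler_pdivrMl// mulr1.
  by rewrite lee_fin.
by rewrite EFinB leeBlDr.
Qed.

(** For a nonnegative variable, [exp (- y) <= 1 - y + y^2] bounds the Laplace transform using two
    moments only; here the second one is a fourth moment of the design. *)
Lemma truncated_laplace u b mu l : l2norm u <= 1 -> l2norm b <= b0 ->
  mu <= dotv u u / C - (2 * C)^-1 -> 0 <= l ->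
  (\int[fx]_x (expR (- (l * (dotv u x ^+ 2 * slab b x))))%:E <=
   (expR (- (l * mu) + 64 * l ^+ 2 * Kx ^+ 4))%:E)%E.
Proof.
move=> u1 bb hmu l0.
have me : measurable_fun [set: 'cV[R]_d] (fun x => expR (- (l * Y u b x))).
  apply: measurableT_comp => //; apply: measurableT_comp => //.
  exact: measurable_funM.
have m4 : measurable_fun [set: 'cV[R]_d] (fun x => dotv u x ^+ 4).
  by apply: measurable_funX; exact: measurable_dotl.
have p4 x : 0 <= dotv u x ^+ 4 by rewrite (exprM _ 2 2) sqr_ge0.
(* The linear term stands on the left so that only nonnegative functions are integrated. *)
have key : (\int[fx]_x (expR (- (l * Y u b x)))%:E + (l * mu)%:E <=
    (1 + 64 * l ^+ 2 * Kx ^+ 4)%:E)%E.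
  apply: (@le_trans _ _ (\int[fx]_x (expR (- (l * Y u b x)) + l * Y u b x)%:E)%E).
    rewrite integralD_nneg; [|by move=> x; exact: expR_ge0|
      by move=> x; rewrite mulr_ge0|by []|exact: measurable_funM].
    rewrite leeD2l// integralZl_nneg// EFinM lee_wpmul2l ?lee_fin//.
    apply: le_trans (truncated_moment_ge u1 bb).
    by rewrite lee_fin.
  apply: (@le_trans _ _ (\int[fx]_x (1 + l ^+ 2 * dotv u x ^+ 4)%:E)%E).
    apply: le_integral_EFin.
    - by move=> x; rewrite addr_ge0 ?expR_ge0// mulr_ge0.
    - move=> x; have lY0 : 0 <= l * Y u b x by rewrite mulr_ge0.
      have := expRN_le lY0.
      have : (l * Y u b x) ^+ 2 <= l ^+ 2 * dotv u x ^+ 4.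
        rewrite exprMn ler_wpM2l ?sqr_ge0// /Y exprMn -exprM.
        rewrite ler_piMr// ?p4// expr_le1 ?slab_le1 ?slab_ge0//.
      lra.
    - by apply: measurable_funD => //; exact: measurable_funM.
    - by apply: measurable_funD => //; exact: measurable_funM.
  rewrite integralD_nneg; [|by []|by move=> x; rewrite mulr_ge0 ?sqr_ge0|by []|
    exact: measurable_funM].
  rewrite integralZl_nneg ?sqr_ge0//.
  rewrite [leRHS]EFinD; apply: leeD.
    rewrite integral_cst// mul1e; exact: probability_le1.
  rewrite (_ : 64 * l ^+ 2 * Kx ^+ 4 = l ^+ 2 * (64 * Kx ^+ 4)); last by ring.
  rewrite [leRHS]EFinM lee_wpmul2l ?lee_fin ?sqr_ge0//.
  exact: (design_fourth_moment Kx0 hD).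
apply: (@le_trans _ _ (1 + 64 * l ^+ 2 * Kx ^+ 4 - l * mu)%:E).
  by rewrite EFinB leeBrDr.
by rewrite lee_fin (le_trans _ (expR_ge1Dx _))//; lra.
Qed.

End truncated_moment.

(** * Chernoff bounds for the sample in a fixed direction *)

Section sample_deviation.
Context d' (Om : measurableType d') (R : realType) (P : probability Om R).
Variables (d n : nat) (fx : probability 'cV[R]_d R) (C Kx : R).
Variable (X : 'I_n -> Om -> 'cV[R]_d).
Hypotheses (Kx0 : 0 < Kx) (hD : design_assumption fx C Kx).
Hypotheses (mX : forall i, measurable_fun [set: Om] (X i))
  (indX : mutually_independent P X).
Hypothesis lawX : forall i (g : 'cV[R]_d -> R), (forall x, 0 <= g x) ->
  measurable_fun [set: 'cV[R]_d] g ->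
  (\int[P]_w (g (X i w))%:E = \int[fx]_x (g x)%:E)%E.

Lemma measurable_sqr_sum u :
  measurable_fun [set: Om] (fun w => \sum_i dotv u (X i w) ^+ 2).
Proof.
apply: measurable_sum => i; apply: measurable_funX.
exact: (measurableT_comp (measurable_dotl u)).
Qed.

(** By independence the exponential moment of the sum is at most [2^n <= exp n]. *)
Lemma sqr_sum_tail u s : l2norm u <= 1 ->
  (P [set w | (n%:R * s <= \sum_i dotv u (X i w) ^+ 2)%R] <=
   (expR (n%:R * (1 - s / (4 * Kx ^+ 2))))%:E)%E.
Proof.
move=> u1.
pose f x := expR ((dotv u x / (2 * Kx)) ^+ 2).
have mf : measurable_fun [set: 'cV[R]_d] f.
  apply: measurableT_comp => //; apply: measurable_funX; apply: measurable_funM => //.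
  exact: measurable_dotl.
have f0 x : 0 <= f x by exact: expR_ge0.
have K0 : 0 < 4 * Kx ^+ 2 by rewrite mulr_gt0// exprn_gt0.
have prodE w : \prod_i f (X i w) = expR ((\sum_i dotv u (X i w) ^+ 2) / (4 * Kx ^+ 2)).
  rewrite /f -expR_sum mulr_suml; congr expR; apply: eq_bigr => i _.
  by field; rewrite gt_eqF.
have mp : measurable_fun [set: Om] (fun w => \prod_i f (X i w)).
  by apply: measurable_prod => i _; exact: measurableT_comp.
apply: (@le_trans _ _ (\int[P]_w (expR (- (n%:R * s / (4 * Kx ^+ 2))) *
    \prod_i f (X i w))%:E)%E).
  apply: measure_le_integral.
  - apply: measurable_ge_set; exact: measurable_sqr_sum.
  - by move=> w; rewrite mulr_ge0 ?expR_ge0// prodr_ge0.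
  - move=> w /= sw; rewrite prodE -expRD -[leLHS]expR0 ler_expR addrC subr_ge0.
    by rewrite ler_pM2r ?invr_gt0.
  - exact: measurable_funM.
rewrite integralZl_nneg; [|exact: expR_ge0|by move=> w; rewrite prodr_ge0|by []].
apply: (@le_trans _ _ ((expR (- (n%:R * s / (4 * Kx ^+ 2))))%:E * (2 ^+ n)%:E)%E).
  apply: lee_wpmul2l; first by rewrite lee_fin expR_ge0.
  rewrite -[n in X in (_ <= X)%E]card_ord; apply: independent_prod_le => // i.
  by rewrite (lawX i f0 mf); exact: (design_exp_sqr Kx0 hD).
rewrite -EFinM lee_fin.
have h2 : 2 ^+ n <= expR n%:R :> R.
  rewrite -[n%:R in leRHS]mulr1 expRM_natl lerXn2r ?nnegrE ?expR_ge0//.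
  by have := expR_ge1Dx (1 : R); lra.
apply: (le_trans (ler_wpM2l (expR_ge0 _) h2)).
rewrite -expRD ler_expR le_eqVlt; apply/orP; left; apply/eqP; ring.
Qed.

Variables (b0 tau : R).
Hypotheses (C0 : 0 < C) (b00 : 0 < b0) (tau0 : 0 < tau).
Hypothesis htau :
  2 * expR (- ((tau / b0) ^+ 2 / (4 * Kx ^+ 2))) <= (256 * C ^+ 2 * Kx ^+ 4)^-1.

Lemma measurable_slab_sum u b :
  measurable_fun [set: Om] (fun w => \sum_i dotv u (X i w) ^+ 2 * slab tau b (X i w)).
Proof.
apply: measurable_sum => i; apply: measurable_funM.
  by apply: measurable_funX; exact: (measurableT_comp (measurable_dotl u)).
by apply: measurableT_comp => //; exact: measurable_slab.
Qed.

Lemma slab_sum_tail u b mu : l2norm u <= 1 -> l2norm b <= b0 -> 0 < mu ->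
  mu <= dotv u u / C - (2 * C)^-1 ->
  (P [set w | (\sum_i dotv u (X i w) ^+ 2 * slab tau b (X i w) <= n%:R * mu / 2)%R] <=
   (expR (- (n%:R * (mu ^+ 2 / (1024 * Kx ^+ 4)))))%:E)%E.
Proof.
move=> u1 bb mu0 hmu.
(* Minimizer of the exponent [- l mu / 2 + 64 l^2 Kx^4] per record. *)
pose l := mu / (256 * Kx ^+ 4).
have K40 : 0 < Kx ^+ 4 by rewrite exprn_gt0.
have l0 : 0 <= l by rewrite divr_ge0 ?mulr_ge0 ?ltW.
pose f x := expR (- (l * (dotv u x ^+ 2 * slab tau b x))).
have mf : measurable_fun [set: 'cV[R]_d] f.
  apply: measurableT_comp => //; apply: measurableT_comp => //.
  apply: measurable_funM => //; apply: measurable_funM; last exact: measurable_slab.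
  by apply: measurable_funX; exact: measurable_dotl.
have f0 x : 0 <= f x by exact: expR_ge0.
have prodE w : \prod_i f (X i w) =
    expR (- (l * \sum_i dotv u (X i w) ^+ 2 * slab tau b (X i w))).
  by rewrite /f -expR_sum sumrN mulr_sumr.
have mp : measurable_fun [set: Om] (fun w => \prod_i f (X i w)).
  by apply: measurable_prod => i _; exact: measurableT_comp.
apply: (@le_trans _ _ (\int[P]_w (expR (l * (n%:R * mu / 2)) *
    \prod_i f (X i w))%:E)%E).
  apply: measure_le_integral.
  - rewrite (_ : [set w | _] = [set w | - (n%:R * mu / 2) <=
        - \sum_i dotv u (X i w) ^+ 2 * slab tau b (X i w)]); last first.
      by apply/seteqP; split=> w /=; rewrite lerN2.
    by apply: measurable_ge_set; apply: measurableT_comp => //; exact: measurable_slab_sum.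
  - by move=> w; rewrite mulr_ge0 ?expR_ge0// prodr_ge0.
  - move=> w /= sw; rewrite prodE -expRD -[leLHS]expR0 ler_expR subr_ge0.
    by rewrite ler_wpM2l.
  - exact: measurable_funM.
rewrite integralZl_nneg; [|exact: expR_ge0|by move=> w; rewrite prodr_ge0|by []].
pose a := expR (- (l * mu) + 64 * l ^+ 2 * Kx ^+ 4).
apply: (@le_trans _ _ ((expR (l * (n%:R * mu / 2)))%:E * (a ^+ n)%:E)%E).
  apply: lee_wpmul2l; first by rewrite lee_fin expR_ge0.
  rewrite -[n in X in (_ <= X)%E]card_ord; apply: independent_prod_le => // i.
  by rewrite (lawX i f0 mf); exact: (truncated_laplace C0 Kx0 b00 tau0 hD htau).
rewrite -EFinM lee_fin -expRM_natl -expRD ler_expR /l.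
rewrite le_eqVlt; apply/orP; left; apply/eqP; field.
by rewrite gt_eqF.
Qed.

End sample_deviation.

(** * From net points to all directions *)

Section nets.
Context {R : realType} (d n : nat).
Variable x : 'I_n -> 'cV[R]_d.

(** Its Euclidean norm is a seminorm in [u] whose square is the weighted sum of squares, so
    perturbing [u] reduces to the triangle inequality. *)
Definition weighted_eval (c : 'I_n -> R) (u : 'cV[R]_d) : 'cV[R]_n :=
  \col_i (c i * dotv u (x i)).

Lemma weighted_evalD c u v :
  weighted_eval c (u + v) = weighted_eval c u + weighted_eval c v.
Proof. by apply/matrixP => i j; rewrite !mxE dotvDl mulrDr. Qed.

Lemma weighted_evalZ c a u : weighted_eval c (a *: u) = a *: weighted_eval c u.
Proof. by apply/matrixP => i j; rewrite !mxE dotvZl mulrCA. Qed.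

Lemma sqr_weighted_eval c u :
  l2norm (weighted_eval c u) ^+ 2 = \sum_i c i ^+ 2 * dotv u (x i) ^+ 2.
Proof.
rewrite sqr_l2norm dotvE; apply: eq_bigr => i _.
by rewrite !mxE -exprMn expr2.
Qed.

Lemma weighted_eval_le c u : (forall i, `|c i| <= 1) ->
  l2norm (weighted_eval c u) <= l2norm (weighted_eval (fun=> 1) u).
Proof.
move=> c1; apply: l2norm_mono => i; rewrite !mxE mul1r normrM.
by rewrite -[leRHS]mul1r ler_wpM2r.
Qed.

(* Halving argument: the supremum M of the seminorm over the unit ball satisfies
   M <= sqrt r + M / 2 when the net bounds it by sqrt r. *)
Lemma sqr_sum_net_bound (r : R) : 0 <= r ->
  (forall u, l2norm u <= 1 -> exists w, [/\ l2norm w <= 1, l2norm (u - w) <= 2^-1 &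
     \sum_i dotv w (x i) ^+ 2 <= r]) ->
  forall u, \sum_i dotv u (x i) ^+ 2 <= 4 * r * dotv u u.
Proof.
move=> r0 hnet.
pose y := weighted_eval (fun=> 1).
have y2 u : l2norm (y u) ^+ 2 = \sum_i dotv u (x i) ^+ 2.
  by rewrite sqr_weighted_eval; apply: eq_bigr => i _; rewrite expr1n mul1r.
pose S := [set l2norm (y u) | u in [set u : 'cV[R]_d | l2norm u <= 1]].
have S0 : S !=set0 by exists (l2norm (y 0)); exists 0 => //=; rewrite l2norm0.
have Sub : has_ubound S.
  exists ((\sum_i l2norm (x i)) * Num.sqrt n%:R) => _ [u /= u1 <-].
  apply: l2norm_le_coord => [|i]; first by apply: sumr_ge0 => i _; exact: l2norm_ge0.
  rewrite mxE mul1r (le_trans (normr_dotv_le _ _))//.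
  rewrite (le_trans (ler_wpM2r (l2norm_ge0 _) u1))// mul1r (bigD1 i)//= lerDl.
  by apply: sumr_ge0 => j _; exact: l2norm_ge0.
have leM u : l2norm u <= 1 -> l2norm (y u) <= sup S.
  by move=> u1; apply: ub_le_sup => //; exists u.
have Mle : sup S <= 2 * Num.sqrt r.
  have h : sup S <= Num.sqrt r + sup S / 2.
    apply: ge_sup => // _ [u /= u1 <-].
    have [w [w1 uw wr]] := hnet u u1.
    have -> : u = w + 2^-1 *: (2 *: (u - w)).
      by rewrite scalerA mulVf ?pnatr_eq0// scale1r addrC subrK.
    rewrite /y weighted_evalD weighted_evalZ (le_trans (l2normD _ _))// lerD//.
      by rewrite -(@ler_sqrt _ _ r)// -y2 sqrtr_sqr ger0_norm ?l2norm_ge0 in wr.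
    rewrite l2normZ ger0_norm ?invr_ge0// mulrC ler_pM2r ?invr_gt0//; apply: leM.
    by rewrite l2normZ ger0_norm// -ler_pdivlMl// mulr1.
  by lra.
move=> u; rewrite -y2.
have [->|u0] := eqVneq u 0.
  rewrite dotv0l mulr0 -[X in y X](scale0r 0) /y weighted_evalZ scale0r.
  by rewrite l2norm0 expr0n.
have un : 0 < l2norm u.
  by rewrite lt_def l2norm_ge0 andbT; apply: contra_neq u0; exact: l2norm_eq0.
have h : l2norm (y u) <= 2 * Num.sqrt r * l2norm u.
  rewrite -ler_pdivrMr// (le_trans _ Mle)//.
  have -> : l2norm (y u) / l2norm u = l2norm (y ((l2norm u)^-1 *: u)).
    by rewrite /y weighted_evalZ l2normZ ger0_norm ?invr_ge0 ?ltW// mulrC.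
  by apply: leM; rewrite l2normZ ger0_norm ?invr_ge0 ?(ltW un)// mulVf ?gt_eqF.
rewrite (_ : 4 * r * dotv u u = (2 * Num.sqrt r * l2norm u) ^+ 2).
  rewrite lerXn2r ?nnegrE ?l2norm_ge0 ?mulr_ge0 ?sqrtr_ge0 ?l2norm_ge0//.
by rewrite !exprMn sqr_sqrtr// sqr_l2norm; congr (_ * _ * _); rewrite expr2; lra.
Qed.

(** Replacing [u] by [w] changes the seminorm by at most half of its value at [w]; replacing [b] by
    [b'] moves every [<b, x i>] by at most [tau], which is paid by doubling the width of the
    slab. *)
Lemma slab_sum_net_bound (g0 mu tau b0 r rb : R) :
  0 <= g0 -> 0 < tau -> 0 <= mu -> 0 < r -> r ^+ 2 * g0 <= mu / 8 ->
  rb ^+ 2 * (n%:R * g0) <= tau ^+ 2 -> 0 <= rb ->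
  (forall u, \sum_i dotv u (x i) ^+ 2 <= n%:R * g0 * dotv u u) ->
  (forall u b, l2norm u = 1 -> l2norm b <= b0 -> exists w b',
    [/\ l2norm (u - w) <= r, l2norm (b - b') <= rb &
      n%:R * mu / 2 <= \sum_i dotv w (x i) ^+ 2 * slab tau b' (x i)]) ->
  forall u b, l2norm u = 1 -> l2norm b <= b0 ->
    n%:R * mu / 8 <= \sum_i dotv u (x i) ^+ 2 * slab (2 * tau) b (x i).
Proof.
move=> g00 tau0 mu0 r0 hr hrb rb0 hup hnet u b u1 bb.
have [w [b' [uw bb' hw]]] := hnet u b u1 bb.
pose c i := slab tau b' (x i).
have c1 i : `|c i| <= 1 by rewrite ger0_norm ?slab_ge0// slab_le1.
have csqr i : c i ^+ 2 = c i by rewrite /c /slab; case: ifP; rewrite ?expr1n ?expr0n.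
have cE v : l2norm (weighted_eval c v) ^+ 2 = \sum_i dotv v (x i) ^+ 2 * c i.
  by rewrite sqr_weighted_eval; apply: eq_bigr => i _; rewrite csqr mulrC.
(* The upper bound taken at [u = x i] already contains the term [|x i|^4]. *)
have xb i : dotv (x i) (x i) <= n%:R * g0.
  have [->|xi0] := eqVneq (x i) 0; first by rewrite dotv0l mulr_ge0.
  have xip : 0 < dotv (x i) (x i).
    rewrite lt_def dotv_ge0 andbT; apply: contra_neq xi0; exact: dotv_eq0.
  have := hup (x i); rewrite (bigD1 i)//= expr2 => h.
  rewrite -(ler_pM2r xip) (le_trans _ h)// lerDl.
  by apply: sumr_ge0 => j _; exact: sqr_ge0.
have slab_sub i : c i <= slab (2 * tau) b (x i).
  rewrite /c /slab; case: (leP _ tau) => [h|_]; last by case: ifP.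
  rewrite ifT// -[b](subrK b') dotvDl (le_trans (ler_normD _ _))//.
  have : `|dotv (b - b') (x i)| <= tau.
    rewrite (le_trans (normr_dotv_le _ _))//.
    apply: (@le_trans _ _ (rb * l2norm (x i))); first by rewrite ler_wpM2r ?l2norm_ge0.
    rewrite -(@ler_pXn2r _ 2) ?nnegrE ?mulr_ge0 ?l2norm_ge0 ?(ltW tau0)//.
    by rewrite exprMn sqr_l2norm (le_trans _ hrb)// ler_wpM2l// sqr_ge0.
  lra.
apply: (@le_trans _ _ (\sum_i dotv u (x i) ^+ 2 * c i)); last first.
  by apply: ler_sum => i _; rewrite ler_wpM2l// sqr_ge0.
rewrite -cE; have {}hw : n%:R * mu / 2 <= l2norm (weighted_eval c w) ^+ 2 by rewrite cE.
have hd : l2norm (weighted_eval c (u - w)) ^+ 2 <= n%:R * mu / 8.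
  apply: (@le_trans _ _ (n%:R * g0 * r ^+ 2)).
    apply: le_trans (_ : l2norm (weighted_eval (fun=> 1) (u - w)) ^+ 2 <= _).
      by rewrite lerXn2r ?nnegrE ?l2norm_ge0// weighted_eval_le.
    rewrite sqr_weighted_eval; under eq_bigr do rewrite expr1n mul1r.
    apply: (le_trans (hup _)); rewrite ler_wpM2l ?mulr_ge0// -sqr_l2norm.
    by rewrite lerXn2r ?nnegrE ?l2norm_ge0// ltW.
  by rewrite -!mulrA ler_wpM2l// mulrC.
have htri : l2norm (weighted_eval c w) <=
    l2norm (weighted_eval c u) + l2norm (weighted_eval c (u - w)).
  have -> : weighted_eval c w = weighted_eval c u - weighted_eval c (u - w).
    by rewrite -scaleN1r -weighted_evalZ -weighted_evalD scaleN1r subKr.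
  by rewrite (le_trans (l2normD _ _))// l2normN.
set a := l2norm (weighted_eval c w) in hw htri *.
set e := l2norm (weighted_eval c u) in htri *.
set f := l2norm (weighted_eval c (u - w)) in hd htri *.
have e0 : 0 <= e by exact: l2norm_ge0.
have f0 : 0 <= f by exact: l2norm_ge0.
have fa : f <= a / 2.
  rewrite -(@ler_pXn2r _ 2) ?nnegrE ?divr_ge0 ?l2norm_ge0// expr_div_n.
  rewrite (_ : 2 ^+ 2 = 4 :> R); last by rewrite expr2; lra.
  lra.
have a0 : 0 <= a by exact: l2norm_ge0.
have ea : a / 2 <= e by lra.
have : (a / 2) ^+ 2 <= e ^+ 2 by rewrite lerXn2r ?nnegrE// divr_ge0.
rewrite expr_div_n (_ : 2 ^+ 2 = 4 :> R); last by rewrite expr2; lra.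
lra.
Qed.

End nets.

(** * The Hessian event and its measurability *)

Section hessian_algebra.
Context {R : realType} (d n : nat) (psi chi : R -> R) (L : R).
Variable x : 'I_n -> 'cV[R]_d.
Local Notation H b := (empirical_hessian psi chi L x b).

Lemma hessian_sym b : (H b)^T = H b.
Proof.
rewrite /empirical_hessian linearZ/= linear_sum/=; congr (_ *: _).
by apply: eq_bigr => i _; rewrite linearZ/= trmx_mul trmxK.
Qed.

Lemma hessian_form b u v : dotv v (H b *m u) =
  n%:R^-1 * \sum_i (psi_sat psi chi L)^`(2)%classic (dotv (x i) b) *
    (dotv (x i) v * dotv (x i) u).
Proof.
rewrite /empirical_hessian -scalemxAl dotvZr mulmx_suml dotv_sumr.
congr (_ * _); apply: eq_bigr => i _.
by rewrite -scalemxAl dotvZr dotv_outer.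
Qed.

End hessian_algebra.

Lemma cvgn_sum (R : realType) (I : Type) (s : seq I) (F : I -> nat -> R)
    (l : I -> R) : (forall i, F i @ \oo --> l i) ->
  (fun k => \sum_(i <- s) F i k) @ \oo --> \sum_(i <- s) l i.
Proof.
move=> Fl; elim: s => [|i s IH].
  by under eq_fun do rewrite big_nil; rewrite big_nil; exact: cvg_cst.
by under eq_fun do rewrite big_cons; rewrite big_cons; apply: cvgD.
Qed.

Section hessian_event.
Context d' (Om : measurableType d') (R : realType) (d n : nat).
Variable (X : 'I_n -> Om -> 'cV[R]_d).
Hypothesis mX : forall i, measurable_fun [set: Om] (X i).
Variables (psi chi : R -> R) (c2 c3 L b0 alpha gamma : R).
Hypotheses (hpsi : link_assumption psi c2 c3) (hchi : cutoff chi).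

Let Q o b u : R := n%:R^-1 * \sum_i (psi_sat psi chi L)^`(2)%classic (dotv (X i o) b) *
    (dotv (X i o) u * dotv (X i o) u).

Definition hessian_event : set Om := [set o | forall b : 'cV[R]_d, l2ball b0 b ->
  let H := empirical_hessian psi chi L (fun i => X i o) b in
  loewner_le alpha%:M H /\ loewner_le H gamma%:M].

Lemma hessian_eventE : hessian_event = [set o | forall b u, l2ball b0 b ->
  alpha * dotv u u <= Q o b u <= gamma * dotv u u].
Proof.
have sc a : (a%:M : 'M[R]_d)^T = a%:M by exact: tr_scalar_mx.
apply/seteqP; split=> o /= h b.
  move=> u bb; have [/(loewner_leP (sc _) (hessian_sym _ _ _ _ _))/(_ u) h1
    /(loewner_leP (hessian_sym _ _ _ _ _) (sc _))/(_ u) h2] := h b bb.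
  by move: h1 h2; rewrite !dotv_scalar_mx hessian_form => -> ->.
move=> bb; split.
  apply/loewner_leP => [||u]; [exact: sc|exact: hessian_sym|].
  by rewrite dotv_scalar_mx hessian_form; have /andP[] := h b u bb.
apply/loewner_leP => [||u]; [exact: hessian_sym|exact: sc|].
by rewrite dotv_scalar_mx hessian_form; have /andP[] := h b u bb.
Qed.

Let continuous_curv : continuous ((psi_sat psi chi L)^`(2)%classic).
Proof.
have -> : (psi_sat psi chi L)^`(2)%classic = fun t => psi^`(2)%classic t * chi (t / L).
  by apply/funext => t; exact: (ddpsi_satE hpsi hchi).
move=> t; apply: cvgM; first exact: (continuous_ddlink hpsi).
apply: (@continuous_comp _ _ _ (fun u : R => u / L) chi).
  by apply: cvgM; [exact: cvg_id|exact: cvg_cst].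
exact: continuous_cutoff.
Qed.

Lemma cvg_harmonic_bound (a : nat -> R) (l c : R) :
  (forall k, `|l - a k| <= c * harmonic k) -> a @ \oo --> l.
Proof.
move=> h; apply/cvgrPdist_le => e e0.
have hc : (fun k => c * harmonic k) @ \oo --> c * 0.
  by apply: cvgM; [exact: cvg_cst|exact: cvg_harmonic].
rewrite mulr0 in hc.
move/cvgrPdist_le : hc => /(_ e e0); apply: filterS => k.
rewrite sub0r normrN => hk; rewrite (le_trans (h k))// (le_trans _ hk)//.
exact: ler_norm.
Qed.

(** Mesh [1 / (k + 1)] on the cube of half-side [k + 1]: finite for each [k], and dense in the
    limit. *)
Let grid k (f : {ffun 'I_d -> bool * 'I_(k.+1 * k.+1).+1}) : 'cV[R]_d :=
  k.+1%:R^-1 *: lattice_pt f.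

Let grid_approx (K : nat) (v : 'cV[R]_d) : l2norm v <= K%:R ->
  exists f : forall k : nat, {ffun 'I_d -> bool * 'I_((k + K).+1 * (k + K).+1).+1},
  forall k, l2norm (grid (f k)) <= l2norm v /\
    l2norm (v - grid (f k)) <= Num.sqrt d%:R * harmonic k.
Proof.
move=> vK.
suff h k : {f : {ffun 'I_d -> bool * 'I_((k + K).+1 * (k + K).+1).+1} |
    l2norm (grid f) <= l2norm v /\
    l2norm (v - grid f) <= Num.sqrt d%:R * harmonic k}.
  by exists (fun k => sval (h k)) => k; exact: (svalP (h k)).
apply: cid.
have k0 : 0 < (k + K).+1%:R :> R by rewrite ltr0n.
have [i|f [f1 f2]] := @lattice_round R d ((k + K).+1 * (k + K).+1) ((k + K).+1%:R *: v).
  rewrite mxE normrM ger0_norm// natrM ler_wpM2l//.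
  rewrite (le_trans (normr_coord_le v i))// (le_trans vK)// ler_nat.
  by rewrite -addSn leq_addl.
exists f; rewrite /grid; split.
  rewrite l2normZ ger0_norm ?invr_ge0// ler_pdivrMl//.
  by rewrite l2normZ ger0_norm// in f1.
have -> : v - (k + K).+1%:R^-1 *: lattice_pt f =
    (k + K).+1%:R^-1 *: ((k + K).+1%:R *: v - lattice_pt f).
  by rewrite scalerBr scalerA mulVf ?gt_eqF// scale1r.
rewrite l2normZ ger0_norm ?invr_ge0// mulrC.
apply: (@le_trans _ _ (Num.sqrt d%:R * (k + K).+1%:R^-1)).
  by rewrite ler_wpM2r ?invr_ge0.
rewrite ler_wpM2l ?sqrtr_ge0// /harmonic lef_pV2 ?posrE ?ltr0n// ler_nat.
by rewrite ltnS leq_addr.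
Qed.

Let grid_event : set Om := \bigcap_k \bigcap_(fg in [set:
    {ffun 'I_d -> bool * 'I_(k.+1 * k.+1).+1} *
    {ffun 'I_d -> bool * 'I_(k.+1 * k.+1).+1}])
  [set o | l2norm (grid fg.1) <= b0 ->
    alpha * dotv (grid fg.2) (grid fg.2) <= Q o (grid fg.1) (grid fg.2) <=
    gamma * dotv (grid fg.2) (grid fg.2)].

(** The form is continuous in [b] and [u], so the uncountably many conditions follow from those at
    grid points. Rounding towards zero keeps the approximants of [b] in the ball, where the
    conditions are known. *)
Lemma hessian_event_grid : hessian_event = grid_event.
Proof.
rewrite hessian_eventE; apply/seteqP; split=> o /= h.
  by move=> k _ [f g] _ /= fb; exact: h.
move=> b u bb.
have [K bK uK] : exists2 K, l2norm b <= K%:R & l2norm u <= K%:R.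
  exists (Num.truncn (l2norm b + l2norm u)).+1.
    rewrite (@le_trans _ _ (l2norm b + l2norm u)) ?(ltW (truncnS_gt _))//.
    by rewrite lerDl l2norm_ge0.
  rewrite (@le_trans _ _ (l2norm b + l2norm u)) ?(ltW (truncnS_gt _))//.
  by rewrite lerDr l2norm_ge0.
have [f hf] := grid_approx bK; have [g hg] := grid_approx uK.
pose bk k := grid (f k); pose uk k := grid (g k).
have cdot y v (vk : nat -> 'cV[R]_d) :
    (forall k, l2norm (v - vk k) <= Num.sqrt d%:R * harmonic k) ->
    (fun k => dotv y (vk k)) @ \oo --> dotv y v.
  move=> hv; apply: (@cvg_harmonic_bound _ _ (l2norm y * Num.sqrt d%:R)) => k.
  rewrite -dotvBr (le_trans (normr_dotv_le _ _))// -mulrA.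
  by rewrite ler_wpM2l ?l2norm_ge0.
have hbk k : l2norm (b - bk k) <= Num.sqrt d%:R * harmonic k by exact: (hf k).2.
have huk k : l2norm (u - uk k) <= Num.sqrt d%:R * harmonic k by exact: (hg k).2.
have cQ : (fun k => Q o (bk k) (uk k)) @ \oo --> Q o b u.
  apply: cvgM; first exact: cvg_cst.
  apply: cvgn_sum => i; apply: cvgM; last by apply: cvgM; exact: cdot.
  apply: continuous_cvg; first exact: continuous_curv.
  exact: cdot.
have cuu : (fun k => dotv (uk k) (uk k)) @ \oo --> dotv u u.
  rewrite dotvE; under eq_fun do rewrite dotvE.
  have cu i : (fun k => uk k i 0) @ \oo --> u i 0.
    by rewrite -dotv_delta; under eq_fun do rewrite -dotv_delta; exact: cdot.
  by apply: cvgn_sum => i; apply: cvgM; exact: cu.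
have hk k : alpha * dotv (uk k) (uk k) <= Q o (bk k) (uk k) <=
    gamma * dotv (uk k) (uk k).
  apply: (h (k + K)%N I (f k, g k) I) => /=.
  exact: le_trans (hf k).1 bb.
have cs a : (fun k => a * dotv (uk k) (uk k)) @ \oo --> a * dotv u u.
  by apply: cvgM => //; exact: cvg_cst.
apply/andP; split.
  rewrite -(cvg_lim _ cQ)// -(cvg_lim _ (cs alpha))//; apply: ler_lim.
  - by apply/cvg_ex; eexists; exact: cs.
  - by apply/cvg_ex; eexists; exact: cQ.
  - by apply: nearW => k; have /andP[] := hk k.
rewrite -(cvg_lim _ cQ)// -(cvg_lim _ (cs gamma))//; apply: ler_lim.
- by apply/cvg_ex; eexists; exact: cQ.
- by apply/cvg_ex; eexists; exact: cs.
- by apply: nearW => k; have /andP[] := hk k.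
Qed.

Lemma measurable_hessian_event : measurable hessian_event.
Proof.
rewrite hessian_event_grid; apply: bigcapT_measurable => k.
apply: fin_bigcap_measurable => // -[f g] _ /=.
have [fb|fb] := boolP (l2norm (grid f) <= b0); last first.
  by rewrite (_ : [set _ | _] = setT)//; apply/seteqP; split=> o //=.
have mQ : measurable_fun [set: Om] (fun o => Q o (grid f) (grid g)).
  apply: measurable_funM => //; apply: measurable_sum => i.
  have md v : measurable_fun [set: Om] (fun o => dotv (X i o) v).
    by apply: measurable_dotv.
  apply: measurable_funM; last by apply: measurable_funM.
  exact: (measurableT_comp (continuous_measurable_fun continuous_curv)).
rewrite (_ : [set _ | _] = [set o | alpha * dotv (grid g) (grid g) <= Q o (grid f) (grid g)]
   `&` [set o | - (gamma * dotv (grid g) (grid g)) <= - Q o (grid f) (grid g)]).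
  apply: measurableI; apply: measurable_ge_set => //.
  exact: measurableT_comp.
apply/seteqP; split=> o /=; first by move=> /(_ isT)/andP[? ?]; rewrite lerN2.
by rewrite lerN2 => -[-> ->].
Qed.

End hessian_event.

(** * Probability of the Hessian event *)

Section hessian_probability.
Context d' (Om : measurableType d') (R : realType) (P : probability Om R).
Variables (d n : nat) (fx : probability 'cV[R]_d R) (C Kx : R).
Variable (X : 'I_n -> Om -> 'cV[R]_d).
Hypotheses (d0 : (0 < d)%N) (n0 : (0 < n)%N).
Hypotheses (Kx0 : 0 < Kx) (hD : design_assumption fx C Kx).
Hypotheses (mX : forall i, measurable_fun [set: Om] (X i))
  (indX : mutually_independent P X).
Hypothesis lawX : forall i (g : 'cV[R]_d -> R), (forall x, 0 <= g x) ->
  measurable_fun [set: 'cV[R]_d] g ->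
  (\int[P]_w (g (X i w))%:E = \int[fx]_x (g x)%:E)%E.
Variables (psi chi : R -> R) (c2 c3 L b0 tau m r : R) (N : nat).
Hypotheses (hpsi : link_assumption psi c2 c3) (hchi : cutoff chi).
Hypotheses (C0 : 0 < C) (b00 : 0 < b0) (tau0 : 0 < tau) (m0 : 0 < m).
Hypothesis htau :
  2 * expR (- ((tau / b0) ^+ 2 / (4 * Kx ^+ 2))) <= (256 * C ^+ 2 * Kx ^+ 4)^-1.
Hypothesis hm : forall t, `|t| <= 2 * tau -> m <= psi^`(2)%classic t.
Hypotheses (L1 : 1 <= L) (Ltau : 2 * tau <= L).
(** [192 = 4 * 48]: at the level [48 Kx^2] one direction fails with probability at most
    [exp (- 11 n)], and passing from the net to the ball costs the factor [4]. *)
Let g0 := 192 * Kx ^+ 2.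
Let mu := (4 * C)^-1.
Hypotheses (r0 : 0 < r) (r1 : r <= 10^-1) (hr : r ^+ 2 * g0 <= mu / 8).
Hypothesis hN1 : Num.sqrt d%:R / r <= N%:R.
Hypothesis hN2 : b0 * (Num.sqrt d%:R * Num.sqrt (n%:R * g0) / tau) <= N%:R.

Let F := {ffun 'I_d -> bool * 'I_(2 * d).+1}.
Let G := {ffun 'I_d -> bool * 'I_N.+1}.
Let sd := Num.sqrt d%:R : R.
Let wF (f : F) : 'cV[R]_d := (2 * sd)^-1 *: lattice_pt f.
Let wG (f : G) : 'cV[R]_d := (r / sd) *: lattice_pt f.
(** Mesh in [b]: once every [|x i|] is at most [sqrt (n g0)], a move of length [rb] changes
    [<b, x i>] by at most [tau]. *)
Let rb := tau / Num.sqrt (n%:R * g0).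
Let bG (f : G) : 'cV[R]_d := (rb / sd) *: lattice_pt f.

Let okF (f : F) := l2norm (lattice_pt f : 'cV[R]_d) ^+ 2 <= 4 * d%:R.
(** Directions of norm at least [9 / 10] satisfy [|w|^2 / C - 1 / (2 C) >= 1 / (4 C) = mu]; the mesh
    bound [r <= 1 / 10] puts the approximants of unit vectors in this range. *)
Let okG (fg : G * G) := [&& l2norm (wG fg.1) <= 1, 9 / 10 <= l2norm (wG fg.1) &
  l2norm (bG fg.2) <= b0].

Let badF (f : F) : set Om :=
  [set w | (n%:R * (48 * Kx ^+ 2) <= \sum_i dotv (wF f) (X i w) ^+ 2)%R].
Let badG (fg : G * G) : set Om := [set w | (\sum_i dotv (wG fg.1) (X i w) ^+ 2 *
  slab tau (bG fg.2) (X i w) <= n%:R * mu / 2)%R].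

Let sd0 : 0 < sd. Proof. by rewrite sqrtr_gt0 ltr0n. Qed.
Let g00 : 0 < g0. Proof. by rewrite mulr_gt0// exprn_gt0. Qed.
Let n0R : 0 < n%:R :> R. Proof. by rewrite ltr0n. Qed.
Let ng0 : 0 < Num.sqrt (n%:R * g0). Proof. by rewrite sqrtr_gt0 mulr_gt0. Qed.
Let rb0 : 0 < rb. Proof. by rewrite divr_gt0. Qed.
Let mu0 : 0 < mu. Proof. by rewrite invr_gt0 mulr_gt0. Qed.

(** The deterministic part: the curvature at each record lies between [m] times the slab indicator
    and [c2]. The term [m * mu / 8] in the upper constant makes it at least the lower one. *)
Let good w : (forall f, okF f -> ~ badF f w) -> (forall fg, okG fg -> ~ badG fg w) ->
  hessian_event X psi chi L b0 (m * mu / 8) (c2 * g0 + m * mu / 8) w.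
Proof.
move=> hF hG; rewrite hessian_eventE/=.
have hup u : \sum_i dotv u (X i w) ^+ 2 <= n%:R * g0 * dotv u u.
  rewrite (_ : n%:R * g0 = 4 * (n%:R * (48 * Kx ^+ 2))); last first.
    by rewrite /g0; ring.
  apply: sqr_sum_net_bound => [|{}u u1].
    by rewrite mulr_ge0// mulr_ge0// sqr_ge0.
  pose v : 'cV[R]_d := (2 * sd) *: u.
  have vn : l2norm v <= 2 * sd.
    rewrite l2normZ ger0_norm; last by rewrite mulr_ge0// ltW.
    by rewrite -[leRHS]mulr1 ler_wpM2l// mulr_ge0// ltW.
  have [i|f [f1 f2]] := @lattice_round R d (2 * d) v.
    rewrite (le_trans (normr_coord_le v i))// (le_trans vn)// natrM ler_wpM2l//.
    rewrite -[leRHS]ger0_norm// -sqrtr_sqr ler_wsqrtr// expr2.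
    by rewrite -[leLHS]mulr1 ler_wpM2l// ler1n.
  have f4 : l2norm (lattice_pt f : 'cV[R]_d) <= 2 * sd by exact: le_trans vn.
  have okf : okF f.
    rewrite /okF (_ : 4 * d%:R = (2 * sd) ^+ 2); last first.
      by rewrite exprMn sqr_sqrtr//; congr (_ * _); rewrite expr2; lra.
    by rewrite lerXn2r ?nnegrE ?l2norm_ge0// mulr_ge0// ltW.
  exists (wF f); split.
  - rewrite l2normZ ger0_norm ?invr_ge0 ?mulr_ge0 ?(ltW sd0)//.
    by rewrite ler_pdivrMl ?mulr_gt0// mulr1.
  - rewrite (_ : u - wF f = (2 * sd)^-1 *: (v - lattice_pt f)); last first.
      by rewrite scalerBr /v scalerA mulVf ?scale1r// gt_eqF// mulr_gt0.
    rewrite l2normZ ger0_norm ?invr_ge0 ?mulr_ge0 ?(ltW sd0)//.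
    rewrite ler_pdivrMl ?mulr_gt0// (le_trans f2)// /sd mulrAC divff ?mul1r//.
  - by have /negP := hF f okf; rewrite -ltNge => /ltW.
have hlow1 u b : l2norm u = 1 -> l2norm b <= b0 ->
    n%:R * mu / 8 <= \sum_i dotv u (X i w) ^+ 2 * slab (2 * tau) b (X i w).
  apply: (@slab_sum_net_bound _ _ _ (fun i => X i w) g0 mu tau b0 r rb) => //.
  - exact: ltW.
  - exact: ltW.
  - rewrite /rb expr_div_n sqr_sqrtr ?divfK ?gt_eqF ?mulr_gt0//.
    by rewrite mulr_ge0// ltW.
  - exact: ltW.
  - move=> {}u {}b u1 bb.
    have [i|f [f1 f2]] := @lattice_round R d N ((sd / r) *: u).
      rewrite (le_trans (normr_coord_le _ i))// l2normZ u1 mulr1.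
      by rewrite ger0_norm// divr_ge0// ltW.
    have [i|g [h1 h2]] := @lattice_round R d N ((sd / rb) *: b).
      rewrite (le_trans (normr_coord_le _ i))// l2normZ.
      rewrite ger0_norm; last by rewrite divr_ge0// ltW.
      apply: le_trans hN2; rewrite mulrC; apply: ler_pM => //.
      - exact: l2norm_ge0.
      - by rewrite divr_ge0// ltW.
      - by rewrite /rb invf_div mulrA.
    have hsd h : 0 < h -> h / sd * (sd / h) = 1.
      by move=> hh; field; rewrite !gt_eqF.
    have dist h (v : 'cV[R]_d) (l : G) : 0 < h ->
        l2norm ((sd / h) *: v - lattice_pt l) <= sd ->
        l2norm (v - (h / sd) *: lattice_pt l) <= h.
      move=> hh hl; rewrite (_ : v - _ = (h / sd) *: ((sd / h) *: v - lattice_pt l)).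
        rewrite l2normZ ger0_norm; last by rewrite divr_ge0// ltW.
        by rewrite mulrAC ler_pdivrMr// ler_wpM2l// ltW.
      by rewrite scalerBr scalerA hsd// scale1r.
    have nrm h (v : 'cV[R]_d) (l : G) : 0 < h ->
        l2norm (lattice_pt l : 'cV[R]_d) <= l2norm ((sd / h) *: v) ->
        l2norm ((h / sd) *: (lattice_pt l : 'cV[R]_d)) <= l2norm v.
      move=> hh; rewrite !l2normZ !ger0_norm; try by rewrite divr_ge0// ltW.
      move=> hl; apply: (le_trans (ler_wpM2l _ hl)); first by rewrite divr_ge0// ltW.
      by rewrite mulrA hsd// mul1r.
    have uw : l2norm (u - wG f) <= r by exact: dist.
    exists (wG f), (bG g); split=> //; first exact: dist.
    have okfg : okG (f, g).
      rewrite /okG/=; apply/and3P; split.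
      - by rewrite -u1; exact: nrm.
      - have := l2normD (u - wG f) (wG f); rewrite subrK u1.
        by have := le_trans uw r1; lra.
      - by apply: le_trans bb; exact: nrm.
    by have /negP := hG (f, g) okfg; rewrite -ltNge => /ltW.
have hlow u b : l2norm b <= b0 ->
    n%:R * mu / 8 * dotv u u <= \sum_i dotv u (X i w) ^+ 2 * slab (2 * tau) b (X i w).
  move=> bb; have [->|u0] := eqVneq u 0.
    rewrite dotv0l mulr0 sumr_ge0// => i _.
    by rewrite mulr_ge0 ?sqr_ge0// slab_ge0.
  have un : 0 < l2norm u.
    by rewrite lt_def l2norm_ge0 andbT; apply: contra_neq u0; exact: l2norm_eq0.
  have := hlow1 ((l2norm u)^-1 *: u) b.
  rewrite l2normZ ger0_norm ?invr_ge0 ?(ltW un)// mulVf ?gt_eqF// => /(_ erefl bb) h.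
  have u2 : 0 < dotv u u by rewrite -sqr_l2norm exprn_gt0.
  rewrite -ler_pdivlMr// (le_trans h)// mulr_suml ler_sum// => i _.
  rewrite dotvZl exprMn exprVn sqr_l2norm.
  by rewrite [(dotv u u)^-1 * _]mulrC mulrAC.
move=> b u bb.
have curv i : m * slab (2 * tau) b (X i w) <=
    (psi_sat psi chi L)^`(2)%classic (dotv (X i w) b) <= c2.
  rewrite (ddpsi_satE hpsi hchi).
  have /andP[h1 h2] := sat_curv_range hpsi hchi L (dotv (X i w) b).
  rewrite h2 andbT /slab dotvC; case: ifPn => [ht|_]; last by rewrite mulr0.
  rewrite (cutoff_one hchi) ?mulr1 ?hm//.
  have L0 : 0 < L by exact: lt_le_trans L1.
  rewrite normrM normfV (gtr0_norm L0) ler_pdivrMr// mul1r.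
  exact: le_trans ht Ltau.
have up2 := hup u.
have low2 := hlow u b bb.
rewrite ler_pdivlMl// ler_pdivrMl//; apply/andP; split.
  apply: (@le_trans _ _ (\sum_i m * (dotv u (X i w) ^+ 2 * slab (2 * tau) b (X i w)))).
    rewrite -mulr_sumr (_ : n%:R * _ = m * (n%:R * mu / 8 * dotv u u)); last by ring.
    by rewrite ler_wpM2l// ltW.
  apply: ler_sum => i _; rewrite -expr2 (dotvC (X i w) u) mulrCA mulrC.
  by rewrite ler_wpM2r ?sqr_ge0//; have /andP[] := curv i.
apply: (@le_trans _ _ (\sum_i c2 * dotv u (X i w) ^+ 2)).
  apply: ler_sum => i _; rewrite -expr2 (dotvC (X i w) u).
  by rewrite ler_wpM2r ?sqr_ge0//; have /andP[] := curv i.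
rewrite -mulr_sumr; apply: (@le_trans _ _ (c2 * (n%:R * g0 * dotv u u))).
  by rewrite ler_wpM2l// ltW// (link_c2_gt0 hpsi).
rewrite [leRHS](_ : _ = c2 * (n%:R * g0 * dotv u u) + n%:R * (m * mu / 8 * dotv u u)).
  rewrite lerDl mulr_ge0// mulr_ge0// ?dotv_ge0// divr_ge0// mulr_ge0// ltW//.
by ring.
Qed.

Lemma hessian_event_prob_explicit :
  ((1 - (expR (6 * d%:R - 11 * n%:R) +
     ((2 * N.+1%:R) ^+ d) ^+ 2 * expR (- (n%:R * (mu ^+ 2 / (1024 * Kx ^+ 4))))))%:E <=
   P (hessian_event X psi chi L b0 (m * mu / 8) (c2 * g0 + m * mu / 8)))%E.
Proof.
set E := hessian_event _ _ _ _ _ _ _.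
have mE : measurable E by exact: (measurable_hessian_event mX _ _ _ _ hpsi hchi).
set B := (X in 1 - X).
suff h : (P (~` E) <= B%:E)%E.
  rewrite -[E]setCK probability_setC; last exact: measurableC.
  by rewrite EFinB leeB.
apply: (@le_trans _ _ (\sum_(s : F + G * G | match s with inl f => okF f | inr fg => okG fg end)
   P (match s with inl f => badF f | inr fg => badG fg end))%E).
  apply: measure_union_bound.
  - exact: measurableC.
  - case=> [f|fg].
      by apply: measurable_ge_set; exact: measurable_sqr_sum.
    rewrite /badG (_ : [set w | _] = [set w | - (n%:R * mu / 2) <=
        - \sum_i dotv (wG fg.1) (X i w) ^+ 2 * slab tau (bG fg.2) (X i w)]); last first.
      by apply/seteqP; split=> w /=; rewrite lerN2.
    by apply: measurable_ge_set; apply: measurableT_comp => //; exact: measurable_slab_sum.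
  - move=> w /= nE; apply: contrapT => hno; apply: nE; apply: good => [f okf bf|fg okfg bfg].
      by apply: hno; exists (inl f).
    by apply: hno; exists (inr fg).
rewrite big_sumType/= /B EFinD; apply: leeD.
  have hexp : expR (n%:R * (1 - 48 * Kx ^+ 2 / (4 * Kx ^+ 2))) = expR (- 11 * n%:R).
    by congr expR; field; rewrite gt_eqF.
  apply: (@le_trans _ _ (\sum_(f : F | okF f) (expR (- 11 * n%:R))%:E)%E).
    apply: lee_sum => f okf; rewrite -hexp.
    apply: (sqr_sum_tail Kx0 hD mX indX lawX).
    rewrite l2normZ ger0_norm ?invr_ge0 ?mulr_ge0 ?(ltW sd0)//.
    rewrite ler_pdivrMl ?mulr_gt0// mulr1.
    rewrite -(@ler_pXn2r _ 2) ?nnegrE ?l2norm_ge0 ?mulr_ge0 ?(ltW sd0)//.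
    rewrite exprMn (sqr_sqrtr (ler0n _ d)) (le_trans okf)// ler_wpM2r//.
    by rewrite expr2; lra.
  rewrite sumEFin lee_fin.
  have -> : \sum_(f | okF f) expR (- 11 * n%:R) =
      expR (- 11 * n%:R) * \sum_(f | okF f) 1 :> R.
    by rewrite mulr_sumr; apply: eq_bigr => f _; rewrite mulr1.
  rewrite [6 * _ - _]addrC expRD mulNr ler_wpM2l ?expR_ge0//.
  apply: (le_trans (@lattice_card_le R d (2 * d) _)).
  rewrite (_ : 6 * d%:R = 4 * d%:R + d%:R * 2 :> R); last by ring.
  rewrite expRD ler_wpM2l ?expR_ge0// expRM_natl lerXn2r ?nnegrE ?expR_ge0//.
  rewrite (_ : 4 = 2 ^+ 2 :> R); last by rewrite expr2; lra.
  rewrite -[X in expR X]mulr1 expRM_natl lerXn2r ?nnegrE ?expR_ge0//.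
  by have := expR_ge1Dx (1 : R); lra.
set e := expR _.
apply: (@le_trans _ _ (\sum_(fg : G * G | okG fg) e%:E)%E).
  apply: lee_sum => fg /and3P[ok1 ok2 ok3].
  apply: (slab_sum_tail Kx0 hD mX indX lawX C0 b00 tau0 htau) => //.
  have : (9 / 10) ^+ 2 <= dotv (wG fg.1) (wG fg.1).
    by rewrite -sqr_l2norm lerXn2r ?nnegrE ?l2norm_ge0//; lra.
  rewrite -(ler_pM2r (_ : 0 < C^-1)) ?invr_gt0// => h.
  have muE : mu = 1 / 4 * C^-1 by rewrite /mu; field; rewrite gt_eqF.
  have CE : (2 * C)^-1 = 1 / 2 * C^-1 by field; rewrite gt_eqF.
  have c0 : 0 < C^-1 by rewrite invr_gt0.
  by rewrite muE CE; move: h c0; rewrite expr2; lra.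
rewrite sumEFin lee_fin big_mkcond/=.
apply: (@le_trans _ _ (\sum_(fg : G * G) e)).
  by apply: ler_sum => fg _; case: ifP => // _; exact: expR_ge0.
rewrite sumr_const card_prod !card_ffun card_prod card_bool !card_ord.
by rewrite -[leLHS]mulr_natl natrM natrX natrM expr2.
Qed.

End hessian_probability.

Section log_of_sample_size.
Context {R : realType}.
Implicit Types (n : nat).

Lemma ln_expn1M n : (0 < n)%N -> ln (expR 1 * n%:R) = 1 + ln n%:R :> R.
Proof. by move=> n0; rewrite lnM ?posrE ?expR_gt0 ?ltr0n// expRK. Qed.

Lemma ln_nat_ge0 n : 0 <= ln n%:R :> R.
Proof.
case: n => [|n]; first by rewrite ln0.
by apply: ln_ge0; rewrite ler1n.
Qed.

Lemma expRN_ln_nat n k : (0 < n)%N -> expR (- (k%:R * ln n%:R)) = n%:R ^- k :> R.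
Proof. by move=> n0; rewrite expRN expRM_natl lnK ?posrE ?ltr0n. Qed.

End log_of_sample_size.

(** At [t^2 = 2 a / e] the claim reads [2 / e <= exp (2 / e)]. *)
Lemma exists_expRN_small (R : realType) (a e : R) : 0 < a -> 0 < e ->
  exists2 t, 0 < t & 2 * expR (- (t ^+ 2 / a)) <= e.
Proof.
move=> a0 e0; exists (Num.sqrt (a * (2 / e))).
  by rewrite sqrtr_gt0 mulr_gt0// divr_gt0.
rewrite sqr_sqrtr; last by rewrite mulr_ge0 ?divr_ge0// ltW.
rewrite [a * _]mulrC mulfK ?gt_eqF// expRN -ler_pdivlMl// [2^-1 * e]mulrC.
rewrite -[e / 2]invrK lef_pV2 ?posrE ?expR_gt0 ?invr_gt0 ?divr_gt0// invf_div.
by have := expR_ge1Dx (2 / e); lra.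
Qed.

(** The constants are fixed before [d] and [n]. The meshes are polynomial in [1 / n], so the
    logarithm of the number of net points is of order [d ln (e n)], which is dominated by [n]
    through the choice of [C0]. *)
Lemma hessian_event_prob (R : realType) (C Kx c2 c3 b0 : R) (psi chi : R -> R) :
  0 < C -> 0 < Kx -> 0 < b0 -> link_assumption psi c2 c3 -> cutoff chi ->
  exists alpha gamma C0 Lpsi0 : R,
  [/\ 0 < alpha, alpha <= gamma, 1 <= Lpsi0 & 3 <= C0] /\
  forall (d n : nat) (fx : probability 'cV[R]_d R) d' (Om : measurableType d')
    (P : probability Om R) (X : 'I_n -> Om -> 'cV[R]_d),
  (0 < d)%N -> (0 < n)%N -> design_assumption fx C Kx ->
  (forall i, measurable_fun [set: Om] (X i)) -> mutually_independent P X ->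
  (forall i (g : 'cV[R]_d -> R), (forall x, 0 <= g x) ->
    measurable_fun [set: 'cV[R]_d] g ->
    (\int[P]_w (g (X i w))%:E = \int[fx]_x (g x)%:E)%E) ->
  C0 * d%:R * ln (expR 1 * n%:R) <= n%:R ->
  forall L, Lpsi0 <= L ->
  ((1 - n%:R ^- 2)%:E <= P (hessian_event X psi chi L b0 alpha gamma))%E.
Proof.
move=> Cp Kx0 b00 hpsi hchi.
pose g0 := 192 * Kx ^+ 2; pose mu := (4 * C)^-1.
have g00 : 0 < g0 by rewrite mulr_gt0// exprn_gt0.
have mu0 : 0 < mu by rewrite invr_gt0 mulr_gt0.
have [t t0 ht] : exists2 t, 0 < t &
    2 * expR (- (t ^+ 2 / (4 * Kx ^+ 2))) <= (256 * C ^+ 2 * Kx ^+ 4)^-1.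
  apply: exists_expRN_small; first by rewrite mulr_gt0// exprn_gt0.
  by rewrite invr_gt0 !mulr_gt0// exprn_gt0.
pose tau := b0 * t.
have tau0 : 0 < tau by rewrite mulr_gt0.
have htau : 2 * expR (- ((tau / b0) ^+ 2 / (4 * Kx ^+ 2))) <= (256 * C ^+ 2 * Kx ^+ 4)^-1.
  by rewrite /tau [b0 * t]mulrC mulfK ?gt_eqF.
(* A positive continuous function attains a positive minimum on a compact interval. *)
have [m m0 hm] : exists2 m, 0 < m & forall u, `|u| <= 2 * tau -> m <= psi^`(2)%classic u.
  have [||s _ hs] := @EVT_min R (psi^`(2)%classic) (- (2 * tau)) (2 * tau).
  - by rewrite ge0_cp// mulr_ge0// ltW.
  - by apply: continuous_subspaceT; exact: (continuous_ddlink hpsi).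
  - exists (psi^`(2)%classic s); first by have /andP[] := link_curvature hpsi s.
    by move=> u; rewrite ler_norml => hu; apply: hs; rewrite in_itv.
pose r := Num.min 10^-1 (Num.sqrt (mu / 8 / g0)).
have r0 : 0 < r by rewrite lt_min invr_gt0 ltr0n sqrtr_gt0 divr_gt0// divr_gt0.
have r1 : r <= 10^-1 by rewrite ge_min lexx.
have hr : r ^+ 2 * g0 <= mu / 8.
  rewrite -ler_pdivlMr// -[leRHS]sqr_sqrtr; last by rewrite !divr_ge0// ltW.
  by rewrite lerXn2r ?nnegrE ?sqrtr_ge0 ?(ltW r0)// ge_min lexx orbT.
have [kappa kappa0 kappaE] : exists2 k, 0 < k & k = mu ^+ 2 / (1024 * Kx ^+ 4).
  eexists; last by []; apply: divr_gt0; first exact: exprn_gt0.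
  by apply: mulr_gt0; [rewrite ltr0n|exact: exprn_gt0].
pose K0 := r^-1 + b0 * Num.sqrt g0 / tau.
have K00 : 0 < K0 by rewrite addr_gt0 ?invr_gt0// divr_gt0 ?mulr_gt0 ?sqrtr_gt0.
pose K1 := 2 * K0 + 4.
have K1_1 : 1 <= K1 by rewrite /K1; lra.
have lnK1 : 0 <= ln K1 by exact: ln_ge0.
(* Of the exponent [- n kappa], the second summand lets one half absorb the cardinality of the nets,
   and the third makes the other half at least [3 ln (e n)]. The first summand serves the upper
   bound. *)
pose C0 := 3 + 4 * (1 + ln K1) / kappa + 6 / kappa.
have c41 : 0 <= 4 * (1 + ln K1) / kappa by rewrite divr_ge0 ?mulr_ge0 ?addr_ge0// ltW.
have c6 : 0 <= 6 / kappa by rewrite divr_ge0// ltW.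
exists (m * mu / 8), (c2 * g0 + m * mu / 8), C0, (Num.max 1 (2 * tau)).
split.
  split.
  - by rewrite divr_gt0// mulr_gt0.
  - by rewrite lerDr mulr_ge0// ltW// (link_c2_gt0 hpsi).
  - by rewrite le_max lexx.
  - by rewrite /C0 -addrA lerDl addr_ge0.
move=> d n fx d' Om P X d0 n0 hD mX indX lawX hn L; rewrite ge_max => /andP[L1 Ltau].
rewrite (ln_expn1M n0) in hn; set l := 1 + ln n%:R in hn.
have l1 : 1 <= l by rewrite lerDl ln_nat_ge0.
have d1 : 1 <= d%:R :> R by rewrite ler1n.
have n1 : 1 <= n%:R :> R by rewrite ler1n.
have dl : 1 <= d%:R * l by rewrite -[leLHS]mulr1 ler_pM.
have hC a : 0 <= a -> a <= C0 -> a * (d%:R * l) <= n%:R.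
  move=> a0 aC; apply: le_trans hn; rewrite -[leRHS]mulrA ler_wpM2r//.
  exact: le_trans dl.
have h3 : 3 * (d%:R * l) <= n%:R by apply: hC => //; rewrite /C0; lra.
have h4 : 4 * (1 + ln K1) / kappa * (d%:R * l) <= n%:R by apply: hC => //; rewrite /C0; lra.
have h6 : 6 / kappa * (d%:R * l) <= n%:R by apply: hC => //; rewrite /C0; lra.
have ld : l <= d%:R * l by rewrite ler_peMl//; lra.
have ddl : d%:R <= d%:R * l by rewrite ler_peMr//; lra.
have dn : d%:R <= n%:R :> R by lra.
pose N := (Num.truncn (K0 * n%:R)).+1.
have NK : K0 * n%:R <= N%:R by rewrite ltW// truncnS_gt.
have sdn : Num.sqrt d%:R <= Num.sqrt n%:R :> R by rewrite ler_wsqrtr.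
have snn : Num.sqrt n%:R * Num.sqrt n%:R = n%:R :> R by rewrite -expr2 sqr_sqrtr.
have sn1 : Num.sqrt n%:R <= n%:R :> R.
  by rewrite -{2}snn ler_peMl ?sqrtr_ge0// -[leLHS]sqrtr1 ler_wsqrtr.
have bK : 0 <= b0 * Num.sqrt g0 / tau by rewrite divr_ge0 ?mulr_ge0 ?sqrtr_ge0 ?ltW.
have hN1 : Num.sqrt d%:R / r <= N%:R.
  apply: le_trans NK; rewrite mulrC; apply: ler_pM; rewrite ?invr_ge0 ?sqrtr_ge0 ?(ltW r0)//.
  - by rewrite lerDl.
  - exact: le_trans sdn sn1.
have hN2 : b0 * (Num.sqrt d%:R * Num.sqrt (n%:R * g0) / tau) <= N%:R.
  apply: le_trans NK; rewrite sqrtrM//.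
  rewrite (_ : b0 * _ = b0 * Num.sqrt g0 / tau * (Num.sqrt d%:R * Num.sqrt n%:R)); last by ring.
  apply: ler_pM => //.
  - by rewrite lerDr invr_ge0 ltW.
  - by rewrite -[leRHS]snn ler_wpM2r ?sqrtr_ge0.
apply: le_trans (hessian_event_prob_explicit d0 n0 Kx0 hD mX indX lawX hpsi hchi Cp b00
  tau0 m0 htau hm L1 Ltau r0 r1 hr hN1 hN2).
rewrite lee_fin lerD2l lerN2 -kappaE.
have l3 : 2 * expR (- (3 * l)) <= n%:R ^- 2.
  rewrite -(expRN_ln_nat _ n0) (_ : - (3 * l) = - 3 + - (3 * ln n%:R)); last first.
    by rewrite /l; ring.
  rewrite expRD mulrA -[leRHS]mul1r; apply: ler_pM; rewrite ?mulr_ge0 ?expR_ge0//.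
    rewrite expRN -ler_pdivlMl// mulr1 lef_pV2 ?posrE ?expR_gt0//.
    by have := expR_ge1Dx (3 : R); lra.
  by rewrite ler_expR lerN2 ler_wpM2r ?ln_nat_ge0//; lra.
apply: le_trans l3; set e3 := expR (- (3 * l)); rewrite [leRHS](_ : _ = e3 + e3); last by ring.
apply: lerD; first by rewrite ler_expR; lra.
have N2 : 2 * N.+1%:R <= K1 * n%:R.
  have : (Num.truncn (K0 * n%:R))%:R <= K0 * n%:R.
    by rewrite truncn_le// mulr_ge0// ltW.
  rewrite /N -!natr1 /K1; lra.
have Kn0 : 0 < K1 * n%:R by rewrite mulr_gt0//; lra.
have h5 : (2 * N.+1%:R) ^+ d ^+ 2 <= expR (2 * d%:R * (ln K1 + ln n%:R)).
  rewrite -exprM (_ : 2 * d%:R = (d * 2)%:R); last by rewrite natrM mulrC.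
  rewrite expRM_natl -lnM ?posrE//; try lra.
  by rewrite lnK ?posrE// lerXn2r ?nnegrE ?(ltW Kn0)// mulr_ge0.
apply: (le_trans (ler_wpM2r (expR_ge0 _) h5)); rewrite -expRD ler_expR.
have hk4 : 4 * (1 + ln K1) * (d%:R * l) <= n%:R * kappa.
  by rewrite -ler_pdivrMr// mulrAC.
have hk6 : 6 * (d%:R * l) <= n%:R * kappa by rewrite -ler_pdivrMr// mulrAC.
have : 2 * d%:R * (ln K1 + ln n%:R) <= 2 * ((1 + ln K1) * (d%:R * l)).
  rewrite -mulrA ler_wpM2l// mulrCA ler_wpM2l// /l.
  have := ln_nat_ge0 n (R := R); nra.
lra.
Qed.

(** * Projections onto balls and intervals in closed form *)

Section projections.
Context {R : realType}.

Lemma l2norm_clip2_le d (L : R) (x : 'cV[R]_d) : 0 <= L -> l2norm (clip2 L x) <= L.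
Proof.
move=> L0; rewrite /clip2 l2normZ.
have [->|x0] := eqVneq x 0; first by rewrite l2norm0 mulr0.
have xn : 0 < l2norm x.
  by rewrite lt_def l2norm_ge0 andbT; apply: contra_neq x0; exact: l2norm_eq0.
rewrite ger0_norm; last by rewrite le_min ler01 divr_ge0// ltW.
by rewrite -ler_pdivlMr// ge_min lexx orbT.
Qed.

Lemma clip2_id d (L : R) (x : 'cV[R]_d) : l2norm x <= L -> clip2 L x = x.
Proof.
move=> xL; rewrite /clip2; have [->|x0] := eqVneq x 0; first by rewrite scaler0.
have xn : 0 < l2norm x.
  by rewrite lt_def l2norm_ge0 andbT; apply: contra_neq x0; exact: l2norm_eq0.
by rewrite min_l ?scale1r// ler_pdivlMr// mul1r.
Qed.

Lemma clip2_far d (L : R) (x : 'cV[R]_d) : L < l2norm x -> 0 <= L ->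
  clip2 L x = (L / l2norm x) *: x.
Proof.
move=> xL L0; rewrite /clip2 min_r// ler_pdivrMr ?mul1r ?ltW//.
exact: le_lt_trans xL.
Qed.

(** The projection is a choice among nearest points, so uniqueness is needed as well as minimality
    of the radial point. *)
Lemma proj_ballE d (r : R) (v : 'cV[R]_d) : 0 <= r -> proj_ball r v = clip2 r v.
Proof.
move=> r0; rewrite /proj_ball /projection; case: xgetP => [p _ [pr pmin]|hno]; last first.
  exfalso; apply: (hno (clip2 r v)); split; first exact: l2norm_clip2_le.
  move=> q qr; have [vr|vr] := leP (l2norm v) r.
    by rewrite clip2_id// subrr l2norm0 l2norm_ge0.
  have vn : 0 < l2norm v by exact: le_lt_trans vr.
  rewrite clip2_far// -[v in v - _]scale1r -scalerBl l2normZ ger0_norm; last first.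
    by rewrite subr_ge0 ler_pdivrMr// mul1r ltW.
  rewrite mulrBl mul1r divfK ?gt_eqF// lerBlDr (le_trans (_ : _ <= l2norm (v - q) + l2norm q))//.
    by rewrite -{1}(subrK q v) l2normD.
  by rewrite lerD2l.
have := pmin (clip2 r v) (l2norm_clip2_le v r0).
have [vr|vr] := leP (l2norm v) r.
  rewrite clip2_id// subrr l2norm0 => h.
  have /l2norm_eq0/eqP : l2norm (v - p) = 0 by apply/eqP; rewrite eq_le h l2norm_ge0.
  by rewrite subr_eq0 => /eqP.
have vn : 0 < l2norm v by exact: le_lt_trans vr.
rewrite clip2_far// -[v in v - _ *: _]scale1r -scalerBl l2normZ ger0_norm; last first.
  by rewrite subr_ge0 ler_pdivrMr// mul1r ltW.
rewrite mulrBl mul1r divfK ?gt_eqF// => h.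
(* With [t = r / |v| <= 1], multiplying the minimality of [p] by [t] yields [|p - t v|^2 <= (1 - t)
   (|p|^2 - r^2) <= 0]. *)
have /l2norm_eq0/eqP : l2norm (p - (r / l2norm v) *: v) = 0; last first.
  by rewrite subr_eq0 => /eqP.
apply/eqP; rewrite -sqrf_eq0 eq_le sqr_ge0 andbT sqr_l2norm.
have h2 : l2norm (v - p) ^+ 2 <= (l2norm v - r) ^+ 2.
  by rewrite lerXn2r ?nnegrE ?l2norm_ge0// subr_ge0 ltW.
move: h2; rewrite sqr_l2norm !(dotvBl, dotvBr, dotvZl, dotvZr) (dotvC p v).
rewrite -!sqr_l2norm; have : l2norm p ^+ 2 <= r ^+ 2 by rewrite lerXn2r ?nnegrE ?l2norm_ge0.
set a := l2norm v in vn vr h *; set b := l2norm p; set s := dotv v p => hb h2.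
set t := r / a; have t0 : 0 <= t by rewrite divr_ge0// ltW.
have t1 : t <= 1 by rewrite ler_pdivrMr// mul1r ltW.
have ta : t * a = r by rewrite divfK// gt_eqF.
have /(ler_wpM2l t0) := h2.
have -> : t * (a - r) ^+ 2 = t * a * a - 2 * r * (t * a) + t * r ^+ 2 by ring.
rewrite [X in X <= _ -> _](_ : _ = t * a * a - 2 * (t * s) + t * b ^+ 2); last by ring.
rewrite [X in _ -> X <= 0](_ : _ = b ^+ 2 - 2 * (t * s) + (t * a) ^+ 2); last by ring.
rewrite ta; have : t * (r ^+ 2 - b ^+ 2) <= 1 * (r ^+ 2 - b ^+ 2).
  by rewrite ler_wpM2r// subr_ge0.
by rewrite mulrBr mul1r; nra.
Qed.

Lemma l2norm_proj_ball_le d (r : R) (v : 'cV[R]_d) : 0 <= r ->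
  l2norm (proj_ball r v) <= r.
Proof. by move=> r0; rewrite proj_ballE// l2norm_clip2_le. Qed.

Lemma proj_ball_contract d (r : R) (v b : 'cV[R]_d) : 0 <= r -> l2norm b <= r ->
  l2norm (proj_ball r v - b) <= l2norm (v - b).
Proof.
move=> r0 br; rewrite proj_ballE//; have [vr|vr] := leP (l2norm v) r.
  by rewrite clip2_id.
have vn : 0 < l2norm v by exact: le_lt_trans vr.
rewrite clip2_far// -(@ler_pXn2r _ 2) ?nnegrE ?l2norm_ge0// !sqr_l2norm.
rewrite !(dotvBl, dotvBr, dotvZl, dotvZr) (dotvC b v) -!sqr_l2norm.
have hs : dotv v b <= l2norm v * r.
  by rewrite (le_trans (dotv_le _ _))// ler_wpM2l// ltW.
set a := l2norm v in vn vr hs *; set c := l2norm b in br *; set s := dotv v b in hs *.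
set t := r / a; have t0 : 0 <= t by rewrite divr_ge0// ltW.
have t1 : t <= 1 by rewrite ler_pdivrMr// mul1r ltW.
have ta : t * a = r by rewrite divfK// gt_eqF.
have -> : t * (t * a ^+ 2) = r ^+ 2 by rewrite -ta; ring.
have : (1 - t) * s <= (1 - t) * (a * r) by rewrite ler_wpM2l// subr_ge0.
have -> : (1 - t) * (a * r) = a * r - t * a * r by ring.
rewrite ta mulrBl mul1r; have := sqr_ge0 (a - r); rewrite sqrrB.
lra.
Qed.

Lemma proj_itvE (r t : R) : 0 <= r -> proj_itv r t = Num.max (- r) (Num.min r t).
Proof.
move=> r0; set p0 := Num.max _ _.
have p0r : - r <= p0 <= r.
  by rewrite /p0 le_max lexx/= ge_max ge_min lexx/= andbT; lra.
have near q : - r <= q <= r -> `|t - p0| <= `|t - q|.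
  rewrite /p0; case: (leP r t) => rt /andP[q1 q2].
    by rewrite max_r; [rewrite !ger0_norm; lra|lra].
  case: (leP (- r) t) => rt'; first by rewrite subrr normr0.
  by rewrite !ler0_norm; lra.
rewrite /proj_itv /projection; case: xgetP => [p _ [/=]|hno]; last first.
  exfalso; apply: (hno p0); split; first by rewrite /= in_itv.
  by move=> q /=; rewrite in_itv; exact: near.
rewrite in_itv/= => pr pmin; have := pmin p0; rewrite /= in_itv/= => /(_ p0r).
move: pr p0r; rewrite /p0; case: (leP r t) => rt /andP[q1 q2] _.
  by rewrite max_r; [rewrite !ger0_norm; lra|lra].
case: (leP (- r) t) => rt'.
  by rewrite subrr normr0 normr_le0 subr_eq0 => /eqP.
by rewrite !ler0_norm; lra.
Qed.

Lemma normr_proj_itv_le (r t : R) : 0 <= r -> `|proj_itv r t| <= r.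
Proof.
move=> r0; rewrite proj_itvE// ler_norml le_max lexx/= ge_max ge_min lexx/= andbT.
by lra.
Qed.

Lemma proj_itv_id (r t : R) : `|t| <= r -> proj_itv r t = t.
Proof.
move=> tr; have r0 : 0 <= r by exact: le_trans tr.
by move: tr; rewrite proj_itvE// ler_norml => /andP[h1 h2]; rewrite min_r// max_r.
Qed.

End projections.

Lemma l2norm_convex {R : realType} d (u v : 'cV[R]_d) (s r : R) :
  0 <= s <= 1 -> l2norm u <= r -> l2norm v <= r -> l2norm (u + s *: (v - u)) <= r.
Proof.
move=> /andP[s0 s1] ur vr.
have -> : u + s *: (v - u) = (1 - s) *: u + s *: v.
  by rewrite scalerBr scalerBl scale1r addrA addrAC.
rewrite (le_trans (l2normD _ _))// !l2normZ !ger0_norm ?subr_ge0//.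
have := ler_wpM2l s0 vr.
have : (1 - s) * l2norm u <= (1 - s) * r by rewrite ler_wpM2l// subr_ge0.
lra.
Qed.

(** * Contraction of the noiseless gradient step *)

Section gradient_step.
Context {R : realType} (d n : nat).
Variables (psi chi : R -> R) (c2 c3 L : R).
Hypotheses (hpsi : link_assumption psi c2 c3) (hchi : cutoff chi).
Variables (x : 'I_n -> 'cV[R]_d) (y : 'I_n -> R) (eta0 : R).

Definition grad_step (b : 'cV[R]_d) : 'cV[R]_d :=
  b - (eta0 / n%:R) *: (\sum_(i < n) (dpsi_sat psi chi L (dotv (x i) b) - y i) *: x i).

Lemma dotv_grad_step v b : dotv v (grad_step b) =
  dotv v b - eta0 / n%:R * \sum_(i < n) (dpsi_sat psi chi L (dotv (x i) b) - y i) * dotv (x i) v.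
Proof.
rewrite /grad_step dotvBr dotvZr dotv_sumr; congr (_ - _ * _).
by apply: eq_bigr => i _; rewrite dotvZr (dotvC v).
Qed.

Variables (alpha gamma b0 : R).
Hypotheses (alpha0 : 0 < alpha) (alpha_gamma : alpha <= gamma).
Hypothesis eta0E : eta0 = 2 / (alpha + gamma).
Hypothesis hH : forall b : 'cV[R]_d, l2ball b0 b ->
  let H := empirical_hessian psi chi L x b in
  loewner_le alpha%:M H /\ loewner_le H gamma%:M.

(* The mean value theorem is applied along the segment [c, b] to the scalar
   function s |-> <w, grad_step (c + s (b - c))>, w being the image of b - c. *)
Lemma grad_step_contract b c : l2norm b <= b0 -> l2norm c <= b0 ->
  l2norm (grad_step b - grad_step c) <=
  (gamma - alpha) / (gamma + alpha) * l2norm (b - c).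
Proof.
move=> bb cb; set w := grad_step b - grad_step c.
set rho := (gamma - alpha) / (gamma + alpha).
have ga0 : 0 < gamma + alpha by rewrite addr_gt0// (lt_le_trans alpha0).
have rho0 : 0 <= rho by rewrite divr_ge0 ?subr_ge0// ltW.
have [->|w0] := eqVneq w 0; first by rewrite l2norm0 mulr_ge0 ?l2norm_ge0.
have wn : 0 < l2norm w.
  by rewrite lt_def l2norm_ge0 andbT; apply: contra_neq w0; exact: l2norm_eq0.
pose seg s := c + s *: (b - c).
pose H s := empirical_hessian psi chi L x (seg s).
pose phi s := dotv w (grad_step (seg s)).
pose dphi s := dotv w ((1%:M - eta0 *: H s) *m (b - c)).
have dphiE s : dphi s = dotv w (b - c) - eta0 / n%:R * \sum_(i < n)
    (psi_sat psi chi L)^`(2)%classic (dotv (x i) (seg s)) * (dotv (x i) w * dotv (x i) (b - c)).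
  rewrite /dphi (mulmxBl 1%:M) mul1mx -(scalemxAl eta0 (H s)).
  by rewrite (dotvBr (b - c) (eta0 *: _)) (dotvZr eta0) hessian_form !mulrA.
have hphi (s : R) : is_derive s 1 phi (dphi s).
  have -> : phi = fun s => (dotv w c + s * dotv w (b - c)) -
      eta0 / n%:R * \sum_(i < n) (dpsi_sat psi chi L (dotv (x i) c + dotv (x i) (b - c) * s) - y i)
        * dotv (x i) w.
    apply/funext => u; rewrite /phi dotv_grad_step /seg dotvDr dotvZr; congr (_ - _ * _).
    by apply: eq_bigr => i _; rewrite dotvDr dotvZr [u * _]mulrC.
  rewrite dphiE; apply: is_derive_fsub.
    rewrite -[X in is_derive _ _ _ X]add0r; apply: is_derive_fadd.
    have := @is_derive_fscale _ (fun u : R => u) (dotv w (b - c)) s 1 (is_derive_id _ _).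
    by rewrite mulr1; under eq_fun do rewrite mulrC.
  apply: is_derive_fscale.
  have hi (i : 'I_n) : is_derive s 1
      (fun u : R => (dpsi_sat psi chi L (dotv (x i) c + dotv (x i) (b - c) * u) - y i) * dotv (x i) w)
      ((psi_sat psi chi L)^`(2)%classic (dotv (x i) (seg s)) * (dotv (x i) w * dotv (x i) (b - c))).
    rewrite mulrCA; under eq_fun do rewrite mulrC; apply: is_derive_fscale.
    rewrite -[X in is_derive _ _ _ X]subr0; apply: is_derive_fsub.
    have curvE : (psi_sat psi chi L)^`(2)%classic (dotv (x i) (seg s)) =
        psi^`(2)%classic (dotv (x i) c + dotv (x i) (b - c) * s) *
        chi ((dotv (x i) c + dotv (x i) (b - c) * s) / L).
      by rewrite (ddpsi_satE hpsi hchi) /seg dotvDr dotvZr [s * _]mulrC.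
    rewrite curvE mulrC; apply: is_derive_affine.
    exact: (is_derive_dpsi_sat hpsi hchi).
  have := is_derive_sum hi.
  by rewrite (_ : \sum_(i < n) _ = fun u : R => \sum_(i < n) (dpsi_sat psi chi L (dotv (x i) c + dotv (x i) (b - c) * u) - y i)
        * dotv (x i) w)//; apply/funext => u; rewrite fct_sumE.
have [s [sb]] := mean_value 0 1 hphi.
rewrite min_l// max_r// in sb.
have -> : phi 1 - phi 0 = dotv w w.
  by rewrite /phi /seg scale1r scale0r addr0 (addrC c) subrK -dotvBr.
rewrite subr0 mulr1 -sqr_l2norm => E.
have segb : l2norm (seg s) <= b0 by exact: l2norm_convex.
have [h1 h2] := hH segb.
have symH : (H s)^T = H s by exact: hessian_sym.
have sc a : (a%:M : 'M[R]_d)^T = a%:M by exact: tr_scalar_mx.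
rewrite -(ler_pM2l wn) -expr2 E /dphi.
rewrite [leRHS](_ : _ = rho * l2norm w * l2norm (b - c)); last by ring.
apply: sym_form_bound => //.
  by rewrite linearB/= linearZ/= symH sc.
move=> z; rewrite mulmxBl dotvBr mul1mx -scalemxAl dotvZr.
have {}h1 := (loewner_leP (sc _) symH).1 h1 z.
have {}h2 := (loewner_leP symH (sc _)).1 h2 z.
rewrite !dotv_scalar_mx in h1 h2.
have eta_gt0 : 0 < eta0 by rewrite eta0E divr_gt0// addrC.
have ne : gamma + alpha != 0 by rewrite gt_eqF.
(* The step size balances both ends of the spectrum: that of [1 - eta0 H] lies in [[- rho, rho]]. *)
have e1 : eta0 * alpha = 1 - rho by rewrite eta0E [alpha + _]addrC /rho; field.
have e2 : eta0 * gamma = 1 + rho by rewrite eta0E [alpha + _]addrC /rho; field.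
have := ler_wpM2l (ltW eta_gt0) h1; have := ler_wpM2l (ltW eta_gt0) h2.
rewrite !mulrA e1 e2 ler_norml; lra.
Qed.

End gradient_step.

(** * Error recursion on the good event *)

Section noisy_pgd.
Context {R : realType} (d n : nat).
Variables (psi chi : R -> R) (c2 c3 : R).
Hypotheses (hpsi : link_assumption psi c2 c3) (hchi : cutoff chi).
Variables (b0 eta0 r Lx L : R) (D : 'I_n -> R * 'cV[R]_d) (w : nat -> 'cV[R]_d).
Hypothesis b00 : 0 < b0.

Local Notation pgd := (noisy_pgd psi chi b0 eta0 r Lx L 0 D w).

Lemma noisy_pgd_ball t : l2norm (pgd t) <= b0.
Proof.
by case: t => [|t] /=; [rewrite l2norm0 ltW|rewrite l2norm_proj_ball_le// ltW].
Qed.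

(** Gradient of the average negative log-likelihood multiplied by [c(sigma)], without clipping or
    saturation. *)
Definition score (b : 'cV[R]_d) : 'cV[R]_d :=
  n%:R^-1 *: \sum_(i < n) (psi^`()%classic (dotv (D i).2 b) - (D i).1) *: (D i).2.

Variables (alpha gamma rho : R) (bstar : 'cV[R]_d).
Hypotheses (alpha0 : 0 < alpha) (alpha_gamma : alpha <= gamma).
Hypotheses (rho0 : 0 < rho) (rho1 : rho < 1).
Hypothesis rhoE : (gamma - alpha) / (gamma + alpha) <= rho.
Hypothesis eta0E : eta0 = 2 / (alpha + gamma).
Hypothesis bstarb : l2norm bstar <= b0.
Hypothesis hH : forall b : 'cV[R]_d, l2ball b0 b ->
  let H := empirical_hessian psi chi L (fun i => (D i).2) b in
  loewner_le alpha%:M H /\ loewner_le H gamma%:M.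
Hypothesis hx : forall i, l2norm (D i).2 <= Lx.
Hypothesis hy : forall i, `|(D i).1| <= r.
Hypothesis hL : forall i, `|dotv (D i).2 bstar| <= L.
Hypothesis L1 : 1 <= L.

(** The hypotheses on the records make both clippings the identity; projection does not increase the
    distance to [bstar], and the step splits into a contraction of [b - bstar] and the displacement
    of [bstar] itself. *)
Lemma noisy_pgd_step t : l2norm (pgd t.+1 - bstar) <=
  rho * l2norm (pgd t - bstar) + (eta0 * l2norm (score bstar) + l2norm (w t)).
Proof.
have eta00 : 0 <= eta0.
  by rewrite eta0E divr_ge0// addr_ge0 ?(ltW alpha0)// (le_trans (ltW alpha0)).
rewrite /= -/(noisy_pgd psi chi b0 eta0 r Lx L 0 D w t).
set b := noisy_pgd _ _ _ _ _ _ _ _ _ _ _.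
have bb : l2norm b <= b0 by exact: noisy_pgd_ball.
pose gs := grad_step psi chi L (fun i => (D i).2) (fun i => (D i).1) eta0.
rewrite [X in proj_ball b0 X](_ : _ = gs b + w t); last first.
  rewrite /gs /grad_step; congr (_ - _ *: _ + _); apply: eq_bigr => i _.
  by rewrite clip2_id ?hx// proj_itv_id ?hy.
apply: (le_trans (proj_ball_contract _ (ltW b00) bstarb)).
(* Only at [bstar] is saturation known to be inactive; elsewhere the Hessian bounds concern the
   saturated loss itself. *)
have gsE : gs bstar - bstar = - (eta0 *: score bstar).
  rewrite /gs /grad_step addrAC subrr add0r /score scalerA; congr (- (_ *: _)).
  by apply: eq_bigr => i _; rewrite (dpsi_satE hpsi hchi L1)// hL.
have -> : gs b + w t - bstar = (gs b - gs bstar) + ((gs bstar - bstar) + w t).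
  by rewrite addrA addrA subrK addrAC.
rewrite (le_trans (l2normD _ _))// lerD//.
  apply: le_trans (_ : (gamma - alpha) / (gamma + alpha) * l2norm (b - bstar) <= _).
    exact: (grad_step_contract hpsi hchi _ alpha0 alpha_gamma eta0E hH bb bstarb).
  by rewrite ler_wpM2r ?l2norm_ge0.
by rewrite (le_trans (l2normD _ _))// lerD// gsE l2normN l2normZ ger0_norm.
Qed.

(* Convexity of the square: (rho D + e)^2 <= rho D^2 + e^2 / (1 - rho). *)
Lemma noisy_pgd_sqr_bound t : l2norm (pgd t - bstar) ^+ 2 <=
  rho ^+ t * b0 ^+ 2 + \sum_(s < t) rho ^+ (t - s.+1) *
    (2 / (1 - rho) * (eta0 ^+ 2 * l2norm (score bstar) ^+ 2 + l2norm (w s) ^+ 2)).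
Proof.
pose c (s : nat) :=
  2 / (1 - rho) * (eta0 ^+ 2 * l2norm (score bstar) ^+ 2 + l2norm (w s) ^+ 2).
suff : l2norm (pgd t - bstar) ^+ 2 <=
  rho ^+ t * b0 ^+ 2 + \sum_(s < t) rho ^+ (t - s.+1) * c s by [].
elim: t => [|t IH].
  rewrite big_ord0 addr0 expr0 mul1r /= sub0r l2normN.
  by rewrite lerXn2r ?nnegrE ?l2norm_ge0// ltW.
rewrite big_ord_recr/= subnn expr0 mul1r.
have step : l2norm (pgd t.+1 - bstar) ^+ 2 <=
    rho * l2norm (pgd t - bstar) ^+ 2 + c t.
  have := noisy_pgd_step t; rewrite /c.
  set D1 := l2norm _; set D0 := l2norm (_ t - _).
  set g := l2norm (score _); set e := l2norm (w t) => h.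
  have D10 : 0 <= D1 by exact: l2norm_ge0.
  have : D1 ^+ 2 <= (rho * D0 + (eta0 * g + e)) ^+ 2.
    by rewrite lerXn2r ?nnegrE ?(le_trans D10 h)//.
  move=> h2; apply: (le_trans h2).
  have q0 : 0 < 1 - rho by rewrite subr_gt0.
  set f := eta0 * g + e.
  have : 0 <= rho * ((1 - rho) * D0 - f) ^+ 2 / (1 - rho).
    by apply: divr_ge0; [apply: mulr_ge0; [exact: ltW|exact: sqr_ge0]|exact: ltW].
  have -> : rho * ((1 - rho) * D0 - f) ^+ 2 / (1 - rho) =
      rho * D0 ^+ 2 + f ^+ 2 / (1 - rho) - (rho * D0 + f) ^+ 2.
    by field; rewrite gt_eqF.
  have : f ^+ 2 / (1 - rho) <= 2 / (1 - rho) * (eta0 ^+ 2 * g ^+ 2 + e ^+ 2).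
    rewrite [leRHS]mulrAC ler_pM2r ?invr_gt0// /f.
    by have := sqr_ge0 (eta0 * g - e); rewrite -exprMn sqrrB sqrrD; lra.
  lra.
apply: (le_trans step); rewrite [leRHS]addrA lerD2r (exprS rho t) -[rho * _ * _]mulrA.
apply: (@le_trans _ _ (rho * (rho ^+ t * b0 ^+ 2 + \sum_(s < t) rho ^+ (t - s.+1) * c s))).
  by rewrite ler_wpM2l// ltW.
rewrite mulrDr lerD2l mulr_sumr ler_sum// => s _.
by rewrite mulrA -exprS subSn.
Qed.

End noisy_pgd.

(** * Gaussian translations and the Gaussian mechanism *)

Section gaussian_shift.
Context {R : realType}.
Local Notation leb := (@lebesgue_measure R).

Lemma lebesgue_measure_shift (a : R) (A : set R) : measurable A ->
  leb ((fun x => x + a) @^-1` A) = leb A.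
Proof.
move=> mA.
have ms : measurable_fun [set: measurableTypeR R] (fun x : R => x + a).
  exact: measurable_funD.
transitivity (pushforward leb (fun x => x + a : measurableTypeR R) A) => //.
apply/esym/lebesgue_measure_unique => //= _ [[l u]] _ <-; rewrite /pushforward.
rewrite (_ : _ @^-1` _ = `]l - a, u - a]%classic); last first.
  by apply/seteqP; split=> x /=; rewrite !in_itv/= ltrBlDr lerBrDr.
rewrite !lebesgue_measure_itv/= !lte_fin ltrD2r.
by case: ifP => // _; rewrite -!EFinB; congr EFin; ring.
Qed.

Lemma ge0_integral_shift (a : R) (f : R -> R) : (forall x, 0 <= f x) ->
  measurable_fun [set: R] f ->
  (\int[leb]_x (f (x + a))%:E = \int[leb]_x (f x)%:E)%E.
Proof.
move=> f0 mf.
have ms : measurable_fun [set: measurableTypeR R] (fun x : R => x + a).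
  exact: measurable_funD.
transitivity (\int[pushforward leb (fun x : R => (x + a)%R : measurableTypeR R)]_x (f x)%:E)%E.
  by rewrite ge0_integral_pushforward//; [exact/measurable_EFinP|move=> y _; rewrite lee_fin f0].
by apply: eq_measure_integral => A mA _; exact: lebesgue_measure_shift.
Qed.

Variable s : R.
Hypothesis s0 : 0 < s.

Lemma ge0_integral_normal (f : R -> R) : (forall x, 0 <= f x) ->
  measurable_fun [set: R] f ->
  (\int[normal_prob 0 s]_x (f x)%:E = \int[leb]_x (f x * normal_pdf 0 s x)%:E)%E.
Proof.
move=> f0 mf.
rewrite (eq_measure_integral (density leb (normal_pdf_ge0 0 s) (measurable_normal_pdf 0 s)))//.
rewrite ge0_integral_density//.
  by apply/measurable_EFinP.
Qed.

Lemma normal_pdf_shift (a x : R) : normal_pdf 0 s (x - a) =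
  expR (a * x / s ^+ 2 - a ^+ 2 / (2 * s ^+ 2)) * normal_pdf 0 s x.
Proof.
rewrite /normal_pdf gt_eqF// /normal_fun mulrCA; congr (_ * _).
rewrite -expRD; congr expR; rewrite !subr0 -mulr_natl.
by field; rewrite gt_eqF.
Qed.

Lemma normal_prob_shift (a : R) (f : R -> R) : (forall x, 0 <= f x) ->
  measurable_fun [set: R] f ->
  (\int[normal_prob 0 s]_x (f (x + a))%:E =
   \int[normal_prob 0 s]_x
     (f x * expR (a * x / s ^+ 2 - a ^+ 2 / (2 * s ^+ 2)))%:E)%E.
Proof.
move=> f0 mf.
have me : measurable_fun [set: R]
    (fun x => expR (a * x / s ^+ 2 - a ^+ 2 / (2 * s ^+ 2))).
  apply: measurableT_comp => //; apply: measurable_funB => //.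
  by apply: measurable_funM => //; exact: measurable_funM.
have mpdf (b : R) : measurable_fun [set: R] (fun x => normal_pdf 0 s (x - b)).
  apply: (measurableT_comp (measurable_normal_pdf 0 s)).
  exact: measurable_funB.
rewrite ge0_integral_normal//; last first.
  by apply: (measurableT_comp mf); exact: measurable_funD.
rewrite ge0_integral_normal; [|by move=> x; rewrite mulr_ge0// expR_ge0|
  exact: measurable_funM].
rewrite -(@ge0_integral_shift a (fun x => f x * _ * _)); last 2 first.
- by move=> x; rewrite !mulr_ge0 ?expR_ge0// normal_pdf_ge0.
- apply: measurable_funM; first exact: measurable_funM.
  exact: measurable_normal_pdf.
apply: eq_integral => x _; congr EFin; rewrite -mulrA -normal_pdf_shift.
by rewrite addrK.
Qed.

(** Translation by [l s^2] has density [exp (l x - l^2 s^2 / 2)], and its total mass is [1]. *)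
Lemma normal_prob_mgf (l : R) :
  (\int[normal_prob 0 s]_x (expR (l * x))%:E = (expR (l ^+ 2 * s ^+ 2 / 2))%:E)%E.
Proof.
have := @normal_prob_shift (l * s ^+ 2) (fun=> 1 : R) (fun=> ler01) (measurable_cst (1 : R)).
have -> : (\int[normal_prob 0 s]_x (1 : R)%:E = 1)%E.
  by rewrite integral_cst// mul1e; exact: probability_setT.
move=> h.
transitivity (\int[normal_prob 0 s]_x (expR (l ^+ 2 * s ^+ 2 / 2) *
    (1 * expR (l * s ^+ 2 * x / s ^+ 2 - (l * s ^+ 2) ^+ 2 / (2 * s ^+ 2))))%:E)%E.
  apply: eq_integral => x _; congr EFin; rewrite mul1r -expRD; congr expR.
  by field; rewrite gt_eqF.
rewrite integralZl_nneg; [|exact: expR_ge0|by move=> x; rewrite mul1r expR_ge0|].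
  by rewrite -h mule1.
apply: measurable_funM => //; apply: measurableT_comp => //; apply: measurable_funB => //.
by apply: measurable_funM => //; exact: measurable_funM.
Qed.

End gaussian_shift.

Section gaussian_vector.
Context d' (W : measurableType d') (R : realType) (Q : probability W R).
Variables (d : nat) (U : W -> 'cV[R]_d) (v : R).
Hypotheses (mU : measurable_fun [set: W] U) (v0 : 0 < v).
Hypothesis indU : mutually_independent Q (fun (j : 'I_d) o => U o j 0).
Hypothesis lawU : forall (j : 'I_d) (B : set R), measurable B ->
  Q [set o | B (U o j 0)] = normal_prob 0 (Num.sqrt v) B.

Let s := Num.sqrt v.
Let s0 : 0 < s. Proof. by rewrite sqrtr_gt0. Qed.
Let s2 : s ^+ 2 = v. Proof. by rewrite sqr_sqrtr// ltW. Qed.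

Let mUj j : measurable_fun [set: W] (fun o => U o j 0).
Proof. exact: (measurableT_comp (measurable_mx_entry j 0)). Qed.

Lemma gaussian_coord_integral j (f : R -> R) : (forall x, 0 <= f x) ->
  measurable_fun [set: R] f ->
  (\int[Q]_o (f (U o j 0))%:E = \int[normal_prob 0 s]_x (f x)%:E)%E.
Proof.
move=> f0 mf.
have mY : measurable_fun [set: W] ((fun o => U o j 0) : W -> measurableTypeR R).
  exact: mUj.
pose Y : {mfun W >-> measurableTypeR R} := HB.pack (fun o => U o j 0)
  (isMeasurableFun.Build _ _ _ _ _ mY).
transitivity (\int[distribution Q Y]_x (f x)%:E)%E.
  by rewrite ge0_integral_distribution//; exact/measurable_EFinP.
by apply: eq_measure_integral => A mA _; exact: lawU.
Qed.

Lemma gaussian_vector_mgf (a : 'cV[R]_d) (l : R) :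
  (\int[Q]_o (expR (l * dotv a (U o)))%:E = (expR (l ^+ 2 * (v * dotv a a) / 2))%:E)%E.
Proof.
have me j : measurable_fun [set: R] (fun x => expR (l * a j 0 * x)).
  by apply: measurableT_comp => //; exact: measurable_funM.
rewrite (eq_integral (fun o => (\prod_j (fun x => expR (l * a j 0 * x)) (U o j 0))%:E)).
  rewrite (independent_integral_prod (f := fun j x => expR (l * a j 0 * x))
    (e := fun j => expR ((l * a j 0) ^+ 2 * v / 2)) indU mUj)//.
    rewrite -expR_sum; congr (expR _)%:E; rewrite dotvE !mulr_sumr mulr_suml.
    by apply: eq_bigr => j _; ring.
  by move=> j; rewrite (gaussian_coord_integral j _ (me j))// normal_prob_mgf// s2.
move=> o _; congr EFin; rewrite -expR_sum dotvE mulr_sumr; congr expR.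
by apply: eq_bigr => j _; rewrite mulrA.
Qed.

Lemma gaussian_sqr_norm : (\int[Q]_o (l2norm (U o) ^+ 2)%:E <= (d%:R * (8 * v))%:E)%E.
Proof.
under eq_integral do rewrite sqr_l2norm dotvE.
rewrite integral_sum_nneg => [|j o|j]; [|by rewrite -expr2 sqr_ge0|
  exact: measurable_funM].
apply: (@le_trans _ _ (\sum_(j < d) (8 * v)%:E)%E).
  apply: lee_sum => j _; under eq_integral do rewrite -expr2.
  apply: subgaussian_sqr => // l.
  have me : measurable_fun [set: R] (fun x => expR (l * x)).
    by apply: measurableT_comp => //; exact: measurable_funM.
  by rewrite (gaussian_coord_integral j _ me)// normal_prob_mgf// s2.
by rewrite sumEFin lee_fin sumr_const card_ord [leRHS]mulr_natl.
Qed.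

Let tilt (a : 'cV[R]_d) (u : 'cV[R]_d) := expR (dotv a u / v - dotv a a / (2 * v)).

Let mtilt a : measurable_fun [set: W] (fun o => tilt a (U o)).
Proof.
rewrite /tilt; apply: (measurableT_comp (@measurable_expR R)) => //; apply: measurable_funB => //.
by apply: measurable_funM => //; exact: (measurableT_comp (measurable_dotl a)).
Qed.

(** The translated law and the tilted law agree on boxes, where independence factorizes both into
    one-dimensional translations. *)
Lemma cameron_martin (a : 'cV[R]_d) (f : 'cV[R]_d -> R) : (forall u, 0 <= f u) ->
  measurable_fun [set: 'cV[R]_d] f ->
  (\int[Q]_o (f (U o + a))%:E = \int[Q]_o (f (U o) * tilt a (U o))%:E)%E.
Proof.
move=> f0 mf.
have mUa : measurable_fun [set: W] (fun o => U o + a) by exact: measurable_addv.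
have tilt0 o : 0 <= tilt a (U o) by exact: expR_ge0.
transitivity (\int[pushforward Q (fun o => (U o + a)%R)]_u (f u)%:E)%E.
  by rewrite ge0_integral_pushforward//; [exact/measurable_EFinP|move=> y _; rewrite lee_fin f0].
transitivity (\int[pushforward (density Q tilt0 (mtilt a)) U]_u (f u)%:E)%E; last first.
  rewrite ge0_integral_pushforward//; [|exact/measurable_EFinP|
    by move=> y _; rewrite lee_fin f0].
  rewrite preimage_setT ge0_integral_density/=; [|by move=> o; rewrite lee_fin|
    by apply/measurable_EFinP; exact: measurableT_comp].
  by apply: eq_integral => o _; rewrite EFinM.
apply: eq_measure_integral => A mA _.
apply: mx_measure_unique => //.
  rewrite /= /pushforward preimage_setT.
  by apply: (@le_lt_trans _ _ 1%E); [exact: probability_le1|exact: ltry].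
move=> B mB; rewrite /= /pushforward.
pose g (j : 'I_d) (x : R) : R := \1_(B j 0) x *
  expR (a j 0 * x / s ^+ 2 - a j 0 ^+ 2 / (2 * s ^+ 2)).
pose e (j : 'I_d) : R := fine (Q [set o | B j 0 (U o j 0 + a j 0)]).
have mBa j : measurable [set o | B j 0 (U o j 0 + a j 0)].
  have m : measurable_fun [set: W] (fun o => U o j 0 + a j 0) by exact: measurable_funD.
  by rewrite -[X in measurable X]setTI; exact: (m _ _ (mB j 0)).
have mexp j : measurable_fun [set: R]
    (fun x : R => expR (a j 0 * x / s ^+ 2 - a j 0 ^+ 2 / (2 * s ^+ 2))).
  apply: measurableT_comp => //; apply: measurable_funB => //.
  by apply: measurable_funM => //; exact: measurable_funM.
have mind j : measurable_fun [set: R] (\1_(B j 0) : R -> R).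
  exact: measurable_indic.
have g0 j x : 0 <= g j x by rewrite mulr_ge0 ?expR_ge0// indicE.
have mg j : measurable_fun [set: R] (g j).
  by apply: measurable_funM.
have ge j : (\int[Q]_o (g j (U o j 0))%:E = (e j)%:E)%E.
  have i0 (x : R) : 0 <= \1_(B j 0) x :> R by rewrite indicE.
  have mi : measurable_fun [set: R] (fun x : R => \1_(B j 0) (x + a j 0) : R).
    by apply: (measurableT_comp (mind j)); exact: measurable_funD.
  rewrite (gaussian_coord_integral j (g0 j) (mg j)) -(normal_prob_shift s0 _ i0 (mind j)).
  rewrite fineK ?fin_num_measure// -(gaussian_coord_integral j _ mi)//.
  transitivity (\int[Q]_o (\1_[set o | B j 0 (U o j 0 + a j 0)] o)%:E)%E => //.
  by rewrite integral_indic// setIT.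
have boxE : mx_box B = [set u : 'cV[R]_d | forall j, B j 0 (u j 0)].
  by apply/seteqP; split=> u /= h; [move=> j; exact: h|move=> j k; rewrite ord1].
transitivity (\int[Q]_o (\prod_j g j (U o j 0))%:E)%E.
  rewrite (independent_integral_prod indU mUj g0 mg ge) -prodEFin boxE.
  pose B' j : set R := (fun x => x + a j 0) @^-1` B j 0.
  have mB' j : measurable (B' j).
    have m : measurable_fun [set: R] (fun x : R => x + a j 0) by exact: measurable_funD.
    by rewrite -[X in measurable X]setTI; exact: (m _ _ (mB j 0)).
  rewrite (_ : _ @^-1` _ = [set o | forall j, B' j (U o j 0)]); last first.
    by apply/seteqP; split=> o /= h j; have := h j; rewrite /B'/= mxE.
  rewrite (indU mB'); apply: eq_bigr => j _.
  by rewrite /e fineK// fin_num_measure.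
rewrite boxE /density integral_mkcond; apply: eq_integral => o _.
have tiltE : tilt a (U o) =
    \prod_j expR (a j 0 * U o j 0 / s ^+ 2 - a j 0 ^+ 2 / (2 * s ^+ 2)).
  rewrite -expR_sum /tilt !dotvE s2 !mulr_suml -sumrB; congr expR.
rewrite patchE; case: ifPn => [|]; rewrite ?notin_setE ?inE /= => ho.
  rewrite tiltE; congr EFin; apply: eq_bigr => j _.
  by rewrite /g indicE mem_set ?mul1r//; exact: ho.
have [j hj] : exists j, ~ B j 0 (U o j 0) by apply/existsNP.
by rewrite (bigD1 j)//= /g indicE memNset// !mul0r.
Qed.

(** Where the likelihood ratio [tilt] is at least [exp (- eps)], the integrand is at most [exp eps]
    times the tilted one. The remaining event is a half-space for [<a, U>], whose probability a
    Chernoff bound turns into the additive term. *)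
Lemma gaussian_mechanism (a : 'cV[R]_d) (f : 'cV[R]_d -> R) (eps D2 : R) :
  (forall u, 0 <= f u <= 1) -> measurable_fun [set: 'cV[R]_d] f ->
  0 < eps -> 0 < D2 -> dotv a a <= D2 ->
  (\int[Q]_o (f (U o))%:E <= (expR eps)%:E * \int[Q]_o (f (U o + a))%:E +
    (expR (- (eps ^+ 2 * v / (2 * D2)) + eps / 2))%:E)%E.
Proof.
move=> f01 mf eps0 D20 aD.
have f0 u : 0 <= f u by have /andP[] := f01 u.
have mfU : measurable_fun [set: W] (fun o => f (U o)) by exact: measurableT_comp.
rewrite cameron_martin//.
(* Minimizes the leading part [l^2 v D2 / 2 - l eps v] of the Chernoff exponent. *)
pose l := eps / D2.
pose t := eps * v - dotv a a / 2.
have mZ : measurable_fun [set: W] (fun o => expR (- l * dotv a (U o))).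
  apply: measurableT_comp => //; apply: measurable_funM => //.
  exact: (measurableT_comp (measurable_dotl a)).
have l0 : 0 <= l by rewrite divr_ge0// ltW.
apply: (@le_trans _ _ (\int[Q]_o (expR eps * (f (U o) * tilt a (U o)) +
    expR (- (l * t)) * expR (- l * dotv a (U o)))%:E)%E).
  apply: le_integral_EFin => //.
  - move=> o; have /andP[g0 g1] := f01 (U o).
    have [h|h] := leP (expR (- eps)) (tilt a (U o)).
      rewrite mulrCA (le_trans (_ : _ <= f (U o) * (expR eps * tilt a (U o))))//.
        rewrite -[leLHS]mulr1 ler_wpM2l// -[leLHS]expR0 -(subrr eps) expRD.
        by rewrite ler_wpM2l ?expR_ge0.
      by rewrite lerDl mulr_ge0 ?expR_ge0.
    rewrite (le_trans g1)// -[leLHS]add0r lerD//.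
      by rewrite !mulr_ge0 ?expR_ge0.
    rewrite -expRD -[leLHS]expR0 ler_expR.
    have -> : - (l * t) + - l * dotv a (U o) = l * (- dotv a (U o) - t) by ring.
    rewrite mulr_ge0// subr_ge0 /t.
    move: h; rewrite /tilt ltr_expR.
    have -> : dotv a (U o) / v - dotv a a / (2 * v) = (dotv a (U o) - dotv a a / 2) / v.
      by field; rewrite gt_eqF.
    by rewrite ltr_pdivrMr// mulNr; lra.
  - apply: measurable_funD; apply: measurable_funM => //.
    exact: measurable_funM.
rewrite integralD_nneg; [|by move=> o; rewrite !mulr_ge0 ?expR_ge0|
  by move=> o; rewrite mulr_ge0 ?expR_ge0| |exact: measurable_funM]; last first.
  by apply: measurable_funM => //; exact: measurable_funM.
rewrite integralZl_nneg; [|exact: expR_ge0|by move=> o; rewrite mulr_ge0 ?expR_ge0|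
  exact: measurable_funM].
rewrite leeD2l// integralZl_nneg; [|exact: expR_ge0|by move=> o; exact: expR_ge0|by []].
rewrite gaussian_vector_mgf -EFinM -expRD lee_fin ler_expR /t sqrrN.
have -> : - (eps ^+ 2 * v / (2 * D2)) + eps / 2 =
    l ^+ 2 * v * D2 / 2 - l * (eps * v) + l * D2 / 2.
  by rewrite /l; field; rewrite gt_eqF.
have : l ^+ 2 * v / 2 * dotv a a <= l ^+ 2 * v / 2 * D2.
  by rewrite ler_wpM2l// divr_ge0// mulr_ge0 ?sqr_ge0// ltW.
have := ler_wpM2l l0 aD.
rewrite mulrBr; lra.
Qed.

End gaussian_vector.

(** Indices outside the image of [g] receive the full set, which contributes the factor [1]. *)
Lemma mutually_independent_sub d d' (T : measurableType d) (T' : measurableType d')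
    (R : realType) (P : probability T R) (I J : finType) (X : I -> T -> T')
    (g : J -> I) : injective g ->
  mutually_independent P X -> mutually_independent P (X \o g).
Proof.
move=> ginj indX A mA.
pose B i := if [pick j | g j == i] is Some j then A j else setT.
have Bg j : B (g j) = A j.
  by rewrite /B; case: pickP => [k /eqP/ginj -> //|/(_ j)]; rewrite eqxx.
have BT i : (forall j, g j != i) -> B i = setT.
  by rewrite /B; case: pickP => [k /eqP <- /(_ k)|//]; rewrite eqxx.
have mB i : measurable (B i) by rewrite /B; case: pickP.
rewrite (_ : [set w | _] = [set w | forall i, B i (X i w)]); last first.
  apply/seteqP; split=> w /= h => [i|j]; last by have := h (g j); rewrite Bg.
  by rewrite /B; case: pickP => // j /eqP <-; exact: h.
rewrite indX// (bigID (fun i => i \in codom g))/= [X in (_ * X)%E]big1 ?mule1; last first.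
  move=> i ig; rewrite BT ?preimage_setT ?probability_setT// => j.
  by apply: contraNneq ig => <-; exact: codom_f.
rewrite -big_uniq/=; last by rewrite map_inj_uniq// enum_uniq.
by rewrite big_image/=; apply: eq_bigr => j _; rewrite Bg.
Qed.

(** * Measurability of the iterates and independence of fresh noise *)

Section pgd_measurability.
Context {R : realType} d' (T : measurableType d') (d n : nat).

Lemma measurable_clip2 (L : R) (x : T -> 'cV[R]_d) : measurable_fun [set: T] x ->
  measurable_fun [set: T] (fun z => clip2 L (x z)).
Proof.
move=> mx; apply: measurable_scalev => //; apply: measurable_minr => //.
apply: measurable_funM => //.
rewrite (_ : (fun _ => _) = fun z => l2norm (x z) `^ (-1)); last first.
  by apply/funext => z; rewrite powR_inv1// l2norm_ge0.
apply: (@measurableT_comp _ _ _ _ _ _ (fun u : R => u `^ (-1))) => //.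
exact: measurable_l2norm.
Qed.

Lemma measurable_proj_ball (r : R) (x : T -> 'cV[R]_d) : 0 <= r ->
  measurable_fun [set: T] x -> measurable_fun [set: T] (fun z => proj_ball r (x z)).
Proof.
by move=> r0 mx; under eq_fun do rewrite proj_ballE//; exact: measurable_clip2.
Qed.

Lemma measurable_proj_itv (r : R) (x : T -> R) : 0 <= r ->
  measurable_fun [set: T] x -> measurable_fun [set: T] (fun z => proj_itv r (x z)).
Proof.
move=> r0 mx; under eq_fun do rewrite proj_itvE//.
by apply: measurable_maxr => //; apply: measurable_minr.
Qed.

Variables (psi chi : R -> R) (c2 c3 : R).
Hypotheses (hpsi : link_assumption psi c2 c3) (hchi : cutoff chi).
Variables (b0 eta0 r Lx L : R).
Hypotheses (b00 : 0 <= b0) (r0 : 0 <= r).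

(** The only way in which the data enter an iteration; the privacy of one step compares its values
    for two data sets. *)
Definition pgd_drift (D : 'I_n -> R * 'cV[R]_d) (b : 'cV[R]_d) : 'cV[R]_d :=
  b - (eta0 / n%:R) *: (\sum_(i < n)
    (dpsi_sat psi chi L (dotv (clip2 Lx (D i).2) b) - proj_itv r (D i).1) *:
      clip2 Lx (D i).2).

Lemma noisy_pgdS D w t : noisy_pgd psi chi b0 eta0 r Lx L 0 D w t.+1 =
  proj_ball b0 (pgd_drift D (noisy_pgd psi chi b0 eta0 r Lx L 0 D w t) + w t).
Proof. by []. Qed.

Lemma measurable_pgd_drift (D : T -> 'I_n -> R * 'cV[R]_d) (b : T -> 'cV[R]_d) :
  (forall i, measurable_fun [set: T] (fun z => D z i)) -> measurable_fun [set: T] b ->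
  measurable_fun [set: T] (fun z => pgd_drift (D z) (b z)).
Proof.
move=> mD mb.
have mD2 i : measurable_fun [set: T] (fun z => (D z i).2).
  exact: (measurableT_comp measurable_snd).
have mD1 i : measurable_fun [set: T] (fun z => (D z i).1).
  exact: (measurableT_comp measurable_fst).
apply: measurable_addv => //; apply: measurable_oppv; apply: measurable_scalev => //.
apply: measurable_sumv => i; apply: measurable_scalev; last exact: measurable_clip2.
apply: measurable_funB; last exact: measurable_proj_itv.
apply: (measurableT_comp (continuous_measurable_fun (continuous_dpsi_sat hpsi hchi (L := L)))).
by apply: measurable_dotv => //; exact: measurable_clip2.
Qed.

Lemma measurable_noisy_pgd (D : T -> 'I_n -> R * 'cV[R]_d) (w : nat -> T -> 'cV[R]_d) t :
  (forall i, measurable_fun [set: T] (fun z => D z i)) ->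
  (forall s, measurable_fun [set: T] (w s)) ->
  measurable_fun [set: T]
    (fun z => noisy_pgd psi chi b0 eta0 r Lx L 0 (D z) (fun s => w s z) t).
Proof.
move=> mD mw; elim: t => [|t IH]; first exact: measurable_cst.
apply: measurable_proj_ball => //; apply: measurable_addv => //.
exact: measurable_pgd_drift.
Qed.

Lemma eq_noisy_pgd (D : 'I_n -> R * 'cV[R]_d) (w w' : nat -> 'cV[R]_d) t :
  (forall s, (s < t)%N -> w s = w' s) ->
  noisy_pgd psi chi b0 eta0 r Lx L 0 D w t = noisy_pgd psi chi b0 eta0 r Lx L 0 D w' t.
Proof.
elim: t => [//|t IH ww']; rewrite !noisy_pgdS IH ?ww'// => s st.
by apply: ww'; rewrite ltnS ltnW.
Qed.

End pgd_measurability.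

Section noise_independence.
Context dW (W : measurableType dW) (R : realType) (Q : probability W R).
Variables (d T : nat) (w : nat -> {mfun W >-> 'cV[R]_d}) (v : R).
Hypothesis hw : gaussian_noise Q w T v.

Lemma noise_coord_law t (tT : (t < T)%N) (j : 'I_d) (B : set R) : measurable B ->
  Q [set o | B (w t o j 0)] = normal_prob 0 (Num.sqrt v) B.
Proof. by move=> mB; exact: (hw.2 (Ordinal tT) j B mB). Qed.

Lemma noise_coord_independent t : (t < T)%N ->
  mutually_independent Q (fun (j : 'I_d) o => w t o j 0).
Proof.
move=> tT; apply: (mutually_independent_sub (g := fun j : 'I_d => (Ordinal tT, j)) _ hw.1).
by move=> j k [].
Qed.

(** The first [t] noise vectors form a single matrix so that [mx_box_independent] applies to the
    past and the present. *)
Definition past_noise t (o : W) : 'M[R]_(t, d) := \matrix_(i < t, j < d) w i o j 0.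

Lemma measurable_past_noise t : measurable_fun [set: W] (past_noise t).
Proof.
apply: measurable_mx_fun => i j; rewrite /past_noise; under eq_fun do rewrite mxE.
by apply: (measurableT_comp (measurable_mx_entry j 0)).
Qed.

Lemma past_noise_independent t : (t < T)%N ->
  forall A B, measurable A -> measurable B ->
  (Q (past_noise t @^-1` A `&` w t @^-1` B) =
   Q (past_noise t @^-1` A) * Q (w t @^-1` B))%E.
Proof.
move=> tT; apply: mx_box_independent => [||A B mA mB].
- exact: measurable_past_noise.
- by [].
pose CA (p : 'I_T * 'I_d) : set R :=
  if (insub (p.1 : nat) : option 'I_t) is Some i then A i p.2 else setT.
pose CB (p : 'I_T * 'I_d) : set R := if (p.1 == t :> nat) then B p.2 0 else setT.
have mCA p : measurable (CA p) by rewrite /CA; case: insub.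
have mCB p : measurable (CB p) by rewrite /CB; case: ifP.
(* Past and present constrain disjoint sets of coordinates, so the product over all coordinates
   splits. *)
have disj p : CA p = setT \/ CB p = setT.
  rewrite /CA /CB; case: insubP => [i it iE|_]; last by left.
  by right; rewrite ifF//; apply/negbTE; rewrite -iE neq_ltn ltn_ord.
have EA : past_noise t @^-1` mx_box A = [set o | forall p, CA p (w p.1 o p.2 0)].
  apply/seteqP; split=> o /= h.
    move=> [i j]; rewrite /CA/=; case: insubP => [k kt kE|//].
    by have := h k j; rewrite mxE kE.
  move=> i j; rewrite mxE.
  have iT : (i < T)%N by exact: ltn_trans tT.
  by have := h (Ordinal iT, j); rewrite /CA/= valK.
have EB : w t @^-1` mx_box B = [set o | forall p, CB p (w p.1 o p.2 0)].
  apply/seteqP; split=> o /= h.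
    by move=> [i j]; rewrite /CB/=; case: eqP => [->|//]; exact: h.
  move=> j k; rewrite ord1.
  by have := h (Ordinal tT, j); rewrite /CB/= eqxx.
have EAB : past_noise t @^-1` mx_box A `&` w t @^-1` mx_box B =
    [set o | forall p, (CA p `&` CB p) (w p.1 o p.2 0)].
  rewrite EA EB; apply/seteqP; split=> o /=.
    by move=> [h1 h2] p; split.
  by move=> h; split=> p; case: (h p).
rewrite EAB (hw.1 (fun p => CA p `&` CB p)); last by move=> p; exact: measurableI.
rewrite EA EB (hw.1 CA)// (hw.1 CB)// -big_split/=.
apply: eq_bigr => p _; have [->|->] := disj p.
  by rewrite setTI preimage_setT probability_setT mul1e.
by rewrite setIT preimage_setT probability_setT mule1.
Qed.

End noise_independence.

(** * Composition of private steps *)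

Section composition.
Context dW (W : measurableType dW) (R : realType) (Q : probability W R).
Variables (d n T : nat) (w : nat -> {mfun W >-> 'cV[R]_d}) (v : R).
Hypotheses (hw : gaussian_noise Q w T v) (v0 : 0 < v).
Variables (psi chi : R -> R) (c2 c3 : R).
Hypotheses (hpsi : link_assumption psi c2 c3) (hchi : cutoff chi).
Variables (b0 eta0 r Lx L : R).
Hypotheses (b00 : 0 <= b0) (r0 : 0 <= r).

Local Notation pgd D o t := (noisy_pgd psi chi b0 eta0 r Lx L 0 D (fun s => w s o) t).
Local Notation drift D b := (@pgd_drift R d n psi chi eta0 r Lx L D b).

Lemma measurable_pgd (D : 'I_n -> R * 'cV[R]_d) t :
  measurable_fun [set: W] (fun o => pgd D o t).
Proof.
by apply: (measurable_noisy_pgd hpsi hchi _ _ _ b00 r0 t (D := fun _ => D)).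
Qed.

Lemma pgd_noise_independent (D : 'I_n -> R * 'cV[R]_d) t : (t < T)%N ->
  forall A B, measurable A -> measurable B ->
  (Q ((fun o => pgd D o t) @^-1` A `&` w t @^-1` B) =
   Q ((fun o => pgd D o t) @^-1` A) * Q (w t @^-1` B))%E.
Proof.
move=> tT A B mA mB.
(* Noise from time [t] on is set to zero; by [eq_noisy_pgd] the iterate at time [t] depends on the
   first [t] vectors only, so it is a measurable function of [past_noise]. *)
pose row (N : 'M[R]_(t, d)) (s : nat) : 'cV[R]_d :=
  \col_j (if (insub s : option 'I_t) is Some i then N i j else 0).
pose Psi N := noisy_pgd psi chi b0 eta0 r Lx L 0 D (row N) t.
have mPsi : measurable_fun [set: 'M[R]_(t, d)] Psi.
  apply: (measurable_noisy_pgd hpsi hchi _ _ _ b00 r0 t (D := fun _ => D)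
    (w := fun s N => row N s)) => // s.
  apply: measurable_mx_fun => j k; rewrite /row; under eq_fun do rewrite mxE.
  by case: insub => [i|]; [exact: measurable_mx_entry|exact: measurable_cst].
have E : (fun o => pgd D o t) = Psi \o past_noise w t.
  apply/funext => o; apply: eq_noisy_pgd => s st; apply/matrixP => j k.
  by rewrite ord1 /row mxE insubT mxE.
have mPA : measurable (Psi @^-1` A) by rewrite -[X in measurable X]setTI; exact: mPsi.
by rewrite E; exact: (past_noise_independent hw tT mPA mB).
Qed.

Lemma pgd_step_integral (D : 'I_n -> R * 'cV[R]_d) (f : 'cV[R]_d -> R) t :
  (t < T)%N -> (forall u, 0 <= f u) -> measurable_fun [set: 'cV[R]_d] f ->
  (\int[Q]_o (f (pgd D o t.+1))%:E =
   \int[Q]_o \int[Q]_o' (f (proj_ball b0 (drift D (pgd D o t) + w t o')))%:E)%E.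
Proof.
move=> tT f0 mf.
pose F (z : 'cV[R]_d * 'cV[R]_d) := (f (proj_ball b0 (drift D z.1 + z.2)))%:E.
transitivity (\int[Q]_o F (pgd D o t, w t o))%E.
  by apply: eq_integral => o _; rewrite /F (noisy_pgdS _ _ _ _ _ _ _ D).
apply: (independent_pair_integral (F := F) (measurable_pgd D t)) => //.
- exact: pgd_noise_independent.
- by move=> z; rewrite lee_fin.
- apply/measurable_EFinP; apply: (measurableT_comp mf).
  apply: measurable_proj_ball => //; apply: measurable_addv => //.
  exact: (measurable_pgd_drift hpsi hchi _ _ _ r0 (D := fun _ => D)).
Qed.

Variables (D D' : 'I_n -> R * 'cV[R]_d) (eps delta D2 : R).
Hypotheses (eps0 : 0 < eps) (D20 : 0 < D2).
Hypothesis hD : forall b, dotv (drift D' b - drift D b) (drift D' b - drift D b) <= D2.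
Hypothesis hdelta : expR (- (eps ^+ 2 * v / (2 * D2)) + eps / 2) <= delta.

(* Privacy is propagated for test functions with values in [0, 1]; the one-step
   bound is truncated at 1 so that it is again such a test function. *)
Lemma pgd_privacy t (f : 'cV[R]_d -> R) : (t <= T)%N ->
  (forall u, 0 <= f u <= 1) -> measurable_fun [set: 'cV[R]_d] f ->
  (\int[Q]_o (f (pgd D o t))%:E <= (expR (t%:R * eps))%:E *
    \int[Q]_o (f (pgd D' o t))%:E + (t%:R * delta)%:E)%E.
Proof.
have delta0 : 0 <= delta by apply: le_trans hdelta; exact: expR_ge0.
elim: t f => [|t IH] f tT f01 mf.
  by rewrite !mul0r expR0 mul1e adde0.
have f0 u : 0 <= f u by have /andP[] := f01 u.
have f1 u : f u <= 1 by have /andP[] := f01 u.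
have mg E b : measurable_fun [set: 'cV[R]_d] (fun u => f (proj_ball b0 (drift E b + u))).
  apply: (measurableT_comp mf); apply: measurable_proj_ball => //.
  exact: measurable_addv.
(* Expectation of the test function after one step from [b] with data [E]. *)
pose K E b := (\int[Q]_o (f (proj_ball b0 (drift E b + w t o)))%:E)%E.
have K0 E b : (0 <= K E b)%E by apply: integral_ge0 => o _; rewrite lee_fin.
have K1 E b : (K E b <= 1)%E.
  apply: (@le_trans _ _ (\int[Q]_o (1 : R)%:E)%E).
    apply: le_integral_EFin => //.
    exact: (measurableT_comp (mg E b)).
  by rewrite integral_cst// mul1e; exact: probability_le1.
have Kfin E b : K E b \is a fin_num by rewrite ge0_fin_numE// (le_lt_trans (K1 _ _))// ltry.
have mK E : measurable_fun [set: 'cV[R]_d] (fun b => fine (K E b)).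
  apply: measurableT_comp => //.
  apply: (measurable_fun_fubini_tonelli_F (fun z : 'cV[R]_d * W =>
    (f (proj_ball b0 (drift E z.1 + w t z.2)))%:E)).
    apply/measurable_EFinP; apply: (measurableT_comp mf).
    apply: measurable_proj_ball => //; apply: measurable_addv.
      exact: (measurable_pgd_drift hpsi hchi _ _ _ r0 (D := fun _ => E)).
    by apply: measurableT_comp.
  by move=> z; rewrite lee_fin.
pose k b := Num.min 1 (expR eps * fine (K D' b)).
have k01 b : 0 <= k b <= 1.
  by rewrite ge_min lexx andbT le_min ler01/= mulr_ge0 ?expR_ge0// fine_ge0.
have mk : measurable_fun [set: 'cV[R]_d] k.
  by apply: measurable_minr => //; apply: measurable_funM.
have step b : (K D b <= (k b + delta)%:E)%E.
  have h : (K D b <= (expR eps * fine (K D' b) + delta)%:E)%E.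
    have := gaussian_mechanism (measurable_funP (w t)) v0
      (noise_coord_independent hw tT) (fun j B => noise_coord_law hw tT j (B := B))
      (fun u => f01 _) (mg D b) eps0 D20 (hD b).
    rewrite -/(K D b).
    have -> : (\int[Q]_o (f (proj_ball b0 (drift D b +
        (w t o + (drift D' b - drift D b)))))%:E = K D' b)%E.
      apply: eq_integral => o _; congr (f (proj_ball _ _))%:E.
      by rewrite [w t o + _]addrC addrA [drift D b + (_ - drift D b)]addrC subrK.
    move=> /le_trans; apply; rewrite -[in leLHS](fineK (Kfin D' b)) -EFinM -EFinD.
    by rewrite lee_fin lerD2l.
  rewrite /k minEle; case: ifP => _ //; apply: (le_trans (K1 D b)).
  by rewrite lee_fin lerDl.
(* From here on the iterate enters only through its measurability, the one-step formula and the
   induction hypothesis, so it is made opaque as [X]. *)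
have [X mX [ED IHX]] : exists2 X : ('I_n -> R * 'cV[R]_d) -> W -> 'cV[R]_d,
    forall E, measurable_fun [set: W] (X E) &
    (forall E, \int[Q]_o (f (pgd E o t.+1))%:E = \int[Q]_o K E (X E o))%E /\
    forall g : 'cV[R]_d -> R, (forall u, 0 <= g u <= 1) -> measurable_fun [set: 'cV[R]_d] g ->
      (\int[Q]_o (g (X D o))%:E <= (expR (t%:R * eps))%:E *
        \int[Q]_o (g (X D' o))%:E + (t%:R * delta)%:E)%E.
  exists (fun E o => pgd E o t); first by move=> E; exact: measurable_pgd.
  split; first by move=> E; exact: pgd_step_integral.
  by move=> g; exact: (IH g (ltnW tT)).
have eqle (x y : \bar R) : x = y -> (x <= y)%E by move=> ->.
have kK b : k b <= expR eps * fine (K D' b) by rewrite /k ge_min lexx orbT.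
suff main : (\int[Q]_o K D (X D o) <=
    (expR (t.+1%:R * eps))%:E * \int[Q]_o K D' (X D' o) + (t.+1%:R * delta)%:E)%E.
  apply: (le_trans (eqle _ _ (ED D))); apply: (le_trans main).
  apply: leeD => //; apply: lee_wpmul2l; first by rewrite lee_fin expR_ge0.
  exact: (eqle _ _ (esym (ED D'))).
clearbody k; clearbody K.
apply: (@le_trans _ _ (\int[Q]_o (k (X D o) + delta)%:E)%E).
  apply: ge0_le_integral => //.
  - have := measurableT_comp (mK D) (mX D) => /measurable_EFinP.
    by apply: eq_measurable_fun => o _ /=; rewrite fineK.
  - apply/measurable_EFinP; apply: measurable_funD => //.
    exact: (measurableT_comp mk (mX D)).
have mkp E : measurable_fun [set: W] (fun o => k (X E o)).
  exact: (measurableT_comp mk (mX E)).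
have kp0 E o : 0 <= k (X E o) by have /andP[] := k01 (X E o).
rewrite integralD_nneg// integral_cst//.
(* The induction hypothesis is applied to [k]. Because [k] excludes the [delta] of the current step,
   that [delta] is added once instead of being multiplied by [expR (t%:R * eps)]. *)
apply: (@le_trans _ _ ((expR (t%:R * eps))%:E * \int[Q]_o (k (X D' o))%:E +
    (t%:R * delta)%:E + delta%:E)%E).
  apply: leeD; first exact: IHX.
  by rewrite -[leRHS]mule1 lee_wpmul2l// ?lee_fin// probability_le1.
rewrite -addeA -EFinD.
have -> : t%:R * delta + delta = t.+1%:R * delta by rewrite -natr1 mulrDl mul1r.
rewrite leeD2r// -natr1 mulrDl mul1r expRD EFinM -muleA lee_wpmul2l ?lee_fin ?expR_ge0//.
apply: (@le_trans _ _ (\int[Q]_o (expR eps * fine (K D' (X D' o)))%:E)%E).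
  apply: le_integral_EFin => //.
  - by apply: measurable_funM => //; exact: (measurableT_comp (mK D') (mX D')).
rewrite integralZl_nneg; [|exact: expR_ge0|by move=> o; rewrite fine_ge0|
  exact: (measurableT_comp (mK D') (mX D'))].
rewrite lee_wpmul2l ?lee_fin ?expR_ge0// le_eqVlt; apply/orP; left; apply/eqP.
by apply: eq_integral => o _; rewrite fineK.
Qed.

End composition.

(** * Sensitivity and privacy of the algorithm *)

Section privacy.
Context {R : realType} (d n : nat).
Variables (psi chi : R -> R) (c2 c3 : R).
Hypotheses (hpsi : link_assumption psi c2 c3) (hchi : cutoff chi).
Variables (b0 eta0 r Lx L : R).
Hypotheses (b00 : 0 <= b0) (eta00 : 0 < eta0) (r0 : 0 <= r) (Lx0 : 0 < Lx) (L1 : 1 <= L).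

Local Notation S := (`|psi^`()%classic 0| + 2 * c2 * L).
Local Notation B := (4 * (r + S) * Lx).
Local Notation drift D b := (@pgd_drift R d n psi chi eta0 r Lx L D b).

(** Only one summand of the gradient changes, and each summand has norm at most [(S + r) Lx] by
    saturation and clipping. *)
Lemma pgd_drift_sensitivity (D D' : 'I_n -> R * 'cV[R]_d) b : neighbors D D' ->
  dotv (drift D' b - drift D b) (drift D' b - drift D b) <= (eta0 * B / (2 * n%:R)) ^+ 2.
Proof.
move=> [i hi].
pose g (E : 'I_n -> R * 'cV[R]_d) j := (dpsi_sat psi chi L (dotv (clip2 Lx (E j).2) b)
  - proj_itv r (E j).1) *: clip2 Lx (E j).2.
have -> : drift D' b - drift D b = (eta0 / n%:R) *: (g D i - g D' i).
  have dE E : drift E b = b - (eta0 / n%:R) *: (g E i + \sum_(j < n | j != i) g E j).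
    by rewrite /pgd_drift (bigD1 i).
  rewrite !dE.
  have -> : \sum_(j < n | j != i) g D' j = \sum_(j < n | j != i) g D j.
    by apply: eq_bigr => j ji; rewrite /g hi.
  move: (g D i) (g D' i) (\sum_(_ | _) _) => x y z.
  by apply/matrixP => k l; rewrite !mxE; ring.
have S0 : 0 <= S.
  by rewrite addr_ge0// mulr_ge0 ?(le_trans ler01 L1)// mulr_ge0// ltW// (link_c2_gt0 hpsi).
have gle E : l2norm (g E i) <= (S + r) * Lx.
  rewrite l2normZ ler_pM ?normr_ge0 ?l2norm_ge0 ?(l2norm_clip2_le _ (ltW Lx0))//.
  apply: (le_trans (ler_normB _ _)); apply: lerD.
    by apply: (dpsi_sat_bound hpsi hchi).
  exact: normr_proj_itv_le.
rewrite -sqr_l2norm lerXn2r ?nnegrE ?l2norm_ge0//.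
  apply: divr_ge0; last by rewrite mulr_ge0.
  apply: mulr_ge0; first exact: ltW.
  by apply: mulr_ge0; [rewrite mulr_ge0// addr_ge0|exact: ltW].
rewrite l2normZ ger0_norm; last by rewrite divr_ge0// ltW.
have h : l2norm (g D i - g D' i) <= 2 * ((S + r) * Lx).
  apply: (le_trans (l2normD _ _)); rewrite l2normN mulr2n mulrDl mul1r.
  by apply: lerD; exact: gle.
apply: (le_trans (ler_wpM2l _ h)); first by rewrite divr_ge0// ltW.
rewrite le_eqVlt; apply/orP; left; apply/eqP.
by rewrite invfM; move: (n%:R^-1) => x; field.
Qed.

Variables (dW : measure_display) (W : measurableType dW) (Q : probability W R).
Variables (T : nat) (w : nat -> {mfun W >-> 'cV[R]_d}) (eps delta : R).
Hypotheses (n0 : (0 < n)%N) (T0 : (0 < T)%N) (eps01 : 0 < eps < 1) (delta01 : 0 < delta <= 1).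
Hypothesis hw : gaussian_noise Q w T (noise_var eta0 B eps delta n T).

(** Each step is private at level [(eps / T, delta / T)]; [pgd_privacy] is then applied to the
    indicator of the event. *)
Lemma noisy_pgd_private : differentially_private Q
  (fun (D : 'I_n -> R * 'cV[R]_d) o => noisy_pgd psi chi b0 eta0 r Lx L 0 D (fun t => w t o) T) eps delta.
Proof.
move=> D D' DD' A mA.
have /andP[eps0 eps1] := eps01; have /andP[delta0 delta1] := delta01.
have n0' : 0 < n%:R :> R by rewrite ltr0n.
have T0' : 0 < T%:R :> R by rewrite ltr0n.
have T1 : 1 <= T%:R :> R by rewrite ler1n.
have S0 : 0 < S.
  by rewrite ltr_wpDl// mulr_gt0 ?(lt_le_trans ltr01 L1)// mulr_gt0// (link_c2_gt0 hpsi).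
have [b [Bb b0']] : exists b, B = b /\ 0 < b.
  by exists B; split => //; rewrite mulr_gt0// mulr_gt0// ltr_wpDl.
have arg_ge2 : 2 <= 2 * T%:R / delta.
  by rewrite ler_pdivlMr// ler_pM2l// (le_trans delta1).
have [l [lE l_ge]] : exists l, ln (2 * T%:R / delta) = l /\ 1 / 2 <= l.
  exists (ln (2 * T%:R / delta)); split => //.
  rewrite -[leLHS]expRK ler_ln ?posrE ?expR_gt0 ?(lt_le_trans _ arg_ge2)//.
  exact: le_trans expR_half_le2 arg_ge2.
have hw' := hw; rewrite /noise_var Bb lE in hw'.
have v0 : 0 < eta0 ^+ 2 * (2 * b ^+ 2 * l) / (n%:R ^+ 2 * (eps / T%:R) ^+ 2).
  have l0 : 0 < l by lra.
  by rewrite !(mulr_gt0, invr_gt0, exprn_gt0).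
have e0 : 0 < eps / T%:R by rewrite divr_gt0.
have e1 : eps / T%:R <= 1 by rewrite ler_pdivrMr// mul1r; lra.
have D20 : 0 < (eta0 * b / (2 * n%:R)) ^+ 2.
  by rewrite exprn_gt0// divr_gt0// mulr_gt0.
have hD c : dotv (drift D' c - drift D c) (drift D' c - drift D c) <=
    (eta0 * b / (2 * n%:R)) ^+ 2.
  by rewrite -Bb; exact: pgd_drift_sensitivity.
(* For the prescribed variance the exponent is [- 4 l + eps / (2 T)] with
   [l = ln (2 T / delta) >= 1 / 2], hence at most [- l], and [exp (- l) = delta / (2 T)]. *)
have hdelta : expR (- ((eps / T%:R) ^+ 2 *
    (eta0 ^+ 2 * (2 * b ^+ 2 * l) / (n%:R ^+ 2 * (eps / T%:R) ^+ 2)) /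
    (2 * (eta0 * b / (2 * n%:R)) ^+ 2)) + eps / T%:R / 2) <= delta / T%:R.
  have -> : (eps / T%:R) ^+ 2 *
    (eta0 ^+ 2 * (2 * b ^+ 2 * l) / (n%:R ^+ 2 * (eps / T%:R) ^+ 2)) /
    (2 * (eta0 * b / (2 * n%:R)) ^+ 2) = 4 * l.
    by field; rewrite !gt_eqF.
  apply: (@le_trans _ _ (expR (- l))); first by rewrite ler_expR; lra.
  rewrite -lE expRN lnK ?posrE; last by rewrite (lt_le_trans _ arg_ge2).
  rewrite invf_div ler_pM2l// lef_pV2 ?posrE ?mulr_gt0//; lra.
have := pgd_privacy hw' v0 hpsi hchi b00 r0 e0 D20 hD hdelta (leqnn T)
  (f := \1_A : 'cV[R]_d -> R).
have ee : T%:R * (eps / T%:R) = eps by field; rewrite gt_eqF.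
have dd : T%:R * (delta / T%:R) = delta by field; rewrite gt_eqF.
rewrite ee dd.
have mE E : measurable_fun [set: W]
    (fun o => noisy_pgd psi chi b0 eta0 r Lx L 0 E (fun s => w s o) T).
  by apply: (measurable_noisy_pgd hpsi hchi _ _ _ b00 r0 T (D := fun _ => E)).
have iE E : (\int[Q]_o (\1_A (noisy_pgd psi chi b0 eta0 r Lx L 0 E
    (fun s => w s o) T) : R)%:E = Q ((fun o => noisy_pgd psi chi b0 eta0 r Lx L 0 E
    (fun s => w s o) T) @^-1` A))%E.
  exact: integral_indic_comp.
rewrite !iE; apply.
- by move=> u; rewrite indicE ler0n lern1 leq_b1.
- exact: measurable_indic.
Qed.

End privacy.

(* The chord bound for the convex function exp, as the average of its tangent bounds
   at t a. *)
Lemma expR_chord (R : realType) (t a : R) : 0 <= t <= 1 ->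
  expR (t * a) <= 1 - t + t * expR a.
Proof.
move=> /andP[t0 t1].
have h1 : expR (t * a) * (1 + (1 - t) * a) <= expR a.
  have -> : expR a = expR (t * a) * expR ((1 - t) * a).
    by rewrite -expRD; congr expR; ring.
  by rewrite ler_pM2l ?expR_gt0// expR_ge1Dx.
have h2 : expR (t * a) * (1 - t * a) <= 1.
  have := expR_ge1Dx (- (t * a)); rewrite expRN => h.
  by rewrite -[leRHS](@mulfV _ (expR (t * a))) ?gt_eqF ?expR_gt0// ler_pM2l ?expR_gt0.
nra.
Qed.

(** * Residual tails and mean squared score *)

Section sample.
Context {R : realType} (d n : nat).
Variables (fx : probability 'cV[R]_d R) (nu : {measure set R -> \bar R}).
Variables (psi : R -> R) (h : R -> R -> R) (c : R -> R) (sigma C Kx c2 c3 : R).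
Variables (b : 'cV[R]_d).
Variables (dO : measure_display) (Om : measurableType dO) (P : probability Om R).
Variables (Z : 'I_n -> {mfun Om >-> (R * 'cV[R]_d)%type}).
Hypotheses (hpsi : link_assumption psi c2 c3) (cs0 : 0 < c sigma).
Hypothesis hpdf : forall theta, is_pdf nu (glm_pdf psi h c sigma theta).
Hypotheses (Kx0 : 0 < Kx) (hD : design_assumption fx C Kx).
Hypothesis hZ : glm_sample fx nu psi h c sigma b P Z.

Let dist_integral i (G : R * 'cV[R]_d -> R) : (forall z, 0 <= G z) ->
  measurable_fun [set: R * 'cV[R]_d] G ->
  (\int[P]_o (G (Z i o))%:E = \int[distribution P (Z i)]_z (G z)%:E)%E.
Proof.
by move=> G0 mG; rewrite ge0_integral_distribution//; exact/measurable_EFinP.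
Qed.

Lemma glm_sample_design_integral i (g : 'cV[R]_d -> R) : (forall x, 0 <= g x) ->
  measurable_fun [set: 'cV[R]_d] g ->
  (\int[P]_o (g (Z i o).2)%:E = \int[fx]_x (g x)%:E)%E.
Proof.
move=> g0 mg; rewrite (dist_integral i (G := fun z => g z.2))//; last first.
  exact: measurableT_comp.
exact: (glm_design_integral hpsi cs0 hpdf (hZ.2 i)).
Qed.

Lemma glm_sample_design_independent :
  mutually_independent P (fun i o => (Z i o).2).
Proof.
move=> A mA.
have := hZ.1 (fun i => setT `*` A i) (fun i => measurableX measurableT (mA i)).
rewrite (_ : [set w | forall i, (setT `*` A i) (Z i w)] =
  [set w | forall i, A i (Z i w).2]); last first.
  by apply/seteqP; split=> w /= hw i; [case: (hw i)|split].
by move=> ->; apply: eq_bigr => i _; congr (P _); apply/seteqP; split=> w //= [].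
Qed.

Let mdot : measurable_fun [set: R * 'cV[R]_d] (fun z => dotv z.2 b).
Proof. exact: measurable_dotv. Qed.

Let mres : measurable_fun [set: R * 'cV[R]_d]
  (fun z : R * 'cV[R]_d => z.1 - psi^`()%classic (dotv z.2 b)).
Proof.
apply: measurable_funB => //.
exact: (measurableT_comp (continuous_measurable_fun (continuous_dlink hpsi))).
Qed.

Let v0 : 0 < c2 * c sigma.
Proof. by rewrite mulr_gt0// (link_c2_gt0 hpsi). Qed.

Lemma glm_residual_tail i s : 0 <= s ->
  (P [set o | (s <= `|(Z i o).1 - psi^`()%classic (dotv (Z i o).2 b)|)%R] <=
   (2 * expR (- (s ^+ 2 / (2 * (c2 * c sigma)))))%:E)%E.
Proof.
move=> s0; apply: subgaussian_abs_tail => //.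
  exact: (measurableT_comp mres).
move=> l; rewrite (dist_integral i
  (G := fun z => expR (l * (z.1 - psi^`()%classic (dotv z.2 b))))); first last.
- by apply: (measurableT_comp (@measurable_expR R)); exact: measurable_funM.
- by move=> z; exact: expR_ge0.
apply: (le_trans (glm_mgf_le hpsi cs0 hpdf (hZ.2 i) (measurable_cst l))).
rewrite (eq_integral (cst (expR (l ^+ 2 * (c2 * c sigma) / 2))%:E))// integral_cst//.
by rewrite [X in (_ * X)%E]probability_setT mule1.
Qed.

Let xi (k : 'I_d) (z : R * 'cV[R]_d) := (psi^`()%classic (dotv z.2 b) - z.1) * z.2 k 0.

Let mxi k : measurable_fun [set: R * 'cV[R]_d] (xi k).
Proof.
apply: measurable_funM.
  rewrite (_ : (fun _ => _) = fun z : R * 'cV[R]_d => - (z.1 - psi^`()%classic (dotv z.2 b))).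
    exact: measurable_funN.
  by apply/funext => z; rewrite opprB.
by apply: (measurableT_comp (measurable_mx_entry k 0)).
Qed.

Let S k o := \sum_(i < n) xi k (Z i o).

Let mS k : measurable_fun [set: Om] (S k).
Proof. by apply: measurable_sum => i; exact: (measurableT_comp (mxi k)). Qed.

(** The second moment of the sum is read off from its exponential moments at [l] and [- l], with
    [1 / l^2] of order [n], via [sqr_le_expR]. *)
Lemma score_coord_sqr (k : 'I_d) : (0 < n)%N ->
  (\int[P]_o ((\sum_(i < n) (psi^`()%classic (dotv (Z i o).2 b) - (Z i o).1) *
      (Z i o).2 k 0) ^+ 2)%:E <= (32 * (c2 * c sigma) * Kx ^+ 2 * n%:R)%:E)%E.
Proof.
move=> n_gt0.
have n0 : 0 < n%:R :> R by rewrite ltr0n.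
have mk : measurable_fun [set: 'cV[R]_d] (fun x : 'cV[R]_d => x k 0).
  exact: measurable_mx_entry.
have mSk := mS k; have mxik := mxi k.
have mexp (l : R) : measurable_fun [set: R * 'cV[R]_d] (fun z => expR (l * xi k z)).
  by apply: (measurableT_comp (@measurable_expR R)); exact: measurable_funM.
(* Given [x], the bound for one record is [exp (q / n)] with [q = (x k / (2 Kx))^2]. The chord bound
   replaces it by [1 - 1/n + exp q / n], of mean at most [1 + 1/n], and the product over the records
   is at most [e]. *)
have mgf (l : R) : l ^+ 2 * (2 * (c2 * c sigma) * Kx ^+ 2 * n%:R) = 1 ->
    (\int[P]_o (expR (l * S k o))%:E <= 4%:E)%E.
  move=> lE.
  have h1 i : (\int[P]_o (expR (l * xi k (Z i o)))%:E <= (1 + n%:R^-1)%:E)%E.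
    rewrite (dist_integral i (G := fun z => expR (l * xi k z))); [|by move=> z; exact: expR_ge0|by []].
    have mg : measurable_fun [set: 'cV[R]_d] (fun x : 'cV[R]_d => - l * x k 0).
      exact: measurable_funM.
    have := glm_mgf_le hpsi cs0 hpdf (hZ.2 i) mg.
    rewrite (eq_integral (fun z => (expR (l * xi k z))%:E)); last first.
      by move=> z _; congr (expR _)%:E; rewrite /xi; ring.
    move=> /le_trans; apply.
    apply: (@le_trans _ _ (\int[fx]_x ((1 - n%:R^-1) +
      n%:R^-1 * expR ((dotv (delta_mx k 0) x / (2 * Kx)) ^+ 2))%:E)%E).
      apply: le_integral_EFin.
      - by move=> x; exact: expR_ge0.
      - move=> x; rewrite dotv_delta.
        have -> : (- l * x k 0) ^+ 2 * (c2 * c sigma) / 2 =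
            n%:R^-1 * (x k 0 / (2 * Kx)) ^+ 2.
          have -> : n%:R^-1 = n%:R^-1 * (l ^+ 2 * (2 * (c2 * c sigma) * Kx ^+ 2 * n%:R)).
            by rewrite lE mulr1.
          by field; rewrite !gt_eqF.
        by apply: expR_chord; rewrite invr_ge0 ltW//= invf_le1// ler1n.
      - apply: (measurableT_comp (@measurable_expR R)); apply: measurable_funM => //.
        by apply: measurable_funM => //; exact: measurable_funX.
      - apply: measurable_funD => //; apply: measurable_funM => //.
        apply: (measurableT_comp (@measurable_expR R)); apply: measurable_funX.
        by apply: measurable_funM => //; exact: measurable_dotl.
    have mE : measurable_fun [set: 'cV[R]_d]
        (fun x => expR ((dotv (delta_mx k 0) x / (2 * Kx)) ^+ 2)).
      apply: (measurableT_comp (@measurable_expR R)); apply: measurable_funX.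
      by apply: measurable_funM => //; exact: measurable_dotl.
    have n1 : 0 <= 1 - n%:R^-1 :> R by rewrite subr_ge0 invf_le1// ler1n.
    rewrite integralD_nneg; [|by []| |by []|exact: measurable_funM]; last first.
      by move=> x; rewrite mulr_ge0 ?expR_ge0 ?invr_ge0// ltW.
    rewrite integral_cst// [X in (_ * X)%E]probability_setT mule1.
    rewrite integralZl_nneg; [|by rewrite invr_ge0 ltW|by move=> x; exact: expR_ge0|by []].
    apply: (@le_trans _ _ ((1 - n%:R^-1)%:E + (n%:R^-1)%:E * 2%:E)%E).
      apply: leeD => //; apply: lee_wpmul2l; first by rewrite lee_fin invr_ge0 ltW.
      by apply: (design_exp_sqr Kx0 hD); rewrite l2norm_delta.
    by rewrite -EFinM -EFinD lee_fin; lra.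
  rewrite (eq_integral (fun o => (\prod_(i < n) expR (l * xi k (Z i o)))%:E)); last first.
    by move=> o _; rewrite /S mulr_sumr expR_sum.
  apply: (le_trans (independent_prod_le (f := fun z => expR (l * xi k z)) hZ.1 _ (fun z => expR_ge0 _) _ h1)) => //.
  rewrite lee_fin card_ord; apply: le_trans expR1_le4.
  have -> : expR 1 = expR (n%:R^-1) ^+ n :> R.
    by rewrite -expRM_natl mulfV// gt_eqF.
  by rewrite lerXn2r ?nnegrE ?expR_ge0 ?addr_ge0 ?invr_ge0 ?ler0n// expR_ge1Dx.
have q0 : 0 < 2 * (c2 * c sigma) * Kx ^+ 2 * n%:R.
  by rewrite mulr_gt0// mulr_gt0 ?exprn_gt0// mulr_gt0.
have [l [l0 lE]] : exists l : R, 0 < l /\ l ^+ 2 * (2 * (c2 * c sigma) * Kx ^+ 2 * n%:R) = 1.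
  exists (Num.sqrt (2 * (c2 * c sigma) * Kx ^+ 2 * n%:R)^-1).
  rewrite sqrtr_gt0 invr_gt0; split => //.
  by rewrite sqr_sqrtr ?invr_ge0 ?ltW// mulVf// gt_eqF.
have mes (a : R) : measurable_fun [set: Om] (fun o => expR (a * S k o)).
  by apply: (measurableT_comp (@measurable_expR R)); exact: measurable_funM.
apply: (@le_trans _ _ (\int[P]_o ((2 / l ^+ 2) * (expR (l * S k o) + expR (- l * S k o)))%:E)%E).
  apply: le_integral_EFin.
  - by move=> o; exact: sqr_ge0.
  - move=> o; rewrite -/(S k o) mulrAC ler_pdivlMr ?exprn_gt0// mulNr.
    by rewrite -exprMn [S k o * l]mulrC; exact: sqr_le_expR.
  - exact: measurable_funX.
  - by apply: measurable_funM => //; exact: measurable_funD.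
rewrite integralZl_nneg; [|by rewrite divr_ge0// sqr_ge0|
  by move=> o; rewrite addr_ge0 ?expR_ge0|exact: measurable_funD].
rewrite integralD_nneg; [|by move=> o; exact: expR_ge0|by move=> o; exact: expR_ge0|by []|by []].
apply: (@le_trans _ _ ((2 / l ^+ 2)%:E * (4%:E + 4%:E))%E).
  apply: lee_wpmul2l; first by rewrite lee_fin divr_ge0// sqr_ge0.
  by apply: leeD; apply: mgf; rewrite ?sqrrN.
rewrite -EFinD -EFinM lee_fin le_eqVlt; apply/orP; left; apply/eqP.
have -> : 32 * (c2 * c sigma) * Kx ^+ 2 * n%:R =
  16 * (l ^+ 2 * (2 * (c2 * c sigma) * Kx ^+ 2 * n%:R)) / l ^+ 2.
  by field; rewrite gt_eqF.
by rewrite lE; field; rewrite gt_eqF.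
Qed.

Lemma score_sqr_norm : (0 < n)%N ->
  (\int[P]_o (l2norm (score psi (fun i => Z i o) b) ^+ 2)%:E <=
   (32 * (c2 * c sigma) * Kx ^+ 2 * (d%:R / n%:R))%:E)%E.
Proof.
move=> n_gt0.
have n0 : 0 < n%:R :> R by rewrite ltr0n.
rewrite (eq_integral (fun o => (n%:R ^- 2 * \sum_(k < d) S k o ^+ 2)%:E)); last first.
  move=> o _; congr EFin; rewrite sqr_l2norm /score dotvZl dotvZr dotvE mulrA -invfM.
  rewrite -expr2; congr (_ * _); apply: eq_bigr => k _; rewrite summxE -expr2.
  by congr (_ ^+ 2); apply: eq_bigr => i _; rewrite mxE.
have mS2 : measurable_fun [set: Om] (fun o => \sum_(k < d) S k o ^+ 2).
  by apply: measurable_sum => k; exact: measurable_funX.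
rewrite integralZl_nneg; [|by rewrite invr_ge0 sqr_ge0|
  by move=> o; apply: sumr_ge0 => k _; exact: sqr_ge0|by []].
rewrite integral_sum_nneg; [|by move=> k o; exact: sqr_ge0|by move=> k; exact: measurable_funX].
apply: (@le_trans _ _ ((n%:R ^- 2)%:E *
    \sum_(k < d) (32 * (c2 * c sigma) * Kx ^+ 2 * n%:R)%:E)%E).
  apply: lee_wpmul2l; first by rewrite lee_fin invr_ge0 sqr_ge0.
  by apply: lee_sum => k _; exact: score_coord_sqr.
rewrite sumEFin -EFinM lee_fin sumr_const card_ord -mulr_natl.
rewrite le_eqVlt; apply/orP; left; apply/eqP.
by field; rewrite gt_eqF.
Qed.

End sample.

(** * Mean squared error over data and noise *)

Section product_marginals.
Context {R : realType} d (T : measurableType d) d' (T' : measurableType d').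
Variables (P : probability T R) (Q : probability T' R).
Local Open Scope ereal_scope.

Lemma product_integral_fst (f : T -> R) : (forall x, (0 <= f x)%R) ->
  measurable_fun [set: T] f ->
  \int[P \x Q]_z (f z.1)%:E = \int[P]_x (f x)%:E.
Proof.
move=> f0 mf; rewrite fubini_tonelli1; [|by apply/measurable_EFinP; exact: measurableT_comp|
  by move=> z; rewrite lee_fin].
apply: eq_integral => x _; rewrite /fubini_F/=.
rewrite (eq_integral (cst (f x)%:E))// integral_cst//.
by rewrite [X in _ * X]probability_setT mule1.
Qed.

Lemma product_integral_snd (f : T' -> R) : (forall x, (0 <= f x)%R) ->
  measurable_fun [set: T'] f ->
  \int[P \x Q]_z (f z.2)%:E = \int[Q]_x (f x)%:E.
Proof.
move=> f0 mf; rewrite fubini_tonelli2; [|by apply/measurable_EFinP; exact: measurableT_comp|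
  by move=> z; rewrite lee_fin].
apply: eq_integral => x _; rewrite /fubini_G/=.
rewrite (eq_integral (cst (f x)%:E))// integral_cst//.
by rewrite [X in _ * X]probability_setT mule1.
Qed.

Lemma product_setT : (P \x Q) setT = 1.
Proof.
rewrite -[LHS]mul1e -integral_cst//; transitivity (\int[P]_x (1%R)%:E).
  exact: (product_integral_fst (f := fun=> 1%R)).
by rewrite integral_cst// mul1e; exact: probability_setT.
Qed.

End product_marginals.

Section expectation_bound.
Context {R : realType} (d n : nat).
Variables (psi chi : R -> R) (c2 c3 : R).
Hypotheses (hpsi : link_assumption psi c2 c3) (hchi : cutoff chi).
Variables (b0 eta0 r Lx L : R).
Variables (alpha gamma rho : R) (bstar : 'cV[R]_d).
Hypotheses (b00 : 0 < b0) (r0 : 0 <= r).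
Hypotheses (alpha0 : 0 < alpha) (alpha_gamma : alpha <= gamma).
Hypotheses (rho0 : 0 < rho) (rho1 : rho < 1).
Hypothesis rhoE : (gamma - alpha) / (gamma + alpha) <= rho.
Hypothesis eta0E : eta0 = 2 / (alpha + gamma).
Hypothesis bstarb : l2norm bstar <= b0.
Hypothesis L1 : 1 <= L.
Variables (dO : measure_display) (Om : measurableType dO) (P : probability Om R).
Variables (dW : measure_display) (W : measurableType dW) (Q : probability W R).
Variables (Z : 'I_n -> {mfun Om >-> (R * 'cV[R]_d)%type}).
Variables (w : nat -> {mfun W >-> 'cV[R]_d}) (T : nat).

Variables (good : set Om) (p eG eN : R).
Hypothesis mgood : measurable good.
Hypothesis goodH : forall o, good o -> forall b : 'cV[R]_d, l2ball b0 b ->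
  let H := empirical_hessian psi chi L (fun i => (Z i o).2) b in
  loewner_le alpha%:M H /\ loewner_le H gamma%:M.
Hypothesis goodZ : forall o, good o -> forall i,
  [/\ l2norm (Z i o).2 <= Lx, `|(Z i o).1| <= r & `|dotv (Z i o).2 bstar| <= L].
Hypothesis good_prob : (P (~` good) <= p%:E)%E.
Hypothesis score_bound :
  (\int[P]_o (l2norm (score psi (fun i => Z i o) bstar) ^+ 2)%:E <= eG%:E)%E.
Hypothesis eN0 : 0 <= eN.
Hypothesis noise_bound : forall s, (s < T)%N ->
  (\int[Q]_o (l2norm (w s o) ^+ 2)%:E <= eN%:E)%E.

Local Notation pgd D o t := (noisy_pgd psi chi b0 eta0 r Lx L 0 D (fun s => w s o) t).

Lemma measurable_score :
  measurable_fun [set: Om] (fun o => score psi (fun i => Z i o) bstar).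
Proof.
apply: measurable_scalev => //; apply: measurable_sumv => i; apply: measurable_scalev.
  apply: measurable_funB.
    apply: (measurableT_comp (continuous_measurable_fun (continuous_dlink hpsi))).
    by apply: measurable_dotv => //; exact: (measurableT_comp measurable_snd).
  exact: (measurableT_comp measurable_fst).
exact: (measurableT_comp measurable_snd).
Qed.

(** On the good event the deterministic bound [noisy_pgd_sqr_bound] holds; off it, iterate and
    target lie in the same ball, so the squared error is at most [4 b0^2]. The majorant [F]
    separates data and noise, and each part integrates to a marginal expectation. *)
Lemma noisy_pgd_expectation_bound :
  (\int[P \x Q]_z (l2norm (pgd (fun i => Z i z.1) z.2 T - bstar) ^+ 2)%:E <=
   (4 * b0 ^+ 2 * p + rho ^+ T * b0 ^+ 2 +
    2 / (1 - rho) ^+ 2 * (eta0 ^+ 2 * eG + eN))%:E)%E.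
Proof.
have q0 : 0 < 1 - rho by rewrite subr_gt0.
pose g o := eta0 ^+ 2 * l2norm (score psi (fun i => Z i o) bstar) ^+ 2.
pose e s o := l2norm (w s o) ^+ 2.
have g0 o : 0 <= g o by rewrite mulr_ge0 ?sqr_ge0.
have e0 s o : 0 <= e s o by exact: sqr_ge0.
have mg : measurable_fun [set: Om] g.
  apply: measurable_funM => //; apply: measurable_funX; apply: measurable_l2norm.
  exact: measurable_score.
have me s : measurable_fun [set: W] (e s).
  by apply: measurable_funX; exact: measurable_l2norm.
pose k (s : 'I_T) := rho ^+ (T - s.+1) * (2 / (1 - rho)).
have k0 s : 0 <= k s.
  by apply: mulr_ge0; [apply: exprn_ge0; exact: ltW|apply: divr_ge0 => //; exact: ltW].
pose a := rho ^+ T * b0 ^+ 2.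
have a0 : 0 <= a by apply: mulr_ge0; [apply: exprn_ge0; exact: ltW|exact: sqr_ge0].
pose bad o : R := 4 * b0 ^+ 2 * \1_(~` good) o.
have mbad : measurable_fun [set: Om] bad.
  by apply: measurable_funM => //; apply: measurable_indic; exact: measurableC.
have bad0 o : 0 <= bad o by rewrite mulr_ge0// mulr_ge0// sqr_ge0.
pose F (z : Om * W) := (bad z.1 + a) + \sum_(s < T) (k s * g z.1 + k s * e s z.2).
have mfst (f : Om -> R) : measurable_fun [set: Om] f ->
    measurable_fun [set: Om * W] (fun z => f z.1) by move=> mf; exact: measurableT_comp.
have msnd (f : W -> R) : measurable_fun [set: W] f ->
    measurable_fun [set: Om * W] (fun z => f z.2) by move=> mf; exact: measurableT_comp.
have mk1 s : measurable_fun [set: Om * W] (fun z => k s * g z.1).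
  by apply: measurable_funM => //; exact: mfst.
have mk2 s : measurable_fun [set: Om * W] (fun z => k s * e s z.2).
  by apply: measurable_funM => //; exact: msnd.
have mks s : measurable_fun [set: Om * W] (fun z => k s * g z.1 + k s * e s z.2).
  exact: measurable_funD.
have ks0 s z : 0 <= k s * g z.1 + k s * e s z.2.
  by rewrite addr_ge0// mulr_ge0.
have mba : measurable_fun [set: Om * W] (fun z => bad z.1 + a).
  by apply: measurable_funD => //; exact: mfst.
have mF : measurable_fun [set: Om * W] F.
  by apply: measurable_funD => //; exact: measurable_sum.
have mM : measurable_fun [set: Om * W] (fun z => pgd (fun i => Z i z.1) z.2 T).
  apply: (measurable_noisy_pgd hpsi hchi _ _ _ (ltW b00) r0 T
    (D := fun (z : Om * W) i => Z i z.1) (w := fun s (z : Om * W) => w s z.2)).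
    by move=> i; exact: measurableT_comp.
  by move=> s; exact: measurableT_comp.
have ptw z : l2norm (pgd (fun i => Z i z.1) z.2 T - bstar) ^+ 2 <= F z.
  have s0 : 0 <= \sum_(s < T) (k s * g z.1 + k s * e s z.2).
    by apply: sumr_ge0 => s _; exact: ks0.
  rewrite /F /bad indicE; have [gz|bz] := pselect (good z.1).
    rewrite memNset; last by move=> /(_ gz).
    rewrite mulr0 add0r; have hz := goodZ gz.
    have := noisy_pgd_sqr_bound hpsi hchi (fun s => w s z.2) b00 alpha0 alpha_gamma
      rho0 rho1 rhoE eta0E bstarb (goodH gz)
      (fun i => let: And3 h _ _ := hz i in h) (fun i => let: And3 _ h _ := hz i in h)
      (fun i => let: And3 _ _ h := hz i in h) L1 T.
    move=> /le_trans; apply; rewrite -/a lerD2l; apply: ler_sum => s _.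
    by rewrite -[leRHS]mulrDr /k -[leRHS]mulrA.
  rewrite mem_set// mulr1.
  have h : l2norm (pgd (fun i => Z i z.1) z.2 T - bstar) <= 2 * b0.
    rewrite (le_trans (l2normD _ _))// l2normN mulr2n mulrDl mul1r; apply: lerD => //.
    by apply: noisy_pgd_ball.
  have : l2norm (pgd (fun i => Z i z.1) z.2 T - bstar) ^+ 2 <= (2 * b0) ^+ 2.
    by rewrite lerXn2r// nnegrE ?l2norm_ge0// (le_trans _ h)// l2norm_ge0.
  by rewrite exprMn; lra.
apply: (@le_trans _ _ (\int[P \x Q]_z (F z)%:E)%E).
  apply: le_integral_EFin => //; first by move=> z; exact: sqr_ge0.
  apply: measurable_funX; apply: measurable_l2norm; apply: measurable_addv => //.
rewrite integralD_nneg//; [|by move=> z; rewrite addr_ge0|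
  by move=> z; apply: sumr_ge0 => s _; exact: ks0|exact: measurable_sum].
rewrite integralD_nneg//; last exact: mfst.
have -> : (\int[P \x Q]__  a%:E = a%:E)%E.
  rewrite integral_cst// -[RHS]mule1; congr (_ * _)%E; exact: product_setT. 
rewrite integral_sum_nneg//.
have -> : (\int[P \x Q]_z (bad z.1)%:E = (4 * b0 ^+ 2)%:E * P (~` good))%E.
  rewrite (product_integral_fst P Q bad0 mbad) integralZl_nneg//.
  - by rewrite integral_indic ?setIT//; exact: measurableC.
  - by rewrite mulr_ge0 ?sqr_ge0.
  - by apply: measurable_indic; exact: measurableC.
have sumk : \sum_(s < T) k s <= 2 / (1 - rho) ^+ 2.
  have -> : 2 / (1 - rho) ^+ 2 = (1 - rho)^-1 * (2 / (1 - rho)).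
    by field; rewrite gt_eqF.
  rewrite -mulr_suml ler_wpM2r//; first by rewrite divr_ge0// ltW.
  (* Reversing time turns the weights [rho ^+ (T - s.+1)] into a geometric series. *)
  rewrite (reindex_inj rev_ord_inj)/= (eq_bigr (fun s : 'I_T => rho ^+ s)); last first.
    by move=> s _; congr (_ ^+ _); rewrite subnSK// subKn// ltnW.
  rewrite -[leRHS]mul1r ler_pdivlMr// mulrC.
  have := subrX1 rho T; have : 0 <= rho ^+ T by apply: exprn_ge0; exact: ltW.
  lra.
have EG : (\int[P]_o (g o)%:E <= (eta0 ^+ 2 * eG)%:E)%E.
  rewrite integralZl_nneg; [|exact: sqr_ge0|by move=> o; exact: sqr_ge0|].
    by rewrite [leRHS]EFinM lee_wpmul2l// lee_fin sqr_ge0.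
  by apply: measurable_funX; apply: measurable_l2norm; exact: measurable_score.
have term (s : 'I_T) : (\int[P \x Q]_z (k s * g z.1 + k s * e s z.2)%:E <=
    (k s * (eta0 ^+ 2 * eG + eN))%:E)%E.
  rewrite integralD_nneg//; [|by move=> z; rewrite mulr_ge0|by move=> z; rewrite mulr_ge0].
  rewrite (integralZl_nneg _ (k0 s) (fun z => g0 z.1) (mfst _ mg)).
  rewrite (integralZl_nneg _ (k0 s) (fun z => e0 s z.2) (msnd _ (me s))).
  rewrite product_integral_fst// product_integral_snd// mulrDr EFinD !EFinM.
  by apply: leeD; apply: lee_wpmul2l; rewrite ?lee_fin ?k0//; exact: noise_bound.
rewrite 2!EFinD; apply: leeD; first apply: leeD => //.
  by rewrite [leRHS]EFinM; apply: lee_wpmul2l => //; rewrite lee_fin mulr_ge0 ?sqr_ge0.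
apply: (@le_trans _ _ (\sum_(s < T) (k s * (eta0 ^+ 2 * eG + eN))%:E)%E).
  by apply: lee_sum => s _; exact: term.
rewrite sumEFin lee_fin -mulr_suml ler_wpM2r//.
have eG0 : 0 <= eG.
  rewrite -lee_fin; apply: (le_trans _ score_bound); apply: integral_ge0 => o _.
  by rewrite lee_fin sqr_ge0.
by rewrite addr_ge0// mulr_ge0 ?sqr_ge0.
Qed.

End expectation_bound.

(** * Probability of the good event *)

Section good_event.
Context {R : realType} (d n : nat).
Variables (fx : probability 'cV[R]_d R) (nu : {measure set R -> \bar R}).
Variables (psi chi : R -> R) (h : R -> R -> R) (c : R -> R) (sigma C Kx c2 c3 : R).
Variables (b : 'cV[R]_d).
Variables (dO : measure_display) (Om : measurableType dO) (P : probability Om R).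
Variables (Z : 'I_n -> {mfun Om >-> (R * 'cV[R]_d)%type}).
Hypotheses (hpsi : link_assumption psi c2 c3) (hchi : cutoff chi) (cs0 : 0 < c sigma).
Hypothesis hpdf : forall theta, is_pdf nu (glm_pdf psi h c sigma theta).
Hypotheses (Kx0 : 0 < Kx) (hD : design_assumption fx C Kx).
Hypothesis hZ : glm_sample fx nu psi h c sigma b P Z.
Variables (b0 L Lx alpha gamma Cx Cpsi : R).
Hypotheses (b00 : 0 < b0) (bb : l2norm b <= b0) (d_gt0 : (0 < d)%N) (n_gt0 : (0 < n)%N).
Hypotheses (Cx12 : 12 <= Cx) (Cpsi4 : 4 <= Cpsi) (L1 : 1 <= L).
Hypothesis LxE : Lx = Cx * Kx * Num.sqrt (d%:R + ln n%:R).
Hypothesis L_ge : Cpsi * Kx * b0 * Num.sqrt (ln n%:R) <= L.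
Hypothesis hess_prob : ((1 - n%:R ^- 2)%:E <=
  P (hessian_event (fun i o => (Z i o).2) psi chi L b0 alpha gamma))%E.

Let hess := hessian_event (fun i o => (Z i o).2) psi chi L b0 alpha gamma.
Let s := Num.sqrt (6 * c2 * c sigma * ln n%:R).
Let tailx i := [set o | Lx <= l2norm (Z i o).2].
Let taily i := [set o | s <= `|(Z i o).1 - psi^`()%classic (dotv (Z i o).2 b)|].
Let tailb i := [set o | L / b0 <= `|dotv (b0^-1 *: b) (Z i o).2|].

Let n0 : 0 < n%:R :> R. Proof. by rewrite ltr0n. Qed.
Let ln0 : 0 <= ln n%:R :> R. Proof. exact: ln_nat_ge0. Qed.

(** Common target of the three tails: probability of order [n^-2] per record, which survives the
    union over [n] records. *)
Let tail_prob (T : 'I_n -> set Om) (e : R) : 2 * ln n%:R <= e ->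
  (forall i, (P (T i) <= (2 * expR (- e))%:E)%E) ->
  forall i, (P (T i) <= (2 * n%:R ^- 2)%:E)%E.
Proof.
move=> he hT i; apply: (le_trans (hT i)); rewrite lee_fin ler_pM2l//.
by rewrite -expRN_ln_nat// ler_expR lerN2.
Qed.

Let mtailx i : measurable (tailx i).
Proof.
apply: measurable_ge_set; apply: measurable_l2norm.
exact: (measurableT_comp measurable_snd).
Qed.

Let mtaily i : measurable (taily i).
Proof.
apply: measurable_ge_set; apply: measurableT_comp => //; apply: measurable_funB.
  exact: (measurableT_comp measurable_fst).
apply: (measurableT_comp (continuous_measurable_fun (continuous_dlink hpsi))).
by apply: measurable_dotv => //; exact: (measurableT_comp measurable_snd).
Qed.

Let mtailb i : measurable (tailb i).
Proof.
apply: measurable_ge_set; apply: measurableT_comp => //; apply: measurable_dotv => //.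
exact: (measurableT_comp measurable_snd).
Qed.

Let law i (A : set 'cV[R]_d) : measurable A ->
  P [set o | A (Z i o).2] = fx A.
Proof.
move=> mA; transitivity (\int[P]_o (\1_A (Z i o).2 : R)%:E)%E.
  by rewrite (integral_indic_comp P (X := fun o => (Z i o).2))//;
    exact: (measurableT_comp measurable_snd).
rewrite (glm_sample_design_integral hpsi cs0 hpdf hZ i (g := \1_A)); [|by []|
  exact: measurable_indic].
by rewrite integral_indic// setIT.
Qed.

Let tailx_prob i : (P (tailx i) <= (2 * n%:R ^- 2)%:E)%E.
Proof.
have d0 : 0 < d%:R + ln n%:R :> R by rewrite ltr_pwDl// ltr0n.
have Lx0 : 0 < Lx.
  rewrite LxE; apply: mulr_gt0; last by rewrite sqrtr_gt0.
  by apply: mulr_gt0 => //; apply: lt_le_trans Cx12.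
move: i; apply: (tail_prob (e := Lx ^+ 2 / (16 * Kx ^+ 2) - 6 * d%:R)).
  rewrite LxE exprMn exprMn sqr_sqrtr ?ltW//.
  have -> : Cx ^+ 2 * Kx ^+ 2 * (d%:R + ln n%:R) / (16 * Kx ^+ 2) =
    Cx ^+ 2 * (d%:R + ln n%:R) / 16 by field; rewrite gt_eqF.
  (* [Cx >= 12] gives the exponent [9 (d + ln n)], which pays the net entropy [6 d] and leaves more
     than [2 ln n]. *)
  have : 144 * (d%:R + ln n%:R) <= Cx ^+ 2 * (d%:R + ln n%:R).
    rewrite ler_pM2r//.
    have -> : 144 = 12 ^+ 2 :> R by ring.
    by rewrite lerXn2r ?nnegrE ?(le_trans _ Cx12)//.
  have : 0 <= d%:R :> R by []. have := ln0.
  lra.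
move=> i; rewrite (law i (A := [set x | Lx <= l2norm x])); last exact/measurable_ge_set/measurable_l2norm.
by rewrite opprB; exact: (design_norm_tail Kx0 hD).
Qed.

Let v0 : 0 < c2 * c sigma.
Proof. by rewrite mulr_gt0// (link_c2_gt0 hpsi). Qed.

Let taily_prob i : (P (taily i) <= (2 * n%:R ^- 2)%:E)%E.
Proof.
move: i; apply: (tail_prob (e := s ^+ 2 / (2 * (c2 * c sigma)))).
  rewrite sqr_sqrtr; last by rewrite mulr_ge0// -mulrA mulr_ge0// ltW.
  have -> : 6 * c2 * c sigma * ln n%:R / (2 * (c2 * c sigma)) = 3 * ln n%:R.
    by field; rewrite gt_eqF//= gt_eqF// (link_c2_gt0 hpsi).
  have := ln0; lra.
by move=> i; apply: (glm_residual_tail hpsi cs0 hpdf hZ); exact: sqrtr_ge0.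
Qed.

Let tailb_prob i : (P (tailb i) <= (2 * n%:R ^- 2)%:E)%E.
Proof.
have Lb0 : 0 <= L / b0 by rewrite divr_ge0 ?ltW// (lt_le_trans ltr01).
move: i; apply: (tail_prob (e := (L / b0) ^+ 2 / (4 * Kx ^+ 2))).
  have h1 : (Cpsi * Kx * Num.sqrt (ln n%:R)) ^+ 2 <= (L / b0) ^+ 2.
    rewrite lerXn2r ?nnegrE//.
      apply: mulr_ge0; last exact: sqrtr_ge0.
      by apply: mulr_ge0; [exact: le_trans Cpsi4|exact: ltW].
    by rewrite ler_pdivlMr//; apply: le_trans L_ge; rewrite mulrAC.
  rewrite ler_pdivlMr; last by rewrite mulr_gt0// exprn_gt0.
  apply: le_trans h1; rewrite exprMn exprMn sqr_sqrtr//.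
  have K2 : 0 < Kx ^+ 2 by rewrite exprn_gt0.
  have : 16 <= Cpsi ^+ 2.
    have -> : 16 = 4 ^+ 2 :> R by ring.
    by rewrite lerXn2r ?nnegrE ?(le_trans _ Cpsi4)//.
  have : 0 <= Kx ^+ 2 * ln n%:R by rewrite mulr_ge0// ltW.
  nra.
move=> i; rewrite (law i (A := [set x | L / b0 <= `|dotv (b0^-1 *: b) x|])); last first.
  by apply: measurable_ge_set; apply: measurableT_comp => //; exact: measurable_dotl.
apply: (design_tail Kx0 hD) => //.
by rewrite l2normZ gtr0_norm ?invr_gt0// mulrC ler_pdivrMr// mul1r.
Qed.

(** Intersection of the Hessian event with the complements of three tail events per record. The
    bound on the response follows from the residual tail together with [dlink_growth] at
    [|<x, b>| <= L]. *)
Lemma glm_good_event : exists good : set Om,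
  [/\ measurable good,
     forall o, good o -> forall b' : 'cV[R]_d, l2ball b0 b' ->
       let H := empirical_hessian psi chi L (fun i => (Z i o).2) b' in
       loewner_le alpha%:M H /\ loewner_le H gamma%:M,
     forall o, good o -> forall i,
       [/\ l2norm (Z i o).2 <= Lx,
           `|(Z i o).1| <= `|psi^`()%classic 0| + c2 * L +
             Num.sqrt (6 * c2 * c sigma * ln n%:R) &
           `|dotv (Z i o).2 b| <= L] &
     (P (~` good) <= (8 / n%:R)%:E)%E].
Proof.
have mhess : measurable hess.
  apply: (measurable_hessian_event (X := fun i o => (Z i o).2) _ _ _ _ _ hpsi hchi).
  by move=> i; exact: (measurableT_comp measurable_snd).
exists (hess `&` [set o | forall i, ~ tailx i o /\ ~ taily i o /\ ~ tailb i o]).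
pose U (k : 'I_3) i := if k == 0 :> nat then tailx i else if k == 1 :> nat then taily i
  else tailb i.
have mU k i : measurable (U k i) by rewrite /U; do 2 case: ifP => // _.
have UP k i : (P (U k i) <= (2 * n%:R ^- 2)%:E)%E by rewrite /U; do 2 case: ifP => // _.
have badE : ~` (hess `&` [set o | forall i, ~ tailx i o /\ ~ taily i o /\ ~ tailb i o]) `<=`
   ~` hess `|` \bigcup_(ki in [set: 'I_3 * 'I_n]) U ki.1 ki.2.
  move=> o /= ho; apply: contrapT => h2; apply: ho; split.
    by apply: contrapT => h3; apply: h2; left.
  move=> i; split; first by move=> h3; apply: h2; right; exists (0, i).
  split; first by move=> h3; apply: h2; right; exists (1, i).
  by move=> h3; apply: h2; right; exists (2, i).
have mgood : measurable (hess `&` [set o | forall i, ~ tailx i o /\ ~ taily i o /\ ~ tailb i o]).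
  apply: measurableI => //.
  rewrite (_ : [set _ | _] = \bigcap_(i in [set: 'I_n]) (~` tailx i `&` (~` taily i `&` ~` tailb i))); last first.
    by apply/seteqP; split=> o /= ho i; [move=> _; exact: ho|exact: ho].
  by apply: fin_bigcap_measurable => // i _; do 2 (apply: measurableI; first exact: measurableC);
    exact: measurableC.
split.
- by [].
- by move=> o [].
- move=> o [_ ho] i; have [/negP + [/negP + /negP]] := ho i.
  rewrite -!ltNge => hx hy hb.
  have hL : `|dotv (Z i o).2 b| <= L.
    move: hb; rewrite dotvZl normrM gtr0_norm ?invr_gt0// ltr_pdivlMr//.
    by rewrite mulrAC mulVf ?gt_eqF// mul1r dotvC => /ltW.
  split => //; first exact: ltW.
  have -> : (Z i o).1 = psi^`()%classic (dotv (Z i o).2 b) +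
     ((Z i o).1 - psi^`()%classic (dotv (Z i o).2 b)) by rewrite addrC subrK.
  apply: (le_trans (ler_normD _ _)); apply: lerD; last exact: ltW.
  apply: (le_trans (dlink_growth hpsi _)); rewrite lerD2l ler_pM2l//.
  exact: (link_c2_gt0 hpsi).
pose B (ki : option ('I_3 * 'I_n)) := if ki is Some p then U p.1 p.2 else ~` hess.
have mB ki : measurable (B ki) by case: ki => [[k i]|]; [exact: mU|exact: measurableC].
apply: (@le_trans _ _ (\sum_(ki : option ('I_3 * 'I_n)) P (B ki))%E).
  apply: measure_union_bound => // [|o ho].
    exact: measurableC.
  have [h1|[ki _ h1]] := badE o ho; first by exists None.
  by exists (Some ki).
apply: (@le_trans _ _ (\sum_(ki : option ('I_3 * 'I_n)) (2 * n%:R ^- 2)%:E)%E).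
  apply: lee_sum => -[[k i]|] _; first exact: UP.
  rewrite /B probability_setC//; move: hess_prob; rewrite -/hess.
  rewrite -(fineK (fin_num_measure P _ mhess)) -EFinB !lee_fin => h1.
  have : 0 <= n%:R ^- 2 :> R by rewrite invr_ge0 sqr_ge0.
  lra.
rewrite sumEFin lee_fin sumr_const card_option card_prod !card_ord.
rewrite -(mulr_natl _ (3 * n).+1) -natr1 natrM.
(* There are [3 n] tail events and the failure of the Hessian event, each charged [2 / n^2]; as
   [n >= 1], the total is at most [8 / n]. *)
have -> : (3 * n%:R + 1) * (2 * n%:R ^- 2) = (6 * n%:R + 2) / n%:R / n%:R :> R.
  by field; rewrite gt_eqF.
have n1 : 1 <= n%:R :> R by rewrite ler1n.
rewrite ler_pM2r ?invr_gt0// ler_pdivrMr//; lra.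
Qed.

End good_event.

(** * Orders of magnitude of the tuning parameters *)

Section parameters.
Context {R : realType}.

Lemma ln_nat_ge1 n : 4 <= n%:R :> R -> 1 <= ln n%:R :> R.
Proof.
move=> n4; rewrite -[leLHS](expRK (R := R)) ler_ln ?posrE ?expR_gt0//.
  exact: le_trans expR1_le4 n4.
by rewrite (lt_le_trans _ n4).
Qed.

(** The condition gives [n >= 3 (1 + ln n) >= 3]; then [ln n > 0] makes the inequality strict. With
    [n >= 4] one has [ln n >= 1], so constants can be absorbed into [ln n]. *)
Lemma sample_size_ge4 (C0 : R) d n : (0 < d)%N -> (0 < n)%N -> 3 <= C0 ->
  C0 * d%:R * ln (expR 1 * n%:R) <= n%:R -> 4 <= n%:R :> R.
Proof.
move=> d0 n0 C03; rewrite ln_expn1M// => h.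
have d1 : 1 <= d%:R :> R by rewrite ler1n.
have l0 : 0 <= ln n%:R :> R := ln_nat_ge0 n.
have h3 : 3 * (1 + ln n%:R) <= n%:R :> R.
  apply: le_trans h; rewrite ler_pM2r; last by rewrite ltr_pwDl.
  by rewrite -[leLHS]mulr1 ler_pM// (le_trans _ C03).
have n3 : (3 <= n)%N by rewrite -(ler_nat R); lra.
have : 0 < ln n%:R :> R by apply: ln_gt0; rewrite ltr1n (leq_trans _ n3).
move=> l1; have : 3%:R < n%:R :> R by lra.
by rewrite ltr_nat => n4; rewrite (ler_nat R 4 n).
Qed.

Lemma pgd_iterations (rho b0 : R) n : 0 < rho < 1 -> 0 < b0 -> 4 <= n%:R :> R ->
  let T := absz (Num.ceil (ln (Num.max (n%:R * b0) n%:R) / (- ln rho))) in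
  [/\ (0 < T)%N, rho ^+ T <= n%:R^-1 &
      T%:R <= ((1 + ln (Num.max b0 1)) / - ln rho + 1) * ln n%:R].
Proof.
move=> /andP[rho0 rho1] b00 n4 T.
have n0 : 0 < n%:R :> R by rewrite (lt_le_trans _ n4).
have l1 := ln_nat_ge1 n4.
have q0 : 0 < - ln rho by rewrite oppr_gt0 ln_lt0// rho0.
have m1 : 1 <= Num.max b0 1 by rewrite le_max lexx orbT.
have maxE : Num.max (n%:R * b0) n%:R = n%:R * Num.max b0 1.
  by rewrite -[X in Num.max _ X]mulr1 maxr_pMr ?ltW.
have m0 : 0 < Num.max b0 1 by rewrite (lt_le_trans _ m1).
have lnE : ln (Num.max (n%:R * b0) n%:R) = ln n%:R + ln (Num.max b0 1).
  by rewrite maxE lnM.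
have lm0 : 0 <= ln (Num.max b0 1) by rewrite ln_ge0.
set a := ln (Num.max (n%:R * b0) n%:R) / - ln rho in T *.
have a0 : 0 < a by rewrite divr_gt0// lnE; lra.
(* The ceiling is positive, so [absz] returns it unchanged. *)
have TE : T%:R = (Num.ceil a)%:~R :> R.
  rewrite /T natr_absz ger0_norm//; apply: ltW.
  by rewrite -(ltr_int R) (lt_le_trans a0)// ceil_ge.
have aT : a <= T%:R by rewrite TE ceil_ge.
split.
- by rewrite -(ltr_nat R) (lt_le_trans a0).
- rewrite -[rho]lnK// -expRM_natl -[n%:R]lnK// -expRN ler_expR.
  have : a * - ln rho <= T%:R * - ln rho by rewrite ler_pM2r.
  rewrite /a divfK ?gt_eqF// lnE; lra.
- have : T%:R < a + 1 by have := ceilB1_lt a; rewrite TE intrB; lra.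
  have : a <= (1 + ln (Num.max b0 1)) / - ln rho * ln n%:R.
    rewrite /a lnE mulrAC ler_pM2r ?invr_gt0//; nra.
  nra.
Qed.

Lemma noise_var_gt0 (eta0 B eps delta : R) n T :
  0 < eta0 -> 0 < B -> 0 < eps -> 0 < delta <= 1 -> (0 < n)%N -> (0 < T)%N ->
  0 < noise_var eta0 B eps delta n T.
Proof.
move=> h1 h2 h3 /andP[h4 h5] n0 T0.
have T1 : 1 <= T%:R :> R by rewrite ler1n.
have n1 : 0 < n%:R :> R by rewrite ltr0n.
have T1' : 0 < T%:R :> R by rewrite ltr0n.
have l0 : 0 < ln (2 * T%:R / delta) by rewrite ln_gt0// ltr_pdivlMr//; lra.
by rewrite /noise_var !(mulr_gt0, invr_gt0, exprn_gt0).
Qed.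

(** [B^2] contributes one factor [ln n] and [T^2] two. Since [delta <= 1 / n],
    [ln n <= ln (1 / delta)], so the term [ln (2 T)] is absorbed into [ln (1 / delta)]. *)
Lemma noise_var_le (eta0 B eps delta KB KT m : R) n T :
  0 < eps -> 0 < delta -> delta <= n%:R^-1 -> 4 <= n%:R :> R -> (0 < T)%N -> 0 <= m ->
  0 <= KB -> T%:R <= KT * ln n%:R -> B ^+ 2 <= KB * ln n%:R * m ->
  noise_var eta0 B eps delta n T <=
  eta0 ^+ 2 * (2 * KB * KT ^+ 2 * (2 * KT + 1)) *
    (m * ln (1 / delta) * ln n%:R ^+ 3 / (n%:R ^+ 2 * eps ^+ 2)).
Proof.
move=> e0 dl0 dln n4 T0 m0 KB0 hT hB.
have n0 : 0 < n%:R :> R by rewrite (lt_le_trans _ n4).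
have l1 := ln_nat_ge1 n4; set l := ln n%:R in l1 hT hB *.
have T0' : 0 < T%:R :> R by rewrite ltr0n.
have lD : l <= ln (1 / delta).
  rewrite ler_ln ?posrE ?divr_gt0// div1r -[leLHS]invrK lef_pV2 ?posrE ?invr_gt0//.
set D := ln (1 / delta) in lD *.
have KT0 : 0 < KT by nra.
have lnT : ln (2 * T%:R / delta) <= (2 * KT + 1) * D.
  rewrite -[_ / delta]mulrA -div1r mulrA lnM ?posrE ?mulr_gt0 ?divr_gt0 ?invr_gt0//.
  have : ln (2 * T%:R) <= 2 * T%:R :> R.
    by rewrite -ler_expR lnK ?posrE ?mulr_gt0//; have := expR_ge1Dx (2 * T%:R : R); lra.
  rewrite -/D; nra.
have lnT0 : 0 <= ln (2 * T%:R / delta).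
  have T1 : 1 <= T%:R :> R by rewrite ler1n.
  have : n%:R^-1 <= 1 :> R by rewrite invf_le1//; lra.
  by move=> n1; rewrite ln_ge0// ler_pdivlMr//; lra.
have -> : noise_var eta0 B eps delta n T = eta0 ^+ 2 * 2 * (B ^+ 2 * ln (2 * T%:R / delta) *
    T%:R ^+ 2) / (n%:R ^+ 2 * eps ^+ 2).
  by rewrite /noise_var; field; rewrite !gt_eqF.
rewrite [leRHS]mulrA ler_pM2r ?invr_gt0 ?mulr_gt0 ?exprn_gt0//.
have h : B ^+ 2 * ln (2 * T%:R / delta) * T%:R ^+ 2 <=
    (KB * l * m) * ((2 * KT + 1) * D) * (KT * l) ^+ 2.
  apply: ler_pM; [by rewrite mulr_ge0 ?sqr_ge0|exact: exprn_ge0| |].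
    by apply: ler_pM => //; exact: exprn_even_ge0.
  by rewrite lerXn2r ?nnegrE ?mulr_ge0// ltW// (lt_le_trans ltr01).
have -> : eta0 ^+ 2 * (2 * KB * KT ^+ 2 * (2 * KT + 1)) * (m * D * l ^+ 3) =
  eta0 ^+ 2 * 2 * ((KB * l * m) * ((2 * KT + 1) * D) * (KT * l) ^+ 2) by ring.
by rewrite ler_wpM2l// mulr_ge0 ?sqr_ge0.
Qed.

Lemma saturation_level_le (a c2 cs cmax Lpsi0 k l L : R) :
  0 <= a -> 0 < c2 -> 0 < cs -> cs <= cmax -> 0 <= Lpsi0 -> 0 <= k -> 1 <= l ->
  L = Lpsi0 + k * Num.sqrt l ->
  0 <= (a + c2 * L + Num.sqrt (6 * c2 * cs * l)) + (a + 2 * c2 * L) <=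
  (2 * a + 3 * c2 * (Lpsi0 + k) + Num.sqrt (6 * c2 * cmax)) * Num.sqrt l.
Proof.
move=> a0 c20 cs0 csmax L0 k0 l1 LE.
have l0 : 0 <= l by lra.
set q := Num.sqrt l in LE *.
have q1 : 1 <= q by rewrite -[leLHS]sqrtr1 ler_sqrt.
have hL : 0 <= L <= (Lpsi0 + k) * q.
  by rewrite LE; apply/andP; split; nra.
have h6 : 0 <= 6 * c2 * cs by rewrite !mulr_ge0// ltW.
rewrite sqrtrM// -/q.
have h7 : Num.sqrt (6 * c2 * cs) <= Num.sqrt (6 * c2 * cmax).
  by rewrite ler_wsqrtr// ler_wpM2l// mulr_ge0// ltW.
have := sqrtr_ge0 (6 * c2 * cs); move: h7.
move: (Num.sqrt (6 * c2 * cs)) (Num.sqrt _) => u v uv u0.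
move/andP: hL => [hL0 hL1].
have h8 : c2 * L <= c2 * ((Lpsi0 + k) * q) by rewrite ler_pM2l.
have h9 : 0 <= c2 * L by rewrite mulr_ge0// ltW.
by apply/andP; split; nra.
Qed.

(** Only the score term carries [c(sigma)]; the others are multiplied by [cs / cmin >= 1]. Terms of
    order [1 / n] are absorbed by [d / n]. *)
Lemma risk_constant_le (b0 K2 eta0 c2 cs cmin Kx Kv rT vn Y : R) (d n : nat) :
  0 <= K2 -> 0 < c2 -> 0 < cmin -> cmin <= cs -> 0 <= Kv -> 0 <= Y ->
  (0 < d)%N -> 0 < n%:R :> R -> rT <= n%:R^-1 -> vn <= Kv * Y ->
  4 * b0 ^+ 2 * (8 / n%:R) + rT * b0 ^+ 2 +
    K2 * (eta0 ^+ 2 * (32 * (c2 * cs) * Kx ^+ 2 * (d%:R / n%:R)) + d%:R * (8 * vn)) <=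
  (33 * b0 ^+ 2 / cmin + 32 * K2 * eta0 ^+ 2 * c2 * Kx ^+ 2 + 8 * K2 * Kv / cmin) * cs *
    (d%:R / n%:R + d%:R * Y).
Proof.
move=> K20 c20 cmin0 cs_ge Kv0 Y0 d_gt0 n0 hr hv.
have d1 : 1 <= d%:R :> R by rewrite ler1n.
set i := n%:R^-1 in hr *; have i0 : 0 < i by rewrite invr_gt0.
set x := d%:R in d1 *.
have iu : i <= x * i by rewrite ler_peMl// ltW.
have b20 : 0 <= b0 ^+ 2 := sqr_ge0 _.
have m1 : 1 <= cs / cmin by rewrite ler_pdivlMr// mul1r.
have h1 : 4 * b0 ^+ 2 * (8 * i) + rT * b0 ^+ 2 <= 33 * b0 ^+ 2 * (x * i).
  have : rT * b0 ^+ 2 <= i * b0 ^+ 2 by rewrite ler_wpM2r.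
  have : b0 ^+ 2 * i <= b0 ^+ 2 * (x * i) by rewrite ler_wpM2l.
  lra.
have h2 : x * (8 * vn) <= 8 * Kv * (x * Y).
  have : x * vn <= x * (Kv * Y) by rewrite ler_wpM2l// (le_trans ler01).
  lra.
have xY0 : 0 <= x * Y by rewrite mulr_ge0// (le_trans ler01).
have xi0 : 0 <= x * i by apply: le_trans iu; exact: ltW.
set A := 33 * b0 ^+ 2; set Bc := 32 * K2 * eta0 ^+ 2 * c2 * Kx ^+ 2.
set D := 8 * K2 * Kv.
have A0 : 0 <= A by rewrite mulr_ge0.
have D0 : 0 <= D by rewrite !mulr_ge0.
have B0 : 0 <= Bc.
  apply: mulr_ge0; last exact: sqr_ge0.
  apply: mulr_ge0; last exact: ltW.
  by apply: mulr_ge0; [exact: mulr_ge0|exact: sqr_ge0].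
have cs0 : 0 <= cs by rewrite (le_trans _ cs_ge)// ltW.
have -> : (A / cmin + Bc + D / cmin) * cs * (x * i + x * Y) =
   (A + D) * (cs / cmin) * (x * i + x * Y) + Bc * cs * (x * i) + Bc * cs * (x * Y).
  by ring.
have h3 : (A + D) * (x * i + x * Y) <= (A + D) * (cs / cmin) * (x * i + x * Y).
  apply: ler_wpM2r; first exact: addr_ge0.
  by rewrite ler_peMr// addr_ge0.
have h4 : 0 <= Bc * cs * (x * Y) by rewrite mulr_ge0// mulr_ge0.
have h5 : K2 * (x * (8 * vn)) <= D * (x * Y).
  have -> : D * (x * Y) = K2 * (8 * Kv * (x * Y)) by rewrite /D; ring.
  exact: ler_wpM2l.
have h6 : K2 * (eta0 ^+ 2 * (32 * (c2 * cs) * Kx ^+ 2 * (x * i))) = Bc * cs * (x * i).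
  by rewrite /Bc; ring.
have h7 : 0 <= A * (x * Y) by rewrite mulr_ge0.
have h8 : 0 <= D * (x * i) by rewrite mulr_ge0.
rewrite mulrDr h6; rewrite -/A in h1.
have := h3; have -> : (A + D) * (x * i + x * Y) =
  A * (x * i) + A * (x * Y) + D * (x * i) + D * (x * Y) by ring.
move: ((A + D) * (cs / cmin) * (x * i + x * Y)) h1 h4 h5 h7 h8.
move: (4 * b0 ^+ 2 * (8 * i) + _) (Bc * cs * (x * i)) (Bc * cs * (x * Y)) (K2 * _).
move: (A * (x * i)) (A * (x * Y)) (D * (x * i)) (D * (x * Y)) => y1 y2 y3 y4 x1 x2 x3 x4 t H1 H4 H5 H7 H8 H3. lra.
Qed.

End parameters.

Theorem theorem3p2 (R : realType) :
  exists Cx0 Cpsi0 : R,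
  forall (C Kx c2 c3 cmin cmax b0 : R) (psi chi : R -> R),
    0 < C -> 0 < Kx -> 0 < cmin -> 0 < b0 ->
    link_assumption psi c2 c3 -> cutoff chi ->
  exists alpha gamma C0 Lpsi0 : R,
  [/\ 0 < alpha, alpha <= gamma & 1 <= Lpsi0] /\
  forall Cx Cpsi : R, Cx0 <= Cx -> Cpsi0 <= Cpsi ->
  exists C' : R,
  forall (d n : nat) (fx : probability 'cV[R]_d R)
    (nu : {measure set R -> \bar R}) (h : R -> R -> R) (c : R -> R) (sigma : R)
    (dO : measure_display) (Om : measurableType dO)
    (P : 'cV[R]_d -> probability Om R)
    (Z : 'I_n -> {mfun Om >-> (R * 'cV[R]_d)%type}),
    (0 < d)%N -> (0 < n)%N ->
    cmin <= c sigma <= cmax ->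
    (forall theta, is_pdf nu (glm_pdf psi h c sigma theta)) ->
    design_assumption fx C Kx ->
    (forall b, l2ball b0 b -> glm_sample fx nu psi h c sigma b (P b) Z) ->
    C0 * d%:R * ln (expR 1 * n%:R) <= n%:R ->
  (forall (bstar : 'cV[R]_d) (Lpsi : R), l2ball b0 bstar -> Lpsi0 <= Lpsi ->
     ((1 - n%:R ^- 2)%:E <=
      P bstar [set o | forall b : 'cV[R]_d, l2ball b0 b ->
        let H := empirical_hessian psi chi Lpsi (fun i => (Z i o).2) b in
        loewner_le alpha%:M H /\ loewner_le H gamma%:M])%E) /\
  (forall eps delta : R, 0 < eps < 1 -> 0 < delta <= n%:R^-1 ->
     let eta0 := 2 / (alpha + gamma) in
     let Lx := Cx * Kx * Num.sqrt (d%:R + ln n%:R) in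
     let Lpsi := Lpsi0 + Cpsi * Kx * b0 * Num.sqrt (ln n%:R) in
     let Spsi := `|psi^`()%classic 0| + 2 * c2 * Lpsi in
     let r := `|psi^`()%classic 0| + c2 * Lpsi
              + Num.sqrt (6 * c2 * c sigma * ln n%:R) in
     let B := 4 * (r + Spsi) * Lx in
     let rho := Num.max (1 / 2) ((gamma - alpha) / (gamma + alpha)) in
     let T := absz (Num.ceil (ln (Num.max (n%:R * b0) n%:R) / (- ln rho))) in
     forall (dW : measure_display) (W : measurableType dW)
       (Q : probability W R) (w : nat -> {mfun W >-> 'cV[R]_d}),
       gaussian_noise Q w T (noise_var eta0 B eps delta n T) ->
     let M (D : 'I_n -> (R * 'cV[R]_d)%type) (o : W) : 'cV[R]_d :=
       noisy_pgd psi chi b0 eta0 r Lx Lpsi 0 D (fun t => w t o) T in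
     differentially_private Q M eps delta /\
     (ereal_sup
        [set 'E_((P bstar \x Q)%E)
               [fun o => (l2norm (M (fun i => Z i o.1) o.2 - bstar) ^+ 2)%R]
         | bstar in l2ball b0] <=
      (C' * c sigma *
        (d%:R / n%:R +
         d%:R * (d%:R + ln n%:R) * ln (1 / delta) * ln n%:R ^+ 3
         / (n%:R ^+ 2 * eps ^+ 2)))%:E)%E).
Proof.
(* The thresholds that make the tails of [|x i|] and [<x i, bstar>] of order [n^-2]. *)
exists 12, 4 => C Kx c2 c3 cmin cmax b0 psi chi C0 Kx0 cmin0 b00 hpsi hchi.
have [alpha [gamma [N0 [Lpsi0 [[a0 ag L1 N03] hess]]]]] :=
  hessian_event_prob C0 Kx0 b00 hpsi hchi.
exists alpha, gamma, N0, Lpsi0; split=> // Cx Cpsi Cx12 Cpsi4.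
have c20 := link_c2_gt0 hpsi.
pose eta := 2 / (alpha + gamma).
pose rate := Num.max (1 / 2) ((gamma - alpha) / (gamma + alpha)).
have s0 : 0 < alpha + gamma by rewrite addr_gt0// (lt_le_trans a0).
have eta_gt0 : 0 < eta by rewrite divr_gt0.
have rate01 : 0 < rate < 1.
  have s0' : 0 < gamma + alpha by rewrite addrC.
  have h : (gamma - alpha) / (gamma + alpha) < 1 by rewrite ltr_pdivrMr//; lra.
  by rewrite lt_max gt_max h; apply/andP; split; lra.
have [rate0 rate1] := andP rate01.
have rateE : (gamma - alpha) / (gamma + alpha) <= rate by rewrite le_max lexx orbT.
pose K1 := 2 * `|psi^`()%classic 0| + 3 * c2 * (Lpsi0 + Cpsi * Kx * b0) +
  Num.sqrt (6 * c2 * cmax).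
pose KB := 16 * K1 ^+ 2 * (Cx * Kx) ^+ 2.
pose KT := (1 + ln (Num.max b0 1)) / - ln rate + 1.
pose Kv := eta ^+ 2 * (2 * KB * KT ^+ 2 * (2 * KT + 1)).
pose K2 := 2 / (1 - rate) ^+ 2.
(* In order: failure event and bias ([33 = 4 * 8 + 1]), score, and privacy noise. *)
exists (33 * b0 ^+ 2 / cmin + 32 * K2 * eta ^+ 2 * c2 * Kx ^+ 2 + 8 * K2 * Kv / cmin).
move=> d n fx nu h c sigma dO Om P Z d_gt0 n_gt0 /andP[cs_ge cs_le] hpdf hD hZ hn.
have cs0 : 0 < c sigma by exact: lt_le_trans cs_ge.
have n4 := sample_size_ge4 d_gt0 n_gt0 N03 hn.
have n0 : 0 < n%:R :> R by rewrite ltr0n.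
have l1 := ln_nat_ge1 n4.
have hess_prob bstar L : l2ball b0 bstar -> Lpsi0 <= L ->
    ((1 - n%:R ^- 2)%:E <= P bstar
      (hessian_event (fun i o => (Z i o).2) psi chi L b0 alpha gamma))%E.
  move=> hb hL; apply: (hess d n fx) => //.
  - by move=> i; exact: (measurableT_comp measurable_snd).
  - exact: (glm_sample_design_independent (hZ _ hb)).
  - by move=> i g g0 mg; exact: (glm_sample_design_integral hpsi cs0 hpdf (hZ _ hb)).
split; first by move=> bstar L hb hL; exact: hess_prob.
move=> eps delta eps01 /andP[delta0 delta_le] eta0 Lx L S r B rho T dW W Q w hw M.
have [eps0 eps1] := andP eps01.
have Cpsi0 : 0 < Cpsi by exact: lt_le_trans Cpsi4.
have Cx0 : 0 < Cx by exact: lt_le_trans Cx12.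
have k0 : 0 <= Cpsi * Kx * b0 by rewrite !mulr_ge0// ltW.
have L_ge : Lpsi0 <= L by rewrite lerDl mulr_ge0// sqrtr_ge0.
have L1' : 1 <= L by exact: le_trans L_ge.
have L_ge' : Cpsi * Kx * b0 * Num.sqrt (ln n%:R) <= L.
  by rewrite lerDr (le_trans _ L1).
have Lpsi00 : 0 <= Lpsi0 by exact: le_trans L1.
have m0 : 0 < d%:R + ln n%:R :> R by rewrite ltr_pwDl ?ltr0n// ln_nat_ge0.
have Lx0 : 0 < Lx by rewrite mulr_gt0 ?sqrtr_gt0// mulr_gt0.
have r0 : 0 <= r.
  rewrite /r addr_ge0 ?sqrtr_ge0// addr_ge0// mulr_ge0 ?(ltW c20)//.
  exact: le_trans L1'.
have /andP[rS0 rS_le] := saturation_level_le (normr_ge0 (psi^`()%classic 0)) c20 cs0 cs_le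
  Lpsi00 k0 l1 (erefl L).
have B_le : B ^+ 2 <= KB * ln n%:R * (d%:R + ln n%:R).
  rewrite /B /Lx !exprMn sqr_sqrtr ?(ltW m0)//.
  have : (r + S) ^+ 2 <= K1 ^+ 2 * ln n%:R.
    rewrite -[X in _ <= _ * X]sqr_sqrtr ?(le_trans ler01)// -exprMn.
    by rewrite lerXn2r ?nnegrE// (le_trans rS0).
  move=> h1.
  have -> : KB * ln n%:R * (d%:R + ln n%:R) =
    4 ^+ 2 * (K1 ^+ 2 * ln n%:R) * (Cx ^+ 2 * Kx ^+ 2 * (d%:R + ln n%:R)).
    by rewrite /KB; ring.
  rewrite ler_pM2r; last by rewrite !mulr_gt0 ?exprn_gt0.
  by rewrite ler_pM2l// exprn_gt0.
have [T_gt0 rhoT T_le] := pgd_iterations rate01 b00 n4.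
have delta1 : delta <= 1 by rewrite (le_trans delta_le)// invf_le1//; lra.
split.
  apply: (noisy_pgd_private hpsi hchi (ltW b00) eta_gt0 r0 Lx0 L1' n_gt0 T_gt0 eps01 _ hw).
  by rewrite delta0.
have D0 : 0 <= ln (1 / delta) by rewrite ln_ge0// ler_pdivlMr// mul1r.
apply: ub_ereal_sup => _ /= [bstar hb <-].
have [good [mgood goodH goodZ good_prob]] := glm_good_event hpsi hchi cs0 hpdf Kx0 hD
  (hZ _ hb) b00 hb d_gt0 n_gt0 Cx12 Cpsi4 L1' (erefl Lx) L_ge' (hess_prob bstar L hb L_ge).
set v := noise_var _ _ _ _ _ _ in hw.
have B0 : 0 < B.
  rewrite /B; apply: mulr_gt0 => //; apply: mulr_gt0 => //; apply: ltr_wpDl => //.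
  rewrite ltr_wpDl// mulr_gt0// ?mulr_gt0//; exact: lt_le_trans L1'.
have v0 : 0 < v by apply: noise_var_gt0 => //; rewrite delta0.
have noise_bound s : (s < T)%N ->
    (\int[Q]_o (l2norm (w s o) ^+ 2)%:E <= (d%:R * (8 * v))%:E)%E.
  move=> sT; exact: (gaussian_sqr_norm (measurable_funP (w s)) v0
    (fun j A => noise_coord_law hw sT j (B := A))).
have vn0 : 0 <= d%:R * (8 * v) by rewrite mulr_ge0// mulr_ge0// ltW.
have main := noisy_pgd_expectation_bound hpsi hchi b00 r0 a0 ag rate0 rate1 rateE
  (erefl eta) hb L1' mgood goodH goodZ good_prob
  (score_sqr_norm hpsi cs0 hpdf Kx0 hD (hZ _ hb) n_gt0) vn0 noise_bound.
rewrite unlock; apply: (le_trans main); rewrite lee_fin.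
have KB0 : 0 <= KB by rewrite mulr_ge0 ?sqr_ge0// mulr_ge0 ?sqr_ge0.
have v_le := noise_var_le eta eps0 delta0 delta_le n4 T_gt0 (ltW m0) KB0 T_le B_le.
have KT0 : 0 <= KT.
  rewrite addr_ge0// divr_ge0//; last by rewrite oppr_ge0 ltW// ln_lt0.
  by rewrite addr_ge0// ln_ge0// le_max lexx orbT.
have Kv0 : 0 <= Kv.
  apply: mulr_ge0; first exact: sqr_ge0.
  apply: mulr_ge0; last by rewrite addr_ge0// mulr_ge0.
  by apply: mulr_ge0; [exact: mulr_ge0|exact: sqr_ge0].
have Y0 : 0 <= (d%:R + ln n%:R) * ln (1 / delta) * ln n%:R ^+ 3 / (n%:R ^+ 2 * eps ^+ 2).
  apply: divr_ge0; last by rewrite mulr_ge0 ?sqr_ge0.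
  apply: mulr_ge0; last by rewrite exprn_ge0// (le_trans ler01).
  by rewrite mulr_ge0// ltW.
have K20 : 0 <= K2 by rewrite divr_ge0// sqr_ge0.
have := risk_constant_le b0 eta Kx K20 c20 cmin0 cs_ge Kv0 Y0 d_gt0 n0 rhoT v_le.
by rewrite [d%:R * (_ / _)]mulrA !mulrA.
Qed.
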